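(* There is a universal constant $c>0$ such that for every $A>0$, $\epsilon>0$ and $\gamma>1$ there is a constant $C_{A,\epsilon,\gamma}$ with the following property. Let $N$ be a positive integer and let $\{\phi_n\}_{n=1}^{N}$ be an orthonormal system of real-valued functions on a probability space $\mathbb{T}$ with $|\phi_n(x)|\le A$ for all $n\in[N]$ and all $x\in\mathbb{T}$. Let $\sigma:[N]\to[N]$ be a uniformly random permutation. Then, with probability at least $1-cN^{-\gamma}$, the reordered system $\{\phi_{\sigma(n)}\}_{n=1}^N$ satisfies $$\|\mathcal{V}^2 f\|_{2}\le C_{A,\epsilon,\gamma}\,\log^{\frac{9}{22}+\epsilon}(N)\,\|f\|_{2}$$ for every $f=\sum_{n=1}^N a_n\phi_{\sigma(n)}$ with real coefficients $a_1,\dots,a_N$, where $\mathcal{V}^2$ is the square variation operator of the reordered system.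
   Context: $[N]=\{1,\dots,N\}$. Orthonormal means orthonormal in $L^2(\mathbb{T})$, and $\|\cdot\|_2$ is the $L^2(\mathbb{T})$ norm. For an orthonormal system $\{\psi_n\}_{n=1}^N$ and $f=\sum_{n=1}^N a_n\psi_n$, the square variation operator is $$\mathcal{V}^{2}f(x)=\Big(\max_{\pi\in\mathcal{P}_N}\sum_{I\in\pi}\Big|\sum_{n\in I}a_n\psi_n(x)\Big|^2\Big)^{1/2},$$ where $\mathcal{P}_N$ is the set of partitions of $[N]$ into subintervals (sets of consecutive integers). In the theorem it is applied with $\psi_n=\phi_{\sigma(n)}$. $\log^{s}(N)$ means $(\log N)^{s}$. *)

(* Defs.v *)
From HB Require Import structures.
From mathcomp Require Import all_boot all_order all_fingroup all_algebra.
From mathcomp Require Import all_classical all_reals all_analysis.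

Set Implicit Arguments.
Unset Strict Implicit.
Unset Printing Implicit Defensive.

Import Order.TTheory GRing.Theory Num.Theory.
Local Open Scope ring_scope.

(* The index set {1, ..., N} is represented by 'I_N = {0, ..., N - 1}. *)

Definition is_interval_ord (N : nat) (I : {set 'I_N}) : bool :=
  [forall i in I, forall j in I, forall k : 'I_N, (i <= k <= j)%N ==> (k \in I)].

(* Blocks of a [partition] are nonempty. *)
Definition interval_partition (N : nat) (pi : {set {set 'I_N}}) : bool :=
  finset.partition pi [set: 'I_N]%SET && [forall I in pi, is_interval_ord I].

Definition orthonormal_system (R : realType) (d : measure_display)
    (T : measurableType d) (P : probability T R) (N : nat)
    (phi : 'I_N -> T -> R) : Prop :=
  forall i j : 'I_N, (\int[P]_x (phi i x * phi j x)%:E = ((i == j)%:R)%:E)%E.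

Definition lin_comb (R : realType) (T : Type) (N : nat)
    (psi : 'I_N -> T -> R) (a : 'I_N -> R) (x : T) : R :=
  \sum_(n < N) a n * psi n x.

(* The square variation of f = lin_comb psi a, as a function of the
   coefficients a, which f determines when psi is orthonormal.  The default
   value 0 of the maximum is harmless: the sums are nonnegative and 'I_N always
   has an interval partition. *)
Definition square_variation (R : realType) (T : Type) (N : nat)
    (psi : 'I_N -> T -> R) (a : 'I_N -> R) (x : T) : R :=
  Num.sqrt (\big[Num.max/0]_(pi : {set {set 'I_N}} | interval_partition pi)
    \sum_(I in pi) `|\sum_(n in I) a n * psi n x| ^+ 2).

Definition norm2 (R : realType) (d : measure_display) (T : measurableType d)
    (P : probability T R) (f : T -> R) : \bar R :=
  ('N[P]_(2%:E) [ EFin \o f ])%E.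

(* The probability of the event E for a uniformly random permutation. *)
Definition perm_prob (R : realType) (N : nat) (E : 'S_N -> Prop) : R :=
  #|[pred s : 'S_N | `[< E s >]]|%:R / #|{: 'S_N}|%:R.

(* Main.v *)
(* Set L = ln N. By Bessel's inequality a fixed function correlates strongly with
   few phi_n, so a random permutation puts few of those in a short window; a union
   bound over a net of thresholded sparse combinations makes this uniform, outside
   an event of probability N^-gamma. For such a good permutation and a window
   holding a proportion e^(-theta L) of the indices, a combination F with
   ||a||_2 = 1 has excess (|F| - C sqrt K)_+ small in L^2 once theta K is large:
   decompose F by the sizes of its coefficients, compare each level with the
   thresholded sum of much larger levels (controlled by goodness), and treat the
   remaining correlations by Maurey sampling of flat combinations. Splitting
   windows at the median of the weights a_n^2 + 1/N passes from partial sums to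
   their maximum. Finally each block of an interval partition is charged to a
   dyadic window of comparable weight: the bulk contributes O(K), the excess at
   scale 2^-k has theta about k / L, and the first (ln N)^(3/11) scales, where
   theta is too small, are handled by the splitting argument alone. With
   K = L^(9/11) all contributions to the squared norm are O(L^(9/11)). *)

Require Import Defs.
From mathcomp Require Import all_boot all_order all_fingroup all_algebra.
From mathcomp Require Import all_classical all_reals all_analysis.
From mathcomp Require Import measurable_realfun.
From mathcomp Require Import ring lra zify.
Import Order.TTheory GRing.Theory Num.Theory.
Local Open Scope ring_scope.
Set Implicit Arguments.
Unset Strict Implicit.
Unset Printing Implicit Defensive.

(** * Bounded measurable functions on a probability space *)

(** The exponents come from a gain parameter s: relative errors are kept at O(s^-2), up to powers of
    ln ln N. In a window of proportion e^(-theta L), a level of weight W with nu coefficients is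
    thresholded at order sqrt (kap W), kap = K / s^2, which relative to the global threshold sqrt K
    costs s^-2. Maurey sampling with q = nu s^4 / kap terms has relative error s^-2. Goodness for q
    terms allows about q / theta strongly correlated indices, whose squared share q / (theta nu) =
    s^6 / (theta K) is at most s^-2 exactly when s^8 <= theta K. At scale 2^-k, where theta is about
    k / L, the squared error is (L / (k K))^(1/4); its sum over k <= 4 L is of order L K^(-1/4) =
    L^(35/44), below K = L^(9/11). The k0 coarsest scales cost about k0^2 each in the splitting
    argument, so k0 = K^(1/3) of them are affordable. Soft thresholding is used because it is
    1-Lipschitz, which lets nets and samples approximate it, and because its square is convex, which
    lets the chain telescope. *)

Section BoundedMeasurable.
Context {R : realType} {d : measure_display} {T : measurableType d}.
Implicit Types f g : T -> R.

(** Every function in the argument is built from finitely many bounded functions, so this class,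
    closed under the operations used, settles all questions of integrability. *)
Definition bmeas f : Prop :=
  measurable_fun [set: T] f /\ exists B : R, forall x, `|f x| <= B.

Lemma bmeas_cst (c : R) : bmeas (fun _ => c).
Proof. by split; [exact: measurable_cst | exists `|c|]. Qed.

Lemma bmeasD f g : bmeas f -> bmeas g -> bmeas (fun x => f x + g x).
Proof.
move=> [mf [B hB]] [mg [B' hB']]; split; first exact: measurable_funD.
by exists (B + B') => x; rewrite (le_trans (ler_normD _ _))// lerD.
Qed.

Lemma bmeasM f g : bmeas f -> bmeas g -> bmeas (fun x => f x * g x).
Proof.
move=> [mf [B hB]] [mg [B' hB']]; split; first exact: measurable_funM.
by exists (B * B') => x; rewrite normrM ler_pM.
Qed.

Lemma bmeasN f : bmeas f -> bmeas (fun x => - f x).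
Proof.
move=> [mf [B hB]]; split; first exact: measurable_funN.
by exists B => x; rewrite normrN.
Qed.

Lemma bmeasX f n : bmeas f -> bmeas (fun x => f x ^+ n).
Proof.
move=> bf; elim: n => [|n IH]; first exact: bmeas_cst.
by under eq_fun do rewrite exprS; exact: bmeasM.
Qed.

Lemma bmeas_norm f : bmeas f -> bmeas (fun x => `|f x|).
Proof.
move=> [mf [B hB]]; split; first exact: measurableT_comp.
by exists B => x; rewrite normr_id.
Qed.

Lemma bmeas_max f g : bmeas f -> bmeas g -> bmeas (fun x => Num.max (f x) (g x)).
Proof.
move=> [mf [B hB]] [mg [B' hB']]; split; first exact: measurable_maxr.
exists (B + B') => x; rewrite /Num.max; case: ifP => _.
  by rewrite (le_trans (hB' x))// lerDr (le_trans _ (hB x)).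
by rewrite (le_trans (hB x))// lerDl (le_trans _ (hB' x)).
Qed.

Lemma bmeas_ltr f g : bmeas f -> bmeas g -> bmeas (fun x => (f x < g x)%R%:R).
Proof.
move=> [mf _] [mg _]; split; last by exists 1 => x; case: (_ < _); rewrite ?normr1 ?normr0.
rewrite (_ : (fun _ => _) = fun x => if f x < g x then 1 else 0); last first.
  by apply/funext => x; case: ifP.
by apply: measurable_fun_ifT => //; exact: measurable_fun_ltr.
Qed.

Lemma bmeas_sum (I : Type) (s : seq I) (p : pred I) (h : I -> T -> R) :
  (forall i, bmeas (h i)) -> bmeas (fun x => \sum_(i <- s | p i) h i x).
Proof.
move=> bh; elim: s => [|i s IH].
  by under eq_fun do rewrite big_nil; exact: bmeas_cst.
under eq_fun do rewrite big_cons.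
by case: (p i) => //; apply: bmeasD.
Qed.

Lemma bmeas_bigmax (I : Type) (s : seq I) (p : pred I) (h : I -> T -> R) :
  (forall i, bmeas (h i)) -> bmeas (fun x => \big[Num.max/0]_(i <- s | p i) h i x).
Proof.
move=> bh; elim: s => [|i s IH].
  by under eq_fun do rewrite big_nil; exact: bmeas_cst.
under eq_fun do rewrite big_cons.
by case: (p i) => //; apply: bmeas_max.
Qed.

End BoundedMeasurable.

Ltac bm := repeat first
  [ assumption
  | apply: bmeas_cst
  | match goal with
    | |- forall _, bmeas _ => intro
    | H : forall _, bmeas _ |- bmeas _ => exact: H
    | |- bmeas (fun x => _ + _) => apply: bmeasD
    | |- bmeas (fun x => - _) => apply: bmeasN
    | |- bmeas (fun x => _ * _) => apply: bmeasM
    | |- bmeas (fun x => _ ^+ _) => apply: bmeasX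
    | |- bmeas (fun x => `|_|) => apply: bmeas_norm
    | |- bmeas (fun x => Num.max _ _) => apply: bmeas_max
    | |- bmeas (fun x => \sum_(_ <- _ | _) _) => apply: bmeas_sum
    | |- bmeas (fun x => \big[Num.max/0]_(_ <- _ | _) _) => apply: bmeas_bigmax
    end
  | apply: bmeas_ltr ].

(** * Expectation and the L^2 norm on bounded measurable functions *)

Section Expectation.
Context {R : realType} {d : measure_display} {T : measurableType d}.
Variable P : probability T R.
Implicit Types f g : T -> R.

Definition Ex f : R := \int[P]_x f x.

Lemma bmeas_integrable f : bmeas f -> P.-integrable [set: T] (EFin \o f).
Proof.
move=> [mf [B hB]]; apply: measurable_bounded_integrable => //.
  by apply: le_lt_trans (ltry 1); rewrite probability_le1.
exists B; split; first exact: num_real.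
by move=> M BM x _ /=; rewrite (le_trans (hB x)) ?ltW.
Qed.

Lemma ExD f g : bmeas f -> bmeas g -> Ex (fun x => f x + g x) = Ex f + Ex g.
Proof. by move=> bf bg; rewrite /Ex RintegralD//; exact: bmeas_integrable. Qed.

Lemma ExZ (c : R) f : bmeas f -> Ex (fun x => c * f x) = c * Ex f.
Proof. by move=> bf; rewrite /Ex RintegralZl//; exact: bmeas_integrable. Qed.

Lemma Ex_cst (c : R) : Ex (fun _ => c) = c.
Proof.
have P1 : P [set: T]%classic = 1%E by exact: probability_setT.
by rewrite /Ex Rintegral_cst//= [X in fine X]P1 /= mulr1.
Qed.

Lemma Ex_le f g : bmeas f -> bmeas g -> (forall x, f x <= g x) -> Ex f <= Ex g.
Proof.
by move=> bf bg fg; rewrite /Ex le_Rintegral//; exact: bmeas_integrable.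
Qed.

Lemma Ex_ge0 f : (forall x, 0 <= f x) -> 0 <= Ex f.
Proof. by move=> f0; rewrite /Ex Rintegral_ge0. Qed.

Lemma eq_Ex f g : f =1 g -> Ex f = Ex g.
Proof. by move=> fg; rewrite (_ : f = g)//; exact/funext. Qed.

Lemma ExB f g : bmeas f -> bmeas g -> Ex (fun x => f x - g x) = Ex f - Ex g.
Proof.
move=> bf bg; rewrite ExD//; last exact: bmeasN.
rewrite (@eq_Ex (fun x => - g x) (fun x => -1 * g x)) ?ExZ ?mulN1r// => x.
by rewrite mulN1r.
Qed.

Lemma Ex_sum (I : Type) (s : seq I) (p : pred I) (h : I -> T -> R) :
  (forall i, bmeas (h i)) ->
  Ex (fun x => \sum_(i <- s | p i) h i x) = \sum_(i <- s | p i) Ex (h i).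
Proof.
move=> bh; elim: s => [|i s IH].
  by rewrite big_nil; under eq_Ex do rewrite big_nil; rewrite Ex_cst.
rewrite big_cons; under eq_Ex do rewrite big_cons.
by case: (p i); rewrite ?ExD ?IH//; bm.
Qed.

Definition nrm f : R := Num.sqrt (Ex (fun x => f x ^+ 2)).

Lemma nrm_ge0 f : 0 <= nrm f. Proof. exact: sqrtr_ge0. Qed.

Lemma nrm2 f : nrm f ^+ 2 = Ex (fun x => f x ^+ 2).
Proof. by rewrite sqr_sqrtr// Ex_ge0// => x; exact: sqr_ge0. Qed.

Lemma nrm_le f (c : R) : 0 <= c -> Ex (fun x => f x ^+ 2) <= c ^+ 2 -> nrm f <= c.
Proof.
by move=> c0 h; rewrite -(ler_pXn2r (ltn0Sn 1)) ?nnegrE ?nrm_ge0// nrm2.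
Qed.

Lemma nrm_mono f g : bmeas f -> bmeas g -> (forall x, `|f x| <= `|g x|) ->
  nrm f <= nrm g.
Proof.
move=> bf bg fg; apply: ler_wsqrtr; apply: Ex_le; [bm..|].
by move=> x; rewrite -(real_normK (num_real (f x))) -(real_normK (num_real (g x)))
  ler_pXn2r// nnegrE.
Qed.

Lemma nrmZ (c : R) f : bmeas f -> nrm (fun x => c * f x) = `|c| * nrm f.
Proof.
move=> bf; rewrite /nrm; under eq_Ex do rewrite exprMn.
by rewrite ExZ; [rewrite sqrtrM ?sqr_ge0// sqrtr_sqr | bm].
Qed.

Lemma Ex_cauchy_schwarz f g : bmeas f -> bmeas g ->
  Ex (fun x => f x * g x) <= nrm f * nrm g.
Proof.
move=> bf bg.
have quad (s t : R) : 2 * s * t * Ex (fun x => f x * g x) <=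
    s ^+ 2 * Ex (fun x => f x ^+ 2) + t ^+ 2 * Ex (fun x => g x ^+ 2).
  rewrite -!ExZ -?ExD; [|bm..].
  apply: Ex_le; [bm..|] => x.
  have := sqr_ge0 (s * f x - t * g x); nra.
have a0 := nrm_ge0 f; have b0 := nrm_ge0 g.
have := quad (nrm g) (nrm f); rewrite -!nrm2 => q.
have [z|nz] := eqVneq (nrm f * nrm g) 0; last first.
  have ab : 0 < nrm f * nrm g by rewrite lt_neqAle eq_sym nz mulr_ge0.
  rewrite -(ler_pM2l ab); nra.
rewrite z.
have [q1|//] := ltP 0 (Ex (fun x => f x * g x)).
(* If one norm vanishes, [quad] is linear in the parameter of that function, and a large value of
   this parameter contradicts a positive correlation. *)
exfalso; move/eqP: z; rewrite mulf_eq0 => /orP[] /eqP z.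
  set e := Ex (fun x => f x * g x) in q1 *.
  have := quad ((nrm g ^+ 2 + 1) / e) 1.
  rewrite -!nrm2 z expr0n mulr0 add0r expr1n mul1r mulr1 -/e.
  rewrite -mulrA divfK ?gt_eqF//; have := sqr_ge0 (nrm g); nra.
set e := Ex (fun x => f x * g x) in q1 *.
have := quad 1 ((nrm f ^+ 2 + 1) / e).
rewrite -!nrm2 z expr0n mulr0 addr0 expr1n mul1r mulr1 -/e.
rewrite -mulrA divfK ?gt_eqF//; have := sqr_ge0 (nrm f); nra.
Qed.

Lemma nrm_triangle f g : bmeas f -> bmeas g ->
  nrm (fun x => f x + g x) <= nrm f + nrm g.
Proof.
move=> bf bg; apply: nrm_le; first by rewrite addr_ge0 ?nrm_ge0.
have cs := Ex_cauchy_schwarz bf bg.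
rewrite (@eq_Ex _ (fun x => f x ^+ 2 + 2 * (f x * g x) + g x ^+ 2)); last first.
  by move=> x /=; ring.
rewrite !ExD ?ExZ; [|bm..]; rewrite -!nrm2; nra.
Qed.

End Expectation.

(** * Random permutations *)

Lemma card_perm_into_swap (N : nat) (B : {set 'I_N}) (l : seq 'I_N) (a y : 'I_N) :
  a \notin l -> y \notin l ->
  #|[set s : 'S_N | all (fun z => s z \in B) l && (s y \in B)]| =
  #|[set s : 'S_N | all (fun z => s z \in B) l && (s a \in B)]|.
Proof.
move=> al yl.
rewrite -[LHS](card_preimset _ (mulgI (tperm a y))).
apply: eq_card => s; rewrite !inE permM tpermR; congr (_ && _).
apply: eq_in_all => z zl; rewrite permM tpermD//.
  by apply: contraNneq al => ->.
by apply: contraNneq yl => ->.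
Qed.

(** Sampling without replacement: once l is mapped into B, with k = size l, a further index lands in
    B with probability (#|B| - k) / (N - k), which is at most #|B| / N. *)
Lemma card_perm_into (N : nat) (B : {set 'I_N}) (l : seq 'I_N) : uniq l ->
  (#|[set s : 'S_N | all (fun z => s z \in B) l]| * N ^ size l <=
   #|B| ^ size l * N`!)%N.
Proof.
elim: l => [_|a l IH /= /andP[al ul]].
  rewrite muln1 mul1n (eq_card (B := [set: 'S_N]%SET)) ?cardsT ?card_Sn//.
set X := [set s : 'S_N | all (fun z => s z \in B) l] in IH.
set k := size l.
set Y := [set s : 'S_N | all (fun z => s z \in B) (a :: l)].
have YE : #|Y| = #|[set s : 'S_N | all (fun z => s z \in B) l && (s a \in B)]|.
  by apply: eq_card => s; rewrite !inE andbC.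
have kN : (k < N)%N.
  have := max_card (mem (a :: l)).
  by rewrite card_ord (card_uniqP _) //= al ul.
(* Double counting of the pairs (s, y) with y outside l and s y in B; by [card_perm_into_swap] all y
   contribute equally. *)
have Bsum : ((N - k) * #|Y| = \sum_(s in X) (#|B| - k))%N.
  transitivity (\sum_(y | y \notin l)
     #|[set s : 'S_N | all (fun z => s z \in B) l && (s y \in B)]|)%N.
    rewrite (eq_bigr (fun=> #|Y|)); last first.
      by move=> y yl; rewrite (card_perm_into_swap _ al yl) YE.
    rewrite sum_nat_const; congr (_ * _)%N.
    have := cardC (mem l); rewrite card_ord (card_uniqP ul) -/k => E.
    by rewrite -[X in (X - k)%N]E addKn; apply: eq_card => z; rewrite !inE.
  rewrite (eq_bigr (fun y => \sum_(s : 'S_N | (s \in X) && (s y \in B)) 1)%N); last first.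
    by move=> y _; rewrite -sum1_card; apply: eq_bigl => s; rewrite !inE.
  rewrite (exchange_big_dep (fun s => s \in X)) /=; last by move=> y s _ /andP[].
  apply: eq_bigr => s sX.
  under eq_bigl => y do rewrite sX /=.
  rewrite sum1_card.
  have lB : {subset l <= [pred y | s y \in B]}.
    by move=> z zl; move: sX; rewrite inE => /allP/(_ z zl).
  have cB : #|[pred y | s y \in B]| = #|B|.
    rewrite -(card_preimset B (@perm_inj _ s)).
    by apply: eq_card => z; rewrite !inE.
  rewrite -cB -(cardID (mem l) [pred y | s y \in B]).
  rewrite [X in (X + _ - _)%N](_ : _ = k).
    by rewrite addKn; apply: eq_card => z; rewrite !inE.
  rewrite /k -(card_uniqP ul); apply: eq_card => z; rewrite !inE andbC.
  by case: (boolP (z \in l)) => //= /lB.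
rewrite sum_nat_const in Bsum.
have BN : (#|B| <= N)%N by have := max_card (mem B); rewrite card_ord.
have key : (#|Y| * N <= #|B| * #|X|)%N.
  rewrite -(@leq_pmul2l (N - k)) ?subn_gt0// mulnA Bsum.
  apply: (@leq_trans (#|X| * (#|B| * (N - k)))); last by lia.
  rewrite -mulnA leq_mul2l; apply/orP; right.
  rewrite mulnBl mulnBr; nia.
rewrite !expnS mulnA.
apply: (leq_trans (leq_mul key (leqnn _))).
by rewrite -!mulnA leq_mul2l IH ?orbT.
Qed.

(** Union bound over the m-element subsets of I that may be sent into B. *)
Lemma card_perm_hits (N : nat) (I B : {set 'I_N}) (m : nat) :
  (#|[set s : 'S_N | m <= #|[set n in I | s n \in B]|]| * N ^ m <=
   'C(#|I|, m) * (#|B| ^ m * N`!))%N.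
Proof.
set bad := [set s : 'S_N | _].
pose S A := [set s : 'S_N | all (fun z => s z \in B) (enum (A : {set 'I_N}))].
have sub : bad \subset \bigcup_(A : {set 'I_N} | (A \subset I) && (#|A| == m)) S A.
  apply/fintype.subsetP => s; rewrite inE => hm.
  have [A AH cA] : exists2 A : {set 'I_N}, A \subset [set n in I | s n \in B] & #|A| = m.
    set D := finset _ in hm *; exists [set x in take m (enum D)].
      by apply/fintype.subsetP => n; rewrite inE => /mem_take; rewrite mem_enum.
    rewrite cardsE; move/card_uniqP: (take_uniq m (enum_uniq (mem D))) => ->.
    by rewrite size_takel// -cardE.
  apply/bigcupP; exists A.
    rewrite cA eqxx andbT; apply: (fintype.subset_trans AH).
    by apply/fintype.subsetP => n; rewrite inE => /andP[].
  rewrite inE; apply/allP => n; rewrite mem_enum => /(fintype.subsetP AH).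
  by rewrite inE => /andP[].
apply: (@leq_trans (\sum_(A : {set 'I_N} | (A \subset I) && (#|A| == m)) #|S A| * N ^ m)).
  rewrite -big_distrl leq_mul2r; apply/orP; right.
  apply: leq_trans (subset_leq_card sub) _.
  elim/big_ind2: _ => [|A1 n1 A2 n2 h1 h2|//]; first by rewrite cards0.
  by rewrite (leq_trans (leq_card_setU _ _))// leq_add.
apply: (@leq_trans (\sum_(A : {set 'I_N} | (A \subset I) && (#|A| == m)) #|B| ^ m * N`!)).
  apply: leq_sum => A /andP[_ /eqP cA].
  by have := card_perm_into B (enum_uniq (mem A)); rewrite -cardE cA.
by rewrite sum_nat_const leq_mul2r -cards_draws cardsE leqnn orbT.
Qed.

Section RealCount.
Variable R : realType.

(** m^m / m! is one term of the series of e^m. *)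
Lemma natr_exp_le_fact (m : nat) : (m%:R : R) ^+ m <= m`!%:R * expR 1 ^+ m.
Proof.
case: m => [|m]; first by rewrite !expr0 mul1r.
have := @expR_ge1Dxn R m.+1%:R m (ler0n _ _).
rewrite -expRM_natl mulr1 => h.
rewrite mulrC -ler_pdivrMr ?ltr0n ?fact_gt0//.
by apply: le_trans h; rewrite lerDr.
Qed.

(* The number of points of the window that land in B has mean at most
   #|B| M / N, which is at most (M / N)^(1/2) m / e. *)
Lemma card_perm_hits_real (N M : nat) (I B : {set 'I_N}) (m : nat) :
  (0 < N)%N -> (0 < M)%N -> (#|I| <= M)%N ->
  expR 1 * Num.sqrt (M%:R / N%:R) * #|B|%:R <= m%:R :> R ->
  #|[set s : 'S_N | m <= #|[set n in I | s n \in B]|]%N|%:R <=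
    Num.sqrt (M%:R / N%:R) ^+ m * N`!%:R :> R.
Proof.
move=> N0 M0 IM Bm; set s := Num.sqrt _ in Bm *.
have N0' : 0 < (N%:R : R) by rewrite ltr0n.
have M0' : 0 < (M%:R : R) by rewrite ltr0n.
have s0 : 0 < s by rewrite sqrtr_gt0 divr_gt0.
have sE : s ^+ 2 * N%:R = M%:R.
  by rewrite sqr_sqrtr ?divfK ?gt_eqF// divr_ge0 ?ltW.
have e0 : 0 < expR 1 :> R by exact: expR_gt0.
have m0 : 0 < m`!%:R :> R by rewrite ltr0n fact_gt0.
have h := card_perm_hits I B m.
set X := #|_| in h *.
have hC : ('C(#|I|, m) * m`! <= M ^ m)%N.
  rewrite bin_ffact; apply: (leq_trans (n:= #|I| ^ m)).
    by rewrite ffact_prod -[X in (_ <= _ ^ X)%N](card_ord m) -prod_nat_const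
      leq_prod// => i _; rewrite leq_subr.
  by case: (m) => // m'; rewrite leq_exp2r.
have hR : X%:R * N%:R ^+ m * m`!%:R <= M%:R ^+ m * #|B|%:R ^+ m * N`!%:R :> R.
  rewrite -!natrX -!natrM ler_nat.
  have := leq_mul h (leqnn m`!); move=> /leq_trans; apply.
  rewrite mulnAC -!mulnA; rewrite mulnA leq_mul2r hC orbT//.
rewrite -(ler_pM2r (exprn_gt0 m N0')) -(ler_pM2r m0).
apply: (le_trans hR).
(* The factor (M / N)^m = s^(2 m) is split in two: one s^m compensates #|B|^m / m!, the other is the
   bound. *)
have hs : (s * #|B|%:R) ^+ m <= m`!%:R.
  have em0 : 0 < expR 1 ^+ m :> R by rewrite exprn_gt0.
  rewrite -(ler_pM2r em0); apply: le_trans (natr_exp_le_fact m).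
  rewrite -exprMn; apply: lerXn2r; rewrite ?nnegrE ?ler0n//.
    by rewrite !mulr_ge0// ltW.
  by rewrite mulrC mulrA.
rewrite -sE -exprMn.
rewrite (_ : s ^+ 2 * N%:R * #|B|%:R = s * N%:R * (s * #|B|%:R)); last by ring.
rewrite exprMn (_ : _ * _ * m`!%:R = (s * N%:R) ^+ m * m`!%:R * N`!%:R).
  by rewrite ler_wpM2r// ler_wpM2l// exprn_ge0// mulr_ge0// ltW.
by rewrite exprMn; ring.
Qed.

End RealCount.

(** * Soft thresholding and orthonormal systems *)

Section SoftThreshold.
Variable R : realType.
Implicit Types t y z c : R.

(** Soft thresholding: for t >= 0, the difference between y and its nearest point in [-t, t]. *)
Definition thr t y : R := Num.max (y - t) 0 - Num.max (- y - t) 0.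

Lemma thr_spec t y : 0 <= t ->
  [\/ thr t y = 0 /\ (- t <= y /\ y <= t), thr t y = y - t /\ t < y | thr t y = y + t /\ y < - t].
Proof.
move=> t0; rewrite /thr /Num.max; case: (ltP (y - t) 0) => h1; case: (ltP (- y - t) 0) => h2.
- by apply: Or31; split; [ring|split; lra].
- have [e|h] := eqVneq y (- t).
    by apply: Or31; split; [lra|split; lra].
  by apply: Or33; split; [ring|rewrite lt_neqAle h; lra].
- have [e|h] := eqVneq y t.
    by apply: Or31; split; [lra|split; lra].
  by apply: Or32; split; [ring|rewrite lt_neqAle eq_sym h; lra].
- by apply: Or31; split; [lra|split; lra].
Qed.

Ltac thr_cases t0 t y := have := @thr_spec t y t0; move=> [[-> [? ?]]|[-> ?]|[-> ?]].

Lemma thr0 t : thr t 0 = 0. Proof. by rewrite /thr oppr0 subrr. Qed.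

Lemma thrZ c t y : 0 <= c -> thr (c * t) (c * y) = c * thr t y.
Proof.
by move=> c0; rewrite /thr [RHS]mulrBr !maxr_pMr// mulr0 !mulrBr mulrN.
Qed.

Lemma thr_lip t y z : 0 <= t -> `|thr t y - thr t z| <= `|y - z|.
Proof.
move=> t0; rewrite ler_norml.
by thr_cases t0 t y; thr_cases t0 t z; case: (ger0P (y - z)) => ?; apply/andP; split; lra.
Qed.

Lemma thr_norm t y : 0 <= t -> `|thr t y| = Num.max (`|y| - t) 0.
Proof.
move=> t0; rewrite /Num.max; thr_cases t0 t y; rewrite ?normr0;
  case: (ltP (`|y| - t) 0) => //; case: (ger0P y) => ?.
all: case: (ger0P (y - t)) => ?; case: (ger0P (y + t)) => ? ?; lra.
Qed.

Lemma thr_le t y : 0 <= t -> `|thr t y| <= `|y|.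
Proof. by move=> t0; rewrite thr_norm// ge_max normr_ge0 andbT lerBlDr lerDl. Qed.

Lemma thr_eq0 t y : `|y| <= t -> thr t y = 0.
Proof.
by move=> h; apply/eqP; rewrite -normr_eq0 thr_norm ?(le_trans _ h)//; apply/eqP/max_idPr; rewrite subr_le0.
Qed.

Lemma thr_sqr_le t y : 0 <= t -> thr t y ^+ 2 <= y * thr t y.
Proof. by move=> t0; thr_cases t0 t y; nra. Qed.

(** The square of [thr t] is the squared distance to [-t, t], a convex function with derivative 2
    [thr t]; this is its tangent inequality at y. *)
Lemma thr_convex t y z : 0 <= t ->
  thr t y ^+ 2 - thr t z ^+ 2 <= 2 * ((y - z) * thr t y).
Proof.
move=> t0; have := sqr_ge0 (y - z); have := sqr_ge0 (y - z - 2 * t).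
have := sqr_ge0 (y - z + 2 * t).
by thr_cases t0 t y; thr_cases t0 t z; nra.
Qed.

(** Beyond 2 t, thresholding removes at most half of y. *)
Lemma sqr_le_thr t y : 0 <= t -> y ^+ 2 <= (2 * t) ^+ 2 + 2 * (y * thr t y).
Proof. by move=> t0; thr_cases t0 t y; nra. Qed.

End SoftThreshold.

Lemma cauchy_schwarz_sum (R : realType) (I : finType) (p : pred I) (u v : I -> R) :
  \sum_(i | p i) u i * v i <=
  Num.sqrt (\sum_(i | p i) u i ^+ 2) * Num.sqrt (\sum_(i | p i) v i ^+ 2).
Proof.
set A := \sum_(i | p i) u i ^+ 2; set B := \sum_(i | p i) v i ^+ 2.
set S := \sum_(i | p i) u i * v i.
have A0 : 0 <= A by apply: sumr_ge0 => i _; exact: sqr_ge0.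
have B0 : 0 <= B by apply: sumr_ge0 => i _; exact: sqr_ge0.
have [S0|S0] := leP S 0; first by rewrite (le_trans S0)// mulr_ge0.
have [Bz|Bn] := eqVneq B 0.
  move: S0; rewrite /S big1 ?ltxx// => i pi.
  move/eqP: Bz; rewrite psumr_eq0 => [/allP/(_ i (mem_index_enum _))|j _]; last exact: sqr_ge0.
  by rewrite pi sqrf_eq0 => /eqP ->; rewrite mulr0.
have Bp : 0 < B by rewrite lt_neqAle eq_sym Bn.
have : 0 <= \sum_(i | p i) (B * u i - S * v i) ^+ 2.
  by apply: sumr_ge0 => i _; exact: sqr_ge0.
rewrite (_ : \sum_(i | p i) (B * u i - S * v i) ^+ 2 = B * (A * B - S ^+ 2)); last first.
  rewrite (eq_bigr (fun i => (B ^+ 2 * u i ^+ 2 + (- 2 * B * S) * (u i * v i)) + S ^+ 2 * v i ^+ 2)); last first.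
    by move=> i _; ring.
  by rewrite !big_split /= -!mulr_sumr -/A -/B -/S; ring.
rewrite pmulr_rge0// subr_ge0 => h.
by rewrite -sqrtrM// -(ger0_norm (ltW S0)) -sqrtr_sqr ler_wsqrtr.
Qed.

Section Orthonormal.
Context {R : realType} {d : measure_display} {T : measurableType d}.
Variable P : probability T R.
Variables (N : nat) (phi : 'I_N -> T -> R).
Hypothesis phi_bm : forall n, bmeas (phi n).
Hypothesis phi_on : forall i j, Ex P (fun x => phi i x * phi j x) = (i == j)%:R.
Implicit Types (a b : 'I_N -> R) (G : T -> R).

Lemma bmeas_lin a : bmeas (lin_comb phi a).
Proof. by rewrite /lin_comb; bm. Qed.
Hint Resolve bmeas_lin : core.

Lemma bmeas_thr t G : bmeas G -> bmeas (fun x => thr t (G x)).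
Proof. by move=> bG; rewrite /thr; bm. Qed.

Lemma Ex_linM b G : bmeas G ->
  Ex P (fun x => lin_comb phi b x * G x) = \sum_n b n * Ex P (fun x => phi n x * G x).
Proof.
move=> bG; rewrite (@eq_Ex _ _ _ _ _ (fun x => \sum_n b n * (phi n x * G x))); last first.
  by move=> x; rewrite /lin_comb big_distrl /=; apply: eq_bigr => n _; rewrite mulrA.
by rewrite Ex_sum; [apply: eq_bigr => n _; rewrite ExZ//; bm|bm].
Qed.

Lemma Ex_phi_lin a n : Ex P (fun x => phi n x * lin_comb phi a x) = a n.
Proof.
rewrite (@eq_Ex _ _ _ _ _ (fun x => lin_comb phi a x * phi n x)); last first.
  by move=> x; rewrite mulrC.
rewrite Ex_linM// (bigD1 n)//= phi_on eqxx mulr1 big1 ?addr0// => i ni.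
by rewrite phi_on (negbTE ni) mulr0.
Qed.

Lemma Ex_lin2 a : Ex P (fun x => lin_comb phi a x ^+ 2) = \sum_n a n ^+ 2.
Proof.
under eq_Ex do rewrite expr2.
by rewrite Ex_linM//; apply: eq_bigr => n _; rewrite Ex_phi_lin expr2.
Qed.

Lemma bessel G : bmeas G ->
  \sum_n Ex P (fun x => phi n x * G x) ^+ 2 <= Ex P (fun x => G x ^+ 2).
Proof.
move=> bG; set b := fun n => Ex P (fun x => phi n x * G x).
have bmL := bmeas_lin b.
have : 0 <= Ex P (fun x => (G x - lin_comb phi b x) ^+ 2).
  by apply: Ex_ge0 => x; exact: sqr_ge0.
rewrite (@eq_Ex _ _ _ _ _ (fun x => G x ^+ 2 - 2 * (lin_comb phi b x * G x)
   + lin_comb phi b x ^+ 2)); last by move=> x; ring.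
rewrite ExD ?ExB ?ExZ ?Ex_lin2 ?Ex_linM; [|bm..].
rewrite (_ : \sum_n _ * _ = \sum_n b n ^+ 2); last by apply: eq_bigr => n _; rewrite expr2.
rewrite /b; set S := \sum_n _; set U := Ex P _ ; lra.
Qed.

Lemma nrm_lin a : nrm P (lin_comb phi a) = Num.sqrt (\sum_n a n ^+ 2).
Proof. by rewrite /nrm Ex_lin2. Qed.

End Orthonormal.

(** * Good permutations *)

Lemma card_union_bound (S J : finType) (bad : pred S) (Q : J -> pred S) :
  (forall s, bad s -> exists j, Q j s) -> (#|bad| <= \sum_j #|Q j|)%N.
Proof.
move=> h; under eq_bigr => j _ do rewrite -sum1_card.
rewrite (exchange_big_dep xpredT)//= -sum1_card big_mkcond /=.
apply: leq_sum => s _; case: ifP => // bs.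
have [j qj] := h s bs.
by rewrite (bigD1 j)// leq_addr.
Qed.

Section GoodPermutations.
Context {R : realType} {d : measure_display} {T : measurableType d}.
Variable P : probability T R.
Variables (N : nat) (phi : 'I_N -> T -> R).
Hypothesis phi_bm : forall n, bmeas (phi n).
Hypothesis phi_on : forall i j, Ex P (fun x => phi i x * phi j x) = (i == j)%:R.

(* N^10 points of spacing N^-5 starting at -N^4: a net of [-N^4, N^4]. *)
Definition grid (z : nat) : R := (z%:R - N%:R ^+ 9) / N%:R ^+ 5.

(** The threshold is 1 because [thrZ] moves any other positive level into the coefficients. Indices
    may repeat, which allows padding by zero coefficients. *)
Definition netfun (q : nat) (w : {ffun 'I_q -> 'I_N * 'I_(N ^ 10)}) (x : T) : R :=
  thr 1 (\sum_r grid (w r).2 * phi (w r).1 x).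

(** By Bessel at most m / (e sqrt (M / N)) of all the indices correlate with G this strongly, which
    is the bound on #|B| that [card_perm_hits_real] asks for. *)
Definition hits (s : 'S_N) (u M m : nat) (G : T -> R) : nat :=
  #|[set n : 'I_N | (u <= n < u + M)%N &&
      (expR 1 * Num.sqrt (M%:R / N%:R) * Ex P (fun x => G x ^+ 2) <
       m%:R * Ex P (fun x => phi (s n) x * G x) ^+ 2)]|.

(* The condition 2 C2 q ln N <= m ln (N / M) makes the bad event of a fixed net
   function have probability at most (M / N)^(m / 2) <= N^(- C2 q), which beats
   the number of net functions with q terms. *)
Definition good (C2 : R) (s : 'S_N) : Prop :=
  forall (u M q m : nat) (w : {ffun 'I_q -> 'I_N * 'I_(N ^ 10)}),
    (0 < M)%N -> (0 < q <= N ^ 3)%N ->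
    2 * C2 * q%:R * ln N%:R <= m%:R * ln (N%:R / M%:R) ->
    (hits s u M m (netfun w) < m)%N.

Lemma bmeas_netfun q (w : {ffun 'I_q -> 'I_N * 'I_(N ^ 10)}) : bmeas (netfun w).
Proof. by apply: bmeas_thr; bm. Qed.

Lemma card_hits_le (u M m : nat) (G : T -> R) : bmeas G -> (0 < N)%N -> (0 < M)%N ->
  #|[set s : 'S_N | m <= hits s u M m G]%N|%:R <= Num.sqrt (M%:R / N%:R) ^+ m * N`!%:R :> R.
Proof.
move=> bG N0 M0.
pose e := expR 1 * Num.sqrt (M%:R / N%:R) : R.
pose I := [set n : 'I_N | (u <= n < u + M)%N].
pose B := [set i : 'I_N | e * Ex P (fun x => G x ^+ 2) <
   m%:R * Ex P (fun x => phi i x * G x) ^+ 2].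
have IM : (#|I| <= M)%N.
  have: (#|I| <= size (iota u M))%N; last by rewrite size_iota.
  rewrite cardE -(size_map val); apply: uniq_leq_size.
    by rewrite map_inj_uniq ?enum_uniq//; exact: val_inj.
  by move=> k /mapP[n]; rewrite mem_enum inE mem_iota => h ->.
have e0 : 0 < e.
  by rewrite mulr_gt0 ?expR_gt0// sqrtr_gt0 divr_gt0// ltr0n.
have Bm : e * #|B|%:R <= m%:R.
  have g0 : 0 <= Ex P (fun x => G x ^+ 2) by apply: Ex_ge0 => x; exact: sqr_ge0.
  have bes := bessel phi_bm phi_on bG.
  have h : #|B|%:R * (e * Ex P (fun x => G x ^+ 2)) <= m%:R * Ex P (fun x => G x ^+ 2).
    apply: le_trans (ler_wpM2l (ler0n _ m) bes).
    rewrite mulr_sumr mulr_natl -sumr_const [leRHS](bigID (mem B))/=.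
    rewrite ler_wpDr ?sumr_ge0//; first by move=> i _; rewrite mulr_ge0 ?sqr_ge0 ?ler0n.
    by apply: ler_sum => i; rewrite inE => /ltW.
  have [gz|gn] := eqVneq (Ex P (fun x => G x ^+ 2)) 0.
    rewrite (eq_card0 (A := B)) ?mulr0 ?ler0n// => i; rewrite !inE gz mulr0.
    apply/negbTE; rewrite -leNgt.
    have : Ex P (fun x => phi i x * G x) ^+ 2 <= 0.
      rewrite -gz; apply: le_trans bes; rewrite (bigD1 i)//= lerDl sumr_ge0// => j _.
      exact: sqr_ge0.
    by move=> ?; rewrite mulr_ge0_le0.
  have gp : 0 < Ex P (fun x => G x ^+ 2) by rewrite lt_neqAle eq_sym gn.
  by rewrite -(ler_pM2r gp) mulrAC mulrC.
apply: le_trans (card_perm_hits_real N0 M0 IM Bm).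
rewrite ler_nat; apply: subset_leq_card; apply/fintype.subsetP => s.
rewrite !inE => /leq_trans; apply; apply: subset_leq_card.
by apply/fintype.subsetP => n; rewrite !inE.
Qed.

(* In 17 + gamma, 11 pays for the N^11 choices of each net term and 6 for the
   choice of (u, M, q, m). *)
Lemma good_prob (C2 gamma : R) : (3 <= N)%N -> 0 <= gamma -> 17 + gamma <= C2 ->
  1 - N%:R `^ (- gamma) <= perm_prob R (good C2).
Proof.
move=> N3 g0 hC.
have N0 : (0 < N)%N by lia.
have Nr : 0 < N%:R :> R by rewrite ltr0n.
have N1 : 1 <= N%:R :> R by rewrite ler1n.
pose L : R := ln N%:R.
have L0 : 0 < L by rewrite ln_gt0// ltr1n; lia.
have NE : N%:R = expR L :> R by rewrite lnK// posrE.
pose cond (j : 'I_N * 'I_N * 'I_(N ^ 3) * 'I_N) : bool :=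
  2 * C2 * j.1.2.+1%:R * L <= j.2.+1%:R * ln (N%:R / j.1.1.2.+1%:R).
pose Q (j : 'I_N * 'I_N * 'I_(N ^ 3) * 'I_N) (s : 'S_N) : bool :=
  cond j && [exists w : {ffun 'I_j.1.2.+1 -> 'I_N * 'I_(N ^ 10)},
    (j.2.+1 <= hits s j.1.1.1 j.1.1.2.+1 j.2.+1 (netfun w))%N].
pose bad := [pred s : 'S_N | ~~ `[< good C2 s >]].
(* Goodness can fail only for u < N, 0 < M < N, 0 < q <= N^3 and 0 < m <= N: outside these ranges
   the window is empty, the condition fails, or m exceeds the number of indices. This leaves N^6
   index tuples, with M, q and m shifted by 1. *)
have badQ s : bad s -> exists j, Q j s.
  move=> /= /asboolPn; rewrite /good => /existsNP[u] /existsNP[M] /existsNP[q].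
  move=> /existsNP[m] /existsNP[w] /not_implyP[M0] /not_implyP[/andP[q0 q3]].
  move=> /not_implyP[hc] /negP; rewrite -leqNgt => hm.
  have m0 : (0 < m)%N.
    case: m hc {hm} => // hc; exfalso; move: hc; rewrite mul0r leNgt !mulr_gt0//.
      by lra.
    by rewrite ltr0n.
  have hitsN : (m <= N)%N.
    by apply: (leq_trans hm); rewrite -[X in (_ <= X)%N](card_ord N) max_card.
  have uN : (u < N)%N.
    rewrite ltnNge; apply/negP => Nu; move: hm; rewrite /hits (eq_card0) ?leqn0 => [/eqP mz|n].
      by rewrite mz in m0.
    by rewrite !inE; apply/negbTE; have := ltn_ord n; case: (leqP u n) => //=; lia.
  have MN : (M < N)%N.
    rewrite ltnNge; apply/negP => NM.
    have : ln (N%:R / M%:R) <= 0 :> R.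
      rewrite ln_le0// ler_pdivrMr ?ltr0n// mul1r ler_nat//.
    move=> ln0; have : m%:R * ln (N%:R / M%:R) <= 0 :> R by rewrite mulr_ge0_le0.
    move=> /(le_trans hc); rewrite leNgt !mulr_gt0//.
      by lra.
    by rewrite ltr0n.
  have q' : (q.-1 < N ^ 3)%N by lia.
  have m' : (m.-1 < N)%N by lia.
  have M' : (M.-1 < N)%N by lia.
  case: q q0 q3 w hc hm q' => // q _ _ w hc hm q'.
  case: m m0 hc hm hitsN m' => // m _ hc hm _ m'.
  case: M M0 hc hm M' {MN} => // M _ hc hm M'.
  exists (Ordinal uN, Ordinal M', Ordinal q', Ordinal m').
  by rewrite /Q /cond /= hc /=; apply/existsP; exists w.
have Qle j : #|Q j|%:R <= N%:R ^+ 11 ^+ j.1.2.+1 * expR (- (C2 * j.1.2.+1%:R * L)) * N`!%:R :> R.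
  have [cj|ncj] := boolP (cond j); last first.
    rewrite (eq_card0 (A := Q j)); last by move=> s; rewrite /Q /in_mem /= (negbTE ncj).
    by rewrite !mulr_ge0 ?expR_ge0// !exprn_ge0.
  set q := j.1.2.+1; set m := j.2.+1; set M := j.1.1.2.+1.
  pose B (w : {ffun 'I_q -> 'I_N * 'I_(N ^ 10)}) :=
    [pred s : 'S_N | (m <= hits s j.1.1.1 M m (netfun w))%N].
  have h1 : (#|Q j| <= \sum_w #|B w|)%N.
    by apply: card_union_bound => s /andP[_ /existsP].
  have h2 w : #|B w|%:R <= expR (- (C2 * q%:R * L)) * N`!%:R :> R.
    have := @card_hits_le j.1.1.1 M m _ (bmeas_netfun w) N0 (ltn0Sn _).
    rewrite cardsE => /le_trans; apply; rewrite ler_wpM2r ?ler0n//.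
    have M0 : 0 < M%:R :> R by rewrite ltr0n.
    rewrite -(ler_pXn2r (ltn0Sn 1)) ?nnegrE ?expR_ge0 ?exprn_ge0 ?sqrtr_ge0//.
    rewrite exprAC sqr_sqrtr ?divr_ge0 ?ler0n//.
    rewrite -expRM_natl (_ : M%:R / N%:R = expR (- ln (N%:R / M%:R))); last first.
      by rewrite -lnV ?posrE ?divr_gt0// invf_div lnK// posrE divr_gt0.
    rewrite -expRM_natl ler_expR.
    by move: cj; rewrite /cond -/q -/m -/M -/L; lra.
  apply: (@le_trans _ _ (\sum_w #|B w|%:R)); first by rewrite -natr_sum ler_nat.
  apply: (le_trans (ler_sum _ (fun w _ => h2 w))).
  rewrite sumr_const card_ffun card_prod !card_ord -[leLHS]mulr_natl -expnS !natrX mulrA.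
  by [].
have badle : #|bad|%:R <= N%:R `^ (- gamma) * N`!%:R :> R.
  apply: (@le_trans _ _ (\sum_j #|Q j|%:R)).
    by rewrite -natr_sum ler_nat; exact: card_union_bound.
  apply: (@le_trans _ _ (\sum_(j : 'I_N * 'I_N * 'I_(N ^ 3) * 'I_N)
     (expR (- (6 + gamma) * L) * N`!%:R))).
    apply: ler_sum => j _; apply: (le_trans (Qle j)); rewrite ler_wpM2r ?ler0n//.
    rewrite NE -!expRM_natl -expRD ler_expR.
    set q := j.1.2.+1.
    have q1 : 1 <= q%:R :> R by rewrite ler1n.
    have qL : L <= q%:R * L by rewrite ler_peMl// ltW.
    have : (17 + gamma) * (q%:R * L) <= C2 * (q%:R * L).
      by rewrite ler_wpM2r// mulr_ge0// ltW.
    have : gamma * L <= gamma * (q%:R * L) by rewrite ler_wpM2l.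
    nra.
  rewrite sumr_const !card_prod !card_ord -[leLHS]mulr_natl mulrA ler_wpM2r ?ler0n//.
  rewrite !natrM ?natrX /powR gt_eqF// -/L NE -?expRM_natl -!expRD ler_expR; lra.
rewrite /perm_prob.
have F0 : 0 < N`!%:R :> R by rewrite ltr0n fact_gt0.
have cS : #|{: 'S_N}| = N`! by rewrite -card_Sn; apply: eq_card => s; rewrite !inE.
rewrite cS ler_pdivlMr// mulrBl mul1r lerBlDr.
apply: (@le_trans _ _ (#|[pred s | `[< good C2 s >]]|%:R + #|bad|%:R)); last by rewrite lerD2l.
rewrite -natrD ler_nat -cS.
have := cardC [pred s : 'S_N | `[< good C2 s >]] => <-.
by rewrite leq_add2l; apply: subset_leq_card; apply/fintype.subsetP => s.
Qed.

End GoodPermutations.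

(** * Correlations with sparse thresholded combinations *)

Section NetBound.
Context {R : realType} {d : measure_display} {T : measurableType d}.
Variable P : probability T R.
Variables (N : nat) (psi : 'I_N -> T -> R) (A C2 : R).
Hypothesis psi_bm : forall n, bmeas (psi n).
Hypothesis psi_on : forall i j, Ex P (fun x => psi i x * psi j x) = (i == j)%:R.
Hypothesis psi_A : forall n x, `|psi n x| <= A.
Hypothesis N3 : (3 <= N)%N.
Hypothesis AN : A <= N%:R.
Hypothesis A1 : 1 <= A.
Hypothesis psi_good : good P psi C2 1%g.

Let Nr : 0 < N%:R :> R. Proof. by rewrite ltr0n; lia. Qed.

Lemma grid_approx (y : R) : `|y| <= N%:R ^+ 4 ->
  exists z : 'I_(N ^ 10), `|grid N z - y| <= N%:R ^- 5.
Proof.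
move=> hy; have N5 : 0 < N%:R ^+ 5 :> R by rewrite exprn_gt0.
pose v := (y + N%:R ^+ 4) * N%:R ^+ 5.
move: hy; rewrite ler_norml => /andP[y1 y2].
have v0 : 0 <= v by apply: mulr_ge0; [lra | exact: ltW].
have /andP[z1 z2] := truncn_itv v0.
have v2 : v <= 2 * N%:R ^+ 9.
  apply: (@le_trans _ _ (2 * N%:R ^+ 4 * N%:R ^+ 5)); last by rewrite -mulrA -exprD.
  by apply: ler_wpM2r; [exact: ltW | lra].
have zN : (Num.truncn v < N ^ 10)%N.
  rewrite -(ltr_nat R); apply: (le_lt_trans z1); apply: (le_lt_trans v2).
  by rewrite natrX [ltRHS]exprS ltr_pM2r ?exprn_gt0// ltr_nat.
exists (Ordinal zN); rewrite /grid /=.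
rewrite -(ler_pM2r N5) mulVf ?gt_eqF// -{2}(gtr0_norm N5) -normrM mulrBl divfK ?gt_eqF//.
have -> : y * N%:R ^+ 5 = v - N%:R ^+ 9 by rewrite /v mulrDl -exprD addrK.
by rewrite ler_norml; move: z2; rewrite -natr1 => z2; apply/andP; split; lra.
Qed.

(** Rounding the coefficients costs at most q A N^-5 <= N^-1 pointwise, since q <= N^3 and A <= N,
    and [thr 1] is 1-Lipschitz. A support smaller than q is padded by zero coefficients. *)
Lemma net_approx (q : nat) (c : 'I_N -> R) : (0 < q <= N ^ 3)%N ->
  (#|[set n | c n != 0%R]%SET| <= q)%N -> (forall n, `|c n| <= N%:R ^+ 4) ->
  exists w : {ffun 'I_q -> 'I_N * 'I_(N ^ 10)},
    forall x, `|netfun psi w x - thr 1 (lin_comb psi c x)| <= N%:R^-1.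
Proof.
move=> /andP[q0 q3] cq cN.
pose n0 : 'I_N := Ordinal (leq_trans (isT : 0 < 3)%N N3).
pose l := enum [set n | c n != 0%R]%SET.
have lq : (size l <= q)%N by rewrite -cardE.
pose cc (r : nat) := if (r < size l)%N then c (nth n0 l r) else 0.
have ccN r : `|cc r| <= N%:R ^+ 4.
  by rewrite /cc; case: ifP => // _; rewrite normr0 exprn_ge0.
have zex r := grid_approx (ccN r).
pose w : {ffun 'I_q -> 'I_N * 'I_(N ^ 10)} :=
  [ffun r : 'I_q => (nth n0 l r, xchoose (zex r))].
have hw r : `|grid N (w r).2 - cc r| <= N%:R ^- 5.
  by rewrite ffunE; exact: (xchooseP (zex r)).
exists w => x; apply: (le_trans (thr_lip _ _ ler01)).
have -> : lin_comb psi c x = \sum_(r < q) cc r * psi (w r).1 x.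
  transitivity (\sum_(n <- l) c n * psi n x).
    rewrite big_enum_cond /= /lin_comb [RHS]big_mkcond /=; apply: eq_bigr => n _.
    by rewrite inE andbT; case: eqVneq => // ->; rewrite mul0r.
  rewrite (big_nth n0) big_mkord (big_ord_widen q (fun r => c (nth n0 l r) * psi (nth n0 l r) x) lq).
  rewrite big_mkcond /=; apply: eq_bigr => r _.
  by rewrite /cc ffunE /=; case: ifP => //; rewrite mul0r.
rewrite -sumrB; apply: (le_trans (ler_norm_sum _ _ _)).
apply: (@le_trans _ _ (\sum_(r < q) N%:R ^- 5 * A)).
  by apply: ler_sum => r _; rewrite -mulrBl normrM ler_pM.
rewrite sumr_const card_ord -[leLHS]mulr_natl mulrA.
have q3' : q%:R <= N%:R ^+ 3 :> R by rewrite -natrX ler_nat.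
have Ni : 0 < N%:R^-1 :> R by rewrite invr_gt0.
apply: (@le_trans _ _ (N%:R ^+ 3 * N%:R ^- 5 * N%:R)).
  have N5 : 0 <= N%:R ^- 5 :> R by rewrite invr_ge0 exprn_ge0.
  by apply: ler_pM => //; rewrite ?mulr_ge0 ?ler0n ?ler_wpM2r// (le_trans _ A1).
by rewrite le_eqVlt; apply/orP; left; apply/eqP; field; rewrite gt_eqF.
Qed.

(** Expand over the correlations of the psi_n with a net function H close to the thresholded
    combination. Fewer than m indices of the window are hits, and Cauchy-Schwarz with Bessel gives
    them t sqrt m; at the others each correlation is at most sqrt (e sqrt (M / N) / m) times the
    norm of H and is summed against l1. The terms in 1 / N pay for the passage to H. *)
Lemma net_correlation (u M q m : nat) (c b : 'I_N -> R) (t l1 : R) :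
  (0 < M)%N -> (0 < q <= N ^ 3)%N ->
  2 * C2 * q%:R * ln N%:R <= m%:R * ln (N%:R / M%:R) ->
  (#|[set n | c n != 0%R]%SET| <= q)%N -> (forall n, `|c n| <= N%:R ^+ 4) ->
  (forall n : 'I_N, ~~ (u <= n < u + M)%N -> b n = 0) ->
  (forall n, `|b n| <= t) -> \sum_n `|b n| <= l1 -> (0 < m)%N ->
  Ex P (fun x => lin_comb psi b x * thr 1 (lin_comb psi c x)) <=
  (t * Num.sqrt m%:R + l1 * Num.sqrt (expR 1 * Num.sqrt (M%:R / N%:R) / m%:R)) *
    (nrm P (fun x => thr 1 (lin_comb psi c x)) + N%:R^-1)
  + Num.sqrt (\sum_n b n ^+ 2) / N%:R.
Proof.
move=> M0 hq hm cq cN bI bt bl m0.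
have [w hw] := net_approx hq cq cN.
have hg := @psi_good u M q m w M0 hq hm.
set G := fun x => thr 1 (lin_comb psi c x).
set H := netfun psi w in hw hg.
have bG : bmeas G by apply: bmeas_thr; exact: bmeas_lin.
have bH : bmeas H by exact: bmeas_netfun.
have bL : bmeas (lin_comb psi b) by exact: bmeas_lin.
have Ni : 0 <= N%:R^-1 :> R by rewrite invr_ge0 ltW.
have GH : nrm P (fun x => G x - H x) <= N%:R^-1.
  apply: nrm_le => //; rewrite -[leRHS](Ex_cst P); apply: Ex_le; [bm..|] => x.
  by rewrite -(real_normK (num_real (G x - H x))) lerXn2r ?nnegrE// distrC.
have t0 : 0 <= t by have n0 : 'I_N := Ordinal (leq_trans (isT : 0 < 3)%N N3); apply: le_trans (bt n0).
have l10 : 0 <= l1 by apply: le_trans bl; apply: sumr_ge0.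
rewrite (@eq_Ex _ _ _ _ _ (fun x => lin_comb psi b x * H x + lin_comb psi b x * (G x - H x)));
  last by move=> x; rewrite /G; ring.
rewrite ExD; [|bm..]; apply: lerD; last first.
  apply: (le_trans (Ex_cauchy_schwarz _ _ _)); [bm..|].
  by rewrite nrm_lin// ler_wpM2l ?sqrtr_ge0.
have nH : nrm P H <= nrm P G + N%:R^-1.
  apply: (@le_trans _ _ (nrm P (fun x => G x + (H x - G x)))).
    by apply: nrm_mono; [bm..|] => x; rewrite addrC subrK.
  apply: (le_trans (nrm_triangle _ _ _)); [bm..|]; rewrite lerD2l.
  apply: le_trans GH; apply: nrm_mono; [bm..|] => x.
  by rewrite distrC.
set k1 := Num.sqrt m%:R; set k2 := Num.sqrt (_ / m%:R).
have k10 : 0 <= k1 by exact: sqrtr_ge0.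
have k20 : 0 <= k2 by exact: sqrtr_ge0.
apply: (@le_trans _ _ ((t * k1 + l1 * k2) * nrm P H)); last first.
  by rewrite ler_wpM2l// addr_ge0// mulr_ge0.
pose be n := Ex P (fun x => psi n x * H x).
have bes : \sum_n be n ^+ 2 <= nrm P H ^+ 2.
  by rewrite nrm2; exact: bessel.
rewrite Ex_linM// -/be.
rewrite /hits in hg; set B := finset _ in hg.
rewrite (bigID (mem B)) /= mulrDl; apply: lerD.
  apply: (@le_trans _ _ (\sum_(n in B) t * `|be n|)).
    apply: ler_sum => n _; apply: (le_trans (ler_norm _)).
    by rewrite normrM ler_wpM2r.
  rewrite -mulr_sumr -mulrA ler_wpM2l//.
  under eq_bigr => n _ do rewrite -[`|be n|]mul1r.
  apply: (le_trans (cauchy_schwarz_sum _ _ _)).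
  apply: ler_pM; rewrite ?sqrtr_ge0//.
    apply: ler_wsqrtr; rewrite (eq_bigr (fun=> 1)); last by move=> n _; rewrite expr1n.
    by rewrite sumr_const ler_nat ltnW.
  rewrite -(ger0_norm (nrm_ge0 P H)) -sqrtr_sqr ler_wsqrtr//.
  apply: le_trans bes; rewrite [leRHS](bigID (mem B)) /= ler_wpDr ?sumr_ge0// => [n _|].
    exact: sqr_ge0.
  by apply: ler_sum => n _; rewrite real_normK ?num_real.
apply: (@le_trans _ _ (\sum_n `|b n| * (k2 * nrm P H))); last first.
  by rewrite -mulr_suml mulrA ler_wpM2r ?nrm_ge0// ler_wpM2r.
rewrite [leRHS](bigID (mem B)) /= ler_wpDl ?sumr_ge0// => [n _|].
  by rewrite !mulr_ge0 ?nrm_ge0.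
apply: ler_sum => n nB.
have [nI|/bI ->] := boolP (u <= n < u + M)%N; last by rewrite mul0r normr0 mul0r.
apply: (le_trans (ler_norm _)); rewrite normrM ler_wpM2l//.
move: nB; rewrite !inE nI /= perm1 -leNgt => nB.
rewrite -(ler_pXn2r (ltn0Sn 1)) ?nnegrE ?mulr_ge0 ?nrm_ge0//.
have m0' : 0 < m%:R :> R by rewrite ltr0n.
rewrite exprMn sqr_sqrtr; last first.
  by rewrite divr_ge0 ?mulr_ge0 ?expR_ge0 ?sqrtr_ge0// ltW.
by rewrite nrm2 real_normK ?num_real// -/(be n) mulrAC ler_pdivlMr// mulrC.
Qed.

End NetBound.

(** * Maurey sampling of flat combinations *)

Section Sampling.
Variable R : realType.
Implicit Types (x y lam : R).

(** The linear term averages out for a mean-zero variable, so that a bound |Z| <= B becomes a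
    sub-Gaussian moment generating function in [mgf_le]. *)
Lemma expR_le_sub x : expR x <= x + expR (2 * x ^+ 2).
Proof.
have h2 : 1 + 2 * x ^+ 2 <= expR (2 * x ^+ 2) by exact: expR_ge1Dx.
have [x1|x1] := leP (1 / 2) x.
  have : expR x <= expR (2 * x ^+ 2) by rewrite ler_expR; nra.
  lra.
have [x2|x2] := leP x (- (1 / 2)).
  have : expR x <= 1 by rewrite -[leRHS](@expR0 R) ler_expR; lra.
  nra.
have h : 1 - x <= expR (- x) by rewrite (le_trans _ (expR_ge1Dx _)).
have e0 : 0 < expR x by exact: expR_gt0.
have : (1 - x) * expR x <= 1.
  by rewrite -[leRHS](expRxMexpNx_1 x) mulrC ler_pM2l.
move=> h1; apply: (@le_trans _ _ (x + (1 + 2 * x ^+ 2))); last by rewrite lerD2l.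
have x3 : 0 < 1 - x by lra.
rewrite -(ler_pM2l x3); nra.
Qed.

Lemma sqr_le_expR_abs y lam : 0 < lam ->
  y ^+ 2 <= 2 / lam ^+ 2 * expR (lam * `|y|).
Proof.
move=> l0; have l2 : 0 < lam ^+ 2 by rewrite exprn_gt0.
rewrite mulrAC ler_pdivlMr// -(real_normK (num_real y)) -exprMn mulrC.
rewrite mulrC [_ * lam]mulrC.
have z0 : 0 <= lam * `|y| by rewrite mulr_ge0// ltW.
have := expR_ge1Dxn 1 z0; rewrite (_ : 2`! = 2)%N//; lra.
Qed.

Lemma expR_abs_le y : expR `|y| <= expR y + expR (- y).
Proof.
have := expR_ge0 y; have := expR_ge0 (- y).
by case: (ger0P y) => _; lra.
Qed.

Lemma sqr_le_expR y lam : 0 < lam ->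
  y ^+ 2 <= 2 / lam ^+ 2 * (expR (lam * y) + expR (- lam * y)).
Proof.
move=> l0; apply: (le_trans (sqr_le_expR_abs y l0)).
rewrite ler_wpM2l ?divr_ge0 ?exprn_ge0 ?(ltW l0)// mulNr.
by rewrite -[X in X * `|y|](gtr0_norm l0) -normrM expR_abs_le.
Qed.

(** Where |y| > s, the factor e^(lam |y|) is at most e^(- lam s) e^(2 lam |y|). *)
Lemma sqr_tail_le_expR y lam s : 0 < lam ->
  y ^+ 2 * (s < `|y|)%R%:R <=
  2 / lam ^+ 2 * expR (- (lam * s)) * (expR (2 * lam * y) + expR (- (2 * lam) * y)).
Proof.
move=> l0; have l2 : 0 < lam ^+ 2 by rewrite exprn_gt0.
have c0 : 0 <= 2 / lam ^+ 2 by rewrite divr_ge0// ltW.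
have [sy|ys] := ltP s `|y|; last first.
  by rewrite mulr0 mulr_ge0 ?addr_ge0 ?expR_ge0// mulr_ge0 ?expR_ge0.
rewrite mulr1 -mulrA; apply: (le_trans (sqr_le_expR_abs y l0)); rewrite ler_wpM2l//.
apply: (@le_trans _ _ (expR (- (lam * s)) * expR (2 * lam * `|y|))).
  by have := ler_wpM2l (ltW l0) (ltW sy); rewrite -expRD ler_expR; lra.
rewrite ler_wpM2l ?expR_ge0// mulNr.
have l20 : 0 < 2 * lam by rewrite mulr_gt0.
by rewrite -[X in X * `|y|](gtr0_norm l20) -normrM expR_abs_le.
Qed.

Variables (V : finType) (Z : V -> R) (B : R).
Hypothesis Z0 : \sum_v Z v = 0.
Hypothesis ZB : forall v, `|Z v| <= B.

Lemma mgf_le lam : \sum_v expR (lam * Z v) <= #|V|%:R * expR (2 * (lam * B) ^+ 2).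
Proof.
apply: (@le_trans _ _ (\sum_v (lam * Z v + expR (2 * (lam * B) ^+ 2)))).
  apply: ler_sum => v _; apply: (le_trans (expR_le_sub _)); rewrite lerD2l ler_expR.
  rewrite ler_wpM2l// !exprMn ler_wpM2l ?sqr_ge0// -(real_normK (num_real (Z v))).
  by rewrite lerXn2r// nnegrE// (le_trans _ (ZB v)).
by rewrite big_split /= -mulr_sumr Z0 mulr0 add0r sumr_const [leRHS]mulr_natl.
Qed.

Variable q : nat.
Hypothesis q0 : (0 < q)%N.

(** The mean of q independent uniform draws. Expectations over the draws appear as sums over all Q,
    hence the factors #|V|^q below. *)
Definition smean (Q : {ffun 'I_q -> V}) : R := q%:R^-1 * \sum_r Z (Q r).

Let qr : 0 < q%:R :> R. Proof. by rewrite ltr0n. Qed.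

Lemma mgf_smean lam :
  \sum_Q expR (lam * smean Q) <= #|V|%:R ^+ q * expR (2 * (lam * B) ^+ 2 / q%:R).
Proof.
rewrite (eq_bigr (fun Q : {ffun 'I_q -> V} => \prod_r expR (lam / q%:R * Z (Q r)))); last first.
  by move=> Q _; rewrite -expR_sum -mulr_sumr /smean mulrA.
rewrite -(bigA_distr_bigA (fun _ v => expR (lam / q%:R * Z v))) /=.
rewrite prodr_const card_ord.
apply: (@le_trans _ _ ((#|V|%:R * expR (2 * (lam / q%:R * B) ^+ 2)) ^+ q)).
  apply: lerXn2r; rewrite ?nnegrE ?mulr_ge0 ?expR_ge0 ?sumr_ge0//; last exact: mgf_le.
rewrite exprMn ler_wpM2l ?exprn_ge0// -expRM_natl ler_expR le_eqVlt; apply/orP; left.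
by apply/eqP; field; rewrite gt_eqF.
Qed.

Lemma smean_var : 0 < B ->
  \sum_Q smean Q ^+ 2 <= #|V|%:R ^+ q * (4 * expR 2 * B ^+ 2 / q%:R).
Proof.
(* Makes the exponent 2 lam^2 B^2 / q equal to 2. *)
move=> B0; pose lam := Num.sqrt q%:R / B.
have s0 : 0 < Num.sqrt q%:R :> R by rewrite sqrtr_gt0.
have l0 : 0 < lam by rewrite divr_gt0.
have lE : (lam * B) ^+ 2 / q%:R = 1.
  by rewrite /lam divfK ?gt_eqF// sqr_sqrtr ?ltW// divff// gt_eqF.
apply: (le_trans (ler_sum _ (fun Q _ => sqr_le_expR (smean Q) l0))).
rewrite -mulr_sumr big_split /=.
have h1 := mgf_smean lam; have h2 := mgf_smean (- lam).
have e1 : 2 * (lam * B) ^+ 2 / q%:R = 2 by rewrite -mulrA lE mulr1.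
have e2 : 2 * (- lam * B) ^+ 2 / q%:R = 2 by rewrite mulNr sqrrN.
rewrite e1 in h1; rewrite e2 in h2.
have -> : #|V|%:R ^+ q * (4 * expR 2 * B ^+ 2 / q%:R) =
    2 / lam ^+ 2 * (#|V|%:R ^+ q * expR 2 + #|V|%:R ^+ q * expR 2).
  rewrite /lam expr_div_n sqr_sqrtr ?ltW//; field.
  by rewrite !gt_eqF.
by rewrite ler_wpM2l ?divr_ge0 ?exprn_ge0 ?(ltW l0)// lerD.
Qed.

Lemma smean_tail s : 0 < B -> 0 < s ->
  \sum_Q smean Q ^+ 2 * (s < `|smean Q|)%R%:R <=
  #|V|%:R ^+ q * (1024 * B ^+ 4 / (s * q%:R) ^+ 2 * expR (- (s ^+ 2 * q%:R / (32 * B ^+ 2)))).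
Proof.
(* The minimizer of - lam s + 8 lam^2 B^2 / q, with minimum - s^2 q / (32 B^2). *)
move=> B0 s0; pose lam := s * q%:R / (16 * B ^+ 2).
have l0 : 0 < lam by rewrite divr_gt0 ?mulr_gt0 ?exprn_gt0.
apply: (le_trans (ler_sum _ (fun Q _ => sqr_tail_le_expR (smean Q) s l0))).
rewrite -mulr_sumr big_split /=.
have h1 := mgf_smean (2 * lam); have h2 := mgf_smean (- (2 * lam)).
rewrite (_ : (- (2 * lam) * B) ^+ 2 = (2 * lam * B) ^+ 2) in h2; last by ring.
have -> : #|V|%:R ^+ q * (1024 * B ^+ 4 / (s * q%:R) ^+ 2 * expR (- (s ^+ 2 * q%:R / (32 * B ^+ 2)))) =
  2 / lam ^+ 2 * expR (- (lam * s)) * (#|V|%:R ^+ q * expR (2 * (2 * lam * B) ^+ 2 / q%:R)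
    + #|V|%:R ^+ q * expR (2 * (2 * lam * B) ^+ 2 / q%:R)).
  have -> : expR (- (s ^+ 2 * q%:R / (32 * B ^+ 2))) =
     expR (- (lam * s)) * expR (2 * (2 * lam * B) ^+ 2 / q%:R).
    rewrite -expRD; congr expR; rewrite /lam; field.
    by rewrite !gt_eqF.
  by rewrite /lam; field; rewrite !gt_eqF.
apply: ler_wpM2l; last exact: lerD.
by rewrite mulr_ge0 ?expR_ge0// divr_ge0 ?exprn_ge0 ?(ltW l0).
Qed.

End Sampling.

Lemma exists_le_average (R : realType) (V : finType) (h : V -> R) (c : R) :
  (0 < #|V|)%N -> \sum_v h v <= #|V|%:R * c -> exists v, h v <= c.
Proof.
move=> V0 hc; apply/not_existsP => hn.
have : \sum_(v : V) c < \sum_v h v.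
  apply: ltr_sum => [|v _]; last by rewrite ltNge; apply/negP; exact: hn.
  by have /card_gt0P[v _] := V0; apply/hasP; exists v => //; rewrite mem_index_enum.
by rewrite sumr_const -[X in X < _]mulr_natl ltNge hc.
Qed.

Section Flat.
Context {R : realType} {d : measure_display} {T : measurableType d}.
Variable P : probability T R.
Variables (N : nat) (psi : 'I_N -> T -> R) (A C2 : R).
Hypothesis psi_bm : forall n, bmeas (psi n).
Hypothesis psi_on : forall i j, Ex P (fun x => psi i x * psi j x) = (i == j)%:R.
Hypothesis psi_A : forall n x, `|psi n x| <= A.
Hypothesis N3 : (3 <= N)%N.
Hypothesis AN : A <= N%:R.
Hypothesis A1 : 1 <= A.
Hypothesis psi_good : good P psi C2 1%g.

Section Maurey.
Variables (U : {set 'I_N}) (a : 'I_N -> R) (t : R) (q : nat).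
Hypothesis U0 : (0 < #|U|)%N.
Hypothesis aU : forall n, n \notin U -> a n = 0.
Hypothesis at_ : forall n, `|a n| <= t.
Hypothesis t0 : 0 < t.
Hypothesis q0 : (0 < q)%N.

Let f := lin_comb psi a.
Let nu : R := #|U|%:R.
Let nu0 : 0 < nu. Proof. by rewrite ltr0n. Qed.
Let qr : 0 < q%:R :> R. Proof. by rewrite ltr0n. Qed.

(** The coefficients of the mean of q draws of nu a_v psi_v, with v uniform in U: an unbiased
    estimate of f that has at most q nonzero coefficients. *)
Definition maurey_coef (Q : {ffun 'I_q -> 'I_#|U|}) (n : 'I_N) : R :=
  nu / q%:R * a n * (\sum_(r < q | enum_val (Q r) == n) 1).

Lemma maurey_coef_supp Q : (#|[set n | maurey_coef Q n != 0%R]%SET| <= q)%N.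
Proof.
apply: (@leq_trans #|[set enum_val (Q r) | r in 'I_q]%SET|).
  apply: subset_leq_card; apply/fintype.subsetP => n; rewrite inE => hn.
  apply/imsetP; apply: contrapT => hx; move/negP: hn; apply; rewrite /maurey_coef big1 ?mulr0//.
  by move=> r /eqP rn; exfalso; apply: hx; exists r.
by rewrite (leq_trans (leq_imset_card _ _))// card_ord.
Qed.

Lemma maurey_coef_le Q n : `|maurey_coef Q n| <= nu * t.
Proof.
rewrite /maurey_coef; set S := \sum_(r < q | _) 1.
have S0 : 0 <= S by rewrite sumr_ge0.
have s : S <= q%:R :> R.
  by rewrite /S sumr_const ler_nat (leq_trans (max_card _))// card_ord.
rewrite normrM (ger0_norm S0) normrM (gtr0_norm (divr_gt0 nu0 qr)).
rewrite (_ : _ * _ * S = nu * (`|a n| * (S / q%:R))); last by ring.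
rewrite ler_pM2l// -[leRHS]mulr1; apply: ler_pM => //; first by rewrite divr_ge0.
by rewrite ler_pdivrMr// mul1r.
Qed.

Let Z (x : T) (v : 'I_#|U|) : R := nu * (a (enum_val v) * psi (enum_val v) x) - f x.

Lemma f_enum x : f x = \sum_(v < #|U|) a (enum_val v) * psi (enum_val v) x :> R.
Proof.
rewrite /f /lin_comb -(big_enum_val (fun n => a n * psi n x)) /= [RHS]big_mkcond /=.
by apply: eq_bigr => n _; case: ifPn => // /aU ->; rewrite mul0r.
Qed.

Lemma Z_sum x : \sum_v Z x v = 0.
Proof.
rewrite /Z big_split /= -mulr_sumr -f_enum sumr_const card_ord.
by rewrite mulNrn -[f x *+ _]mulr_natl subrr.
Qed.

Lemma f_le x : `|f x| <= nu * (t * A).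
Proof.
rewrite f_enum (le_trans (ler_norm_sum _ _ _))//.
apply: (@le_trans _ _ (\sum_(v < #|U|) t * A)); last by rewrite sumr_const card_ord mulr_natl.
by apply: ler_sum => v _; rewrite normrM ler_pM.
Qed.

Let B : R := 2 * nu * t * A.

Lemma Z_le x v : `|Z x v| <= B.
Proof.
rewrite /Z (le_trans (ler_normB _ _))// /B.
have : `|nu * (a (enum_val v) * psi (enum_val v) x)| <= nu * (t * A).
  by rewrite normrM (gtr0_norm nu0) ler_pM2l// normrM ler_pM.
by have := f_le x; lra.
Qed.

Lemma maurey_coef_lin Q x : lin_comb psi (maurey_coef Q) x = f x + smean (Z x) Q.
Proof.
rewrite /smean /Z big_split /= sumr_const card_ord mulNrn -[f x *+ _]mulr_natl.
rewrite mulrBr mulrA mulVf ?gt_eqF// mul1r addrC subrK -mulr_sumr mulrA.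
rewrite /lin_comb (eq_bigr (fun n => nu / q%:R *
   \sum_(r < q | enum_val (Q r) == n) (a (enum_val (Q r)) * psi (enum_val (Q r)) x))); last first.
  move=> n _; rewrite /maurey_coef; set S := \sum_(r < q | _) 1.
  rewrite (_ : _ * S * _ = nu / q%:R * (S * (a n * psi n x))); last by ring.
  by rewrite /S mulr_suml; congr (_ * _); apply: eq_bigr => r /eqP <-; rewrite mul1r.
rewrite -mulr_sumr [nu / _]mulrC; congr (_ * _).
rewrite (exchange_big_dep xpredT)//=; apply: eq_bigr => r _.
by rewrite (big_pred1 (enum_val (Q r))).
Qed.

(* Some sample does at least as well as the average over all samples. *)
Lemma maurey (kap : R) : 0 < kap ->
  let W := nu * t ^+ 2 in let tau := Num.sqrt (kap * W) in let H := kap * q%:R / nu in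
  exists Q : {ffun 'I_q -> 'I_#|U|},
    nrm P (fun x => thr (tau / 2) (lin_comb psi (maurey_coef Q) x) - thr (tau / 2) (f x)) ^+ 2
    <= W * (256 * expR 2 * A ^+ 2 / H +
            2 ^+ 18 * A ^+ 4 * kap / H ^+ 2 * expR (- (H / (2048 * A ^+ 2)))).
Proof.
move=> k0 W tau H.
have A0 : 0 < A by apply: lt_le_trans A1.
have W0 : 0 < W by rewrite mulr_gt0// exprn_gt0.
have tau0 : 0 < tau by rewrite sqrtr_gt0 mulr_gt0.
have tauE : tau ^+ 2 = kap * W by rewrite sqr_sqrtr// ltW// mulr_gt0.
have B0 : 0 < B by rewrite !mulr_gt0.
have s0 : 0 < tau / 4 by rewrite divr_gt0.
have bf : bmeas f by exact: bmeas_lin.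
have bS (Q : {ffun 'I_q -> 'I_#|U|}) : bmeas (fun x => smean (Z x) Q) by rewrite /smean /Z; bm.
pose big1f := fun x => (tau / 4 < `|f x|)%R%:R : R.
have bb1 : bmeas big1f by rewrite /big1f; bm.
(* Where |f| and the sampling error are both at most tau / 4, both thresholdings vanish. So the
   error counts only on {tau / 4 < |f|}, of measure at most 16 / kap by Chebyshev, or where it is
   itself large; this is the gain over the plain variance of the sample. *)
pose err (Q : {ffun 'I_q -> 'I_#|U|}) x := big1f x * smean (Z x) Q ^+ 2 +
  smean (Z x) Q ^+ 2 * (tau / 4 < `|smean (Z x) Q|)%R%:R.
have berr Q : bmeas (err Q) by have := bS Q => bq; rewrite /err; bm.
have pt Q x : (thr (tau / 2) (lin_comb psi (maurey_coef Q) x) - thr (tau / 2) (f x)) ^+ 2 <= err Q x.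
  rewrite maurey_coef_lin /err /big1f; set y := smean (Z x) Q.
  have tau20 : 0 <= tau / 2 by rewrite ltW// divr_gt0.
  have lip : (thr (tau / 2) (f x + y) - thr (tau / 2) (f x)) ^+ 2 <= y ^+ 2.
    rewrite -(real_normK (num_real (_ - _))) -(real_normK (num_real y)) lerXn2r ?nnegrE//.
    by apply: (le_trans (thr_lip _ _ tau20)); rewrite addrAC subrr add0r.
  have [h1|h1] := ltP (tau / 4) `|f x|.
    rewrite mul1r; apply: (le_trans lip); rewrite lerDl mulr_ge0 ?sqr_ge0 ?ler0n//.
  have [h2|h2] := ltP (tau / 4) `|y|.
    by rewrite mulr1 mul0r add0r.
  rewrite mulr0 mul0r addr0 !thr_eq0 ?subrr ?expr0n//; first by lra.
  by rewrite (le_trans (ler_normD _ _))//; lra.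
have cardV : #|{ffun 'I_q -> 'I_#|U|}|%:R = nu ^+ q :> R.
  by rewrite card_ffun !card_ord natrX.
have P1 : Ex P big1f <= 16 / kap.
  have : Ex P (fun x => tau ^+ 2 / 16 * big1f x) <= Ex P (fun x => f x ^+ 2).
    apply: Ex_le; [bm..|] => x; rewrite /big1f.
    have [h|h] := ltP; last by rewrite mulr0 sqr_ge0.
    by rewrite mulr1 -(real_normK (num_real (f x))); nra.
  rewrite ExZ// Ex_lin2// => h.
  have sa : \sum_n a n ^+ 2 <= W.
    rewrite (bigID (mem U)) /= addrC big1 ?add0r => [|n nU]; last by rewrite aU// expr0n.
    apply: (@le_trans _ _ (\sum_(n in U) t ^+ 2)); last by rewrite sumr_const /W mulr_natl.
    apply: ler_sum => n _; rewrite -(real_normK (num_real (a n))) lerXn2r ?nnegrE// ltW//.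
  have := le_trans h sa; rewrite tauE ler_pdivlMr// => h2.
  by rewrite -(ler_pM2r W0); lra.
have [Q hQ] : exists Q, Ex P (err Q) <= W * (256 * expR 2 * A ^+ 2 / H +
            2 ^+ 18 * A ^+ 4 * kap / H ^+ 2 * expR (- (H / (2048 * A ^+ 2)))).
  apply: exists_le_average; first by rewrite card_ffun !card_ord expn_gt0 U0.
  rewrite cardV -Ex_sum//.
  pose K1 := 4 * expR 2 * B ^+ 2 / q%:R.
  pose K2 := 1024 * B ^+ 4 / (tau / 4 * q%:R) ^+ 2 * expR (- ((tau / 4) ^+ 2 * q%:R / (32 * B ^+ 2))).
  apply: (@le_trans _ _ (Ex P (fun x => nu ^+ q * (K1 * big1f x + K2)))).
    apply: Ex_le; [bm..|] => x; rewrite /err big_split /= -mulr_sumr mulrDr; apply: lerD.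
      rewrite [K1 * _]mulrC mulrCA ler_wpM2l ?ler0n//.
      have := smean_var (Z_sum x) (Z_le x) q0 B0; by rewrite card_ord.
    by have := smean_tail (Z_sum x) (Z_le x) q0 B0 s0; rewrite card_ord.
  rewrite ExZ; [|bm..]; rewrite ler_pM2l ?exprn_gt0// ExD ?ExZ ?Ex_cst; [|bm..].
  rewrite mulrDr; apply: lerD.
    apply: (@le_trans _ _ (K1 * (16 / kap))).
      apply: ler_wpM2l => //; rewrite /K1 divr_ge0 ?ler0n// mulr_ge0 ?sqr_ge0// mulr_ge0 ?expR_ge0 ?ler0n//.
    rewrite le_eqVlt; apply/orP; left; apply/eqP; rewrite /K1 /W /H /B; field.
    by rewrite !gt_eqF.
  rewrite le_eqVlt; apply/orP; left; apply/eqP; rewrite /K2.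
  have -> : (tau / 4) ^+ 2 * q%:R / (32 * B ^+ 2) = H / (2048 * A ^+ 2).
    rewrite expr_div_n tauE /H /B /W; field.
    by rewrite !gt_eqF.
  rewrite [(tau / 4 * _) ^+ 2]exprMn expr_div_n tauE mulrA; congr (_ * _).
  rewrite /H /B /W; field; by rewrite !gt_eqF.
exists Q; rewrite nrm2; apply: le_trans hQ; apply: Ex_le => //.
have bl1 : bmeas (lin_comb psi (maurey_coef Q)) by exact: bmeas_lin.
by have h1 := bmeas_thr (tau / 2) bl1; have h2 := bmeas_thr (tau / 2) bf; bm.
Qed.

End Maurey.
End Flat.

Lemma lin_combZ (R : realType) (T : Type) (N : nat) (psi : 'I_N -> T -> R) k a x :
  lin_comb psi (fun n => k * a n) x = k * lin_comb psi a x.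
Proof. by rewrite /lin_comb mulr_sumr; apply: eq_bigr => n _; rewrite mulrA. Qed.

(** Closes a self-referential bound: up to small errors X is at most w g y with y^2 <= X, and the
    arithmetic-geometric inequality absorbs y into X. *)
Lemma quad_absorb (R : realFieldType) (X Z w g y e1 eta : R) : 0 <= g -> g <= 1 -> 0 <= e1 -> 0 <= eta ->
  y ^+ 2 <= X -> X <= Z + w * (w * e1) ->
  Z <= w * g * (y + w * e1 + w * eta) + w * (w * eta) -> X <= w ^+ 2 * (4 * e1 + g ^+ 2 + 4 * eta).
Proof.
move=> g0 g1 e10 eta0 yX X1 hZ.
have h1 : w * g * y <= (w ^+ 2 * g ^+ 2 + y ^+ 2) / 2 by have := sqr_ge0 (w * g - y); lra.
have h2 : w * g * (w * e1 + w * eta) <= w ^+ 2 * (e1 + eta).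
  rewrite (_ : w * g * _ = g * (w ^+ 2 * (e1 + eta))); last by ring.
  by rewrite ler_piMl// mulr_ge0 ?sqr_ge0// addr_ge0.
move: h1 h2 yX X1 hZ; lra.
Qed.

(** * Flat combinations under a good permutation *)

Section FlatBound.
Context {R : realType} {d : measure_display} {T : measurableType d}.
Variable P : probability T R.
Variables (N : nat) (psi : 'I_N -> T -> R) (A C2 : R).
Hypothesis psi_bm : forall n, bmeas (psi n).
Hypothesis psi_on : forall i j, Ex P (fun x => psi i x * psi j x) = (i == j)%:R.
Hypothesis psi_A : forall n x, `|psi n x| <= A.
Hypothesis N3 : (3 <= N)%N.
Hypothesis AN : A <= N%:R.
Hypothesis A1 : 1 <= A.
Hypothesis psi_good : good P psi C2 1%g.

Let Nr : 0 < N%:R :> R. Proof. by rewrite ltr0n; lia. Qed.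

(** Replace the thresholded f by that of a Maurey sample, at relative cost e1. The sample has at
    most q terms, so [net_correlation] applies, with l1 = nu t. This bounds the correlation X by the
    norm of the thresholded f, whose square is at most X, and [quad_absorb] concludes. *)
Lemma flat_bound (u M m q : nat) (U : {set 'I_N}) (a : 'I_N -> R) (t kap e1 g : R) :
  (0 < #|U|)%N -> (forall n, n \notin U -> a n = 0) -> (forall n, `|a n| <= t) -> 0 < t ->
  (forall n : 'I_N, n \in U -> (u <= n < u + M)%N) -> (0 < M)%N ->
  (0 < q <= N ^ 3)%N -> (0 < m)%N ->
  2 * C2 * q%:R * ln N%:R <= m%:R * ln (N%:R / M%:R) -> 1 <= kap -> 0 <= e1 ->
  let nu : R := #|U|%:R in let W := nu * t ^+ 2 in let H := kap * q%:R / nu in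
  let tau := Num.sqrt (kap * W) in
  256 * expR 2 * A ^+ 2 / H +
    2 ^+ 18 * A ^+ 4 * kap / H ^+ 2 * expR (- (H / (2048 * A ^+ 2))) <= e1 ^+ 2 ->
  Num.sqrt (m%:R / nu) + Num.sqrt (nu * (expR 1 * Num.sqrt (M%:R / N%:R)) / m%:R) <= g ->
  g <= 1 ->
  Ex P (fun x => lin_comb psi a x * thr (tau / 2) (lin_comb psi a x)) <=
    W * (4 * e1 + g ^+ 2 + 2 * Num.sqrt kap / N%:R).
Proof.
move=> U0 aU at_ t0 UI M0 hq m0 hm k1 e10 nu W H tau he hg g1.
have k0 : 0 < kap by apply: lt_le_trans k1.
have nu1 : 1 <= nu by rewrite ler1n.
have nu0 : 0 < nu by apply: lt_le_trans nu1.
have W0 : 0 < W by rewrite mulr_gt0// exprn_gt0.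
have m0' : 0 < m%:R :> R by rewrite ltr0n.
pose w := Num.sqrt W.
have w0 : 0 < w by rewrite sqrtr_gt0.
have wE : w ^+ 2 = W by rewrite sqr_sqrtr// ltW.
have tauE : tau = Num.sqrt kap * w by rewrite /tau sqrtrM// ltW.
have sk1 : 1 <= Num.sqrt kap by rewrite -(@sqrtr1 R) ler_wsqrtr.
have tau0 : 0 < tau by rewrite tauE mulr_gt0// (lt_le_trans _ sk1).
have [q0 _] := andP hq.
have [Q hQ] := maurey psi_bm psi_on psi_A A1 U0 aU at_ t0 q0 k0.
rewrite -/nu -/W -/H -/tau in hQ.
set f := lin_comb psi a in hQ *.
set fQ := lin_comb psi (maurey_coef a Q) in hQ.
have bf : bmeas f by exact: bmeas_lin.
have bQ : bmeas fQ by exact: bmeas_lin.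
pose g0 x := thr (tau / 2) (f x); pose gQ x := thr (tau / 2) (fQ x).
have bg0 : bmeas g0 by exact: bmeas_thr.
have bgQ : bmeas gQ by exact: bmeas_thr.
have tau20 : 0 <= tau / 2 by rewrite divr_ge0// ltW.
have D : nrm P (fun x => gQ x - g0 x) <= w * e1.
  rewrite -(ler_pXn2r (ltn0Sn 1)) ?nnegrE ?nrm_ge0// ?mulr_ge0 ?(ltW w0)//.
  by rewrite exprMn wE; apply: (le_trans hQ); rewrite ler_pM2l.
have nf : nrm P f <= w.
  rewrite nrm_lin//; apply: ler_wsqrtr.
  rewrite (bigID (mem U)) /= addrC big1 ?add0r => [|n nU]; last by rewrite aU// expr0n.
  apply: (@le_trans _ _ (\sum_(n in U) t ^+ 2)); last by rewrite sumr_const /W mulr_natl.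
  apply: ler_sum => n _; rewrite -(real_normK (num_real (a n))) lerXn2r ?nnegrE// ltW//.
set X := Ex P _.
set y := nrm P g0.
have y0 : 0 <= y by exact: nrm_ge0.
have yX : y ^+ 2 <= X.
  by rewrite nrm2; apply: Ex_le; [bm..|] => x; exact: thr_sqr_le.
have X1 : X <= Ex P (fun x => f x * gQ x) + w * (w * e1).
  rewrite /X (@eq_Ex _ _ _ _ _ (fun x => f x * gQ x + f x * (g0 x - gQ x))); last first.
    by move=> x; rewrite /g0; ring.
  rewrite ExD; [|bm..]; rewrite lerD2l.
  apply: (le_trans (Ex_cauchy_schwarz _ _ _)); [bm..|].
  apply: ler_pM; rewrite ?nrm_ge0//; apply: le_trans D.
  by apply: nrm_mono; [bm..|] => x; rewrite distrC.
(* The factor 2 / tau turns the threshold tau / 2 into the threshold 1 of [netfun]. *)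
pose c n := 2 / tau * maurey_coef a Q n.
pose G x := thr 1 (lin_comb psi c x).
have gQE x : gQ x = tau / 2 * G x.
  rewrite /G lin_combZ -thrZ// mulr1 /gQ; congr thr.
  by rewrite /fQ; field; rewrite gt_eqF.
have cs : (#|[set n | c n != 0%R]%SET| <= q)%N.
  apply: leq_trans (maurey_coef_supp a Q); apply: subset_leq_card; apply/fintype.subsetP => n.
  by rewrite !inE /c mulf_eq0 negb_or => /andP[].
have nuN : nu <= N%:R by rewrite ler_nat (leq_trans (max_card _))// card_ord.
have wt : t <= w.
  rewrite -(ler_pXn2r (ltn0Sn 1)) ?nnegrE ?(ltW t0) ?(ltW w0)// wE /W ler_peMl ?sqr_ge0//.
have cN n : `|c n| <= N%:R ^+ 4.
  rewrite /c normrM gtr0_norm ?divr_gt0//.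
  rewrite mulrAC ler_pdivrMr//.
  have := maurey_coef_le U0 at_ q0 Q n; rewrite -/nu => hc.
  apply: (@le_trans _ _ (2 * (nu * t))); first by rewrite ler_pM2l.
  have tt : t <= tau by rewrite tauE (le_trans wt)// ler_peMl// ltW.
  apply: (@le_trans _ _ (2 * N%:R * tau)).
    by rewrite -mulrA ler_pM2l// ler_pM// ltW.
  rewrite ler_pM2r// exprS mulrC ler_pM2l//.
  rewrite -natrX ler_nat; apply: (@leq_trans (3 ^ 3)) => //.
  by rewrite leq_exp2r.
have bI (n : 'I_N) : ~~ (u <= n < u + M)%N -> a n = 0.
  by move=> nI; apply: aU; apply: contra nI => /UI.
have al : \sum_n `|a n| <= nu * t.
  rewrite (bigID (mem U)) /= addrC big1 ?add0r => [|n nU]; last by rewrite aU// normr0.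
  apply: (@le_trans _ _ (\sum_(n in U) t)); last by rewrite sumr_const mulr_natl.
  by apply: ler_sum.
have nc := net_correlation psi_bm psi_on psi_A N3 AN A1 psi_good M0 hq hm cs cN bI at_ al m0.
rewrite -(nrm_lin psi_bm psi_on) -/f -/G in nc.
have EfG : Ex P (fun x => f x * gQ x) = tau / 2 * Ex P (fun x => f x * G x).
  have bG : bmeas G by apply: bmeas_thr; exact: bmeas_lin.
  rewrite -ExZ; [|bm..]; apply: eq_Ex => x; rewrite gQE; ring.
have nQ : nrm P gQ <= y + w * e1.
  apply: (@le_trans _ _ (nrm P (fun x => g0 x + (gQ x - g0 x)))).
    by apply: nrm_mono; [bm..|] => x; rewrite addrC subrK.
  by apply: (le_trans (nrm_triangle _ _ _)); [bm..|]; rewrite lerD2l.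
have nQE : nrm P gQ = tau / 2 * nrm P G.
  have bG : bmeas G by apply: bmeas_thr; exact: bmeas_lin.
  rewrite -[in RHS](ger0_norm tau20) -nrmZ//; congr nrm; apply/funext => x; exact: gQE.
have wnu : w = Num.sqrt nu * t.
  by rewrite /w /W sqrtrM ?ltW// sqrtr_sqr gtr0_norm.
have snu : Num.sqrt nu ^+ 2 = nu by rewrite sqr_sqrtr// ltW.
have snu0 : 0 < Num.sqrt nu by rewrite sqrtr_gt0.
have coef : t * Num.sqrt m%:R + nu * t * Num.sqrt (expR 1 * Num.sqrt (M%:R / N%:R) / m%:R) <= w * g.
  apply: (@le_trans _ _ (w * (Num.sqrt (m%:R / nu) +
      Num.sqrt (nu * (expR 1 * Num.sqrt (M%:R / N%:R)) / m%:R)))); last by rewrite ler_pM2l.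
  rewrite le_eqVlt; apply/orP; left; apply/eqP.
  rewrite [Num.sqrt (m%:R / nu)]sqrtrM ?ler0n// sqrtrV ?(ltW nu0)//.
  rewrite -[nu * _ / _]mulrA [Num.sqrt (nu * _)]sqrtrM ?(ltW nu0)//.
  set E := Num.sqrt (_ / m%:R); rewrite wnu -{1}snu.
  by field; rewrite gt_eqF.
pose eta := Num.sqrt kap / N%:R / 2.
have eta0 : 0 <= eta by rewrite !divr_ge0 ?sqrtr_ge0 ?ler0n.
have tN : tau / 2 / N%:R = w * eta by rewrite tauE /eta; field; rewrite gt_eqF.
have g00 : 0 <= g by apply: le_trans hg; rewrite addr_ge0 ?sqrtr_ge0.
have main : Ex P (fun x => f x * gQ x) <= w * g * (y + w * e1 + w * eta) + w * (w * eta).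
  rewrite EfG; apply: (@le_trans _ _ (tau / 2 * (w * g * (nrm P G + N%:R^-1) + w / N%:R))).
    rewrite ler_wpM2l//; apply: (le_trans nc); apply: lerD; last by rewrite ler_pM2r ?invr_gt0.
    by rewrite ler_wpM2r// addr_ge0 ?nrm_ge0 ?invr_ge0 ?ler0n.
  rewrite mulrDr; apply: lerD; last by rewrite -tN le_eqVlt; apply/orP; left; apply/eqP; ring.
  rewrite mulrCA ler_wpM2l ?mulr_ge0 ?(ltW w0)// mulrDr -nQE tN.
  by rewrite lerD2r.
have fin := quad_absorb g00 g1 e10 eta0 yX X1 main.
apply: (le_trans fin); rewrite wE ler_pM2l// lerD2l /eta.
by rewrite le_eqVlt; apply/orP; left; apply/eqP; field; rewrite gt_eqF.
Qed.

End FlatBound.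

(** * Chaining over the sizes of the coefficients *)

Lemma sum_shift_le (R : numDomainType) (W : nat -> R) (J k : nat) :
  (forall j, 0 <= W j) -> \sum_(i < J | (k <= i)%N) W (i - k)%N <= \sum_(j < J) W j.
Proof.
move=> W0; have [Jk|kJ] := leqP J k.
  rewrite big1 ?sumr_ge0// => i ki.
  by have := leq_ltn_trans ki (ltn_ord i); rewrite ltnNge Jk.
have -> : \sum_(i < J | (k <= i)%N) W (i - k)%N = \sum_(j < J - k) W j.
  rewrite -(big_mkord (fun i => k <= i)%N (fun i => W (i - k)%N)).
  rewrite (big_cat_nat (n := k)) ?leq0n ?(ltnW kJ)//= big_nat_cond big1 ?add0r; last by lia.
  rewrite big_nat_cond (eq_bigl (fun i => (k <= i < J)%N)); last by move=> i /=; lia.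
  rewrite -big_nat -[X in index_iota X _]add0n big_addn big_mkord.
  by apply: eq_bigr => i _; rewrite addnK.
rewrite (big_ord_widen J W (leq_subr k J)) big_mkcond /=.
by apply: ler_sum => j _; case: ifP.
Qed.

Section Chain.
Context {R : realType} {d : measure_display} {T : measurableType d}.
Variable P : probability T R.
Variables (N : nat) (psi : 'I_N -> T -> R) (A C2 : R).
Hypothesis psi_bm : forall n, bmeas (psi n).
Hypothesis psi_on : forall i j, Ex P (fun x => psi i x * psi j x) = (i == j)%:R.
Hypothesis psi_A : forall n x, `|psi n x| <= A.
Hypothesis N3 : (3 <= N)%N.
Hypothesis AN : A <= N%:R.
Hypothesis A1 : 1 <= A.
Hypothesis psi_good : good P psi C2 1%g.

Let Nr : 0 < N%:R :> R. Proof. by rewrite ltr0n; lia. Qed.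
Let h (j : nat) : R := 2^-1 ^+ j.
Let h0 j : 0 < h j. Proof. by rewrite exprn_gt0// invr_gt0. Qed.
Let hS j : h j = 2 * h j.+1. Proof. by rewrite /h exprS; field. Qed.

Section Levels.
Variable a : 'I_N -> R.
Hypothesis a2 : \sum_n a n ^+ 2 <= 1.

(** The chain starts at j = 0, where no coefficient exceeds 1, and stops at j = J, where the
    discarded coefficients are at most 2^-J <= 1 / N. *)
Definition above (j : nat) (n : 'I_N) : R := if h j < `|a n| then a n else 0.
Definition lev (j : nat) (n : 'I_N) : R := above j.+1 n - above j n.
Definition levset (j : nat) : {set 'I_N} := [set n | h j.+1 < `|a n| <= h j].
Definition lev_weight (j : nat) : R := #|levset j|%:R * h j ^+ 2.

Lemma coef_le1 n : `|a n| <= 1.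
Proof.
rewrite -(ler_pXn2r (ltn0Sn 1)) ?nnegrE// real_normK ?num_real// expr1n.
by apply: le_trans a2; rewrite (bigD1 n)//= lerDl sumr_ge0// => i _; exact: sqr_ge0.
Qed.

Lemma above0 n : above 0 n = 0.
Proof. by rewrite /above /h expr0 ltNge coef_le1. Qed.

Lemma levE j n : lev j n = if n \in levset j then a n else 0.
Proof.
rewrite /lev /above inE; have := hS j; have := h0 j.+1.
by case: (ltP (h j.+1) `|a n|); case: (ltP (h j) `|a n|) => //= *; rewrite ?subrr ?subr0//; lra.
Qed.

Lemma lev_le j n : `|lev j n| <= h j.
Proof.
rewrite levE inE; case: ifP => [/andP[_ //]|_]; first by rewrite normr0 ltW.
Qed.

Lemma lev_sqr j n : lev j n ^+ 2 = above j.+1 n ^+ 2 - above j n ^+ 2.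
Proof.
rewrite /lev /above; have := hS j; have := h0 j.+1.
by case: (ltP (h j.+1) `|a n|); case: (ltP (h j) `|a n|) => //= *;
  rewrite ?expr0n/= ?subrr ?expr0n ?subr0//; lra.
Qed.

Lemma above_card j : #|[set n | h j < `|a n|]|%:R <= 4 ^+ j :> R.
Proof.
have hj : h j ^+ 2 * 4 ^+ j = 1.
  by rewrite /h -exprM mulnC exprM -exprMn (_ : _ * _ = 1) ?expr1n//; field.
have : #|[set n | h j < `|a n|]|%:R * h j ^+ 2 <= 1.
  apply: le_trans a2; rewrite mulr_natl -sumr_const big_mkcond /=.
  apply: ler_sum => n _; rewrite inE; case: ifP => hn; last exact: sqr_ge0.
  by rewrite -(real_normK (num_real (a n))) lerXn2r ?nnegrE// ltW.
move=> hc; rewrite -(ler_pM2r (exprn_gt0 2 (h0 j))); apply: (le_trans hc).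
by rewrite mulrC hj.
Qed.

Lemma levset_card j : #|levset j|%:R <= 4 ^+ j.+1 :> R.
Proof.
apply: le_trans (above_card j.+1); rewrite ler_nat; apply: subset_leq_card.
by apply/fintype.subsetP => n; rewrite !inE => /andP[].
Qed.

Lemma lev_weight_ge0 j : 0 <= lev_weight j. Proof. by rewrite mulr_ge0 ?ler0n ?sqr_ge0. Qed.

(** Coefficients of a level exceed h j / 2, which costs the factor 4 against the total square sum
    1. *)
Lemma lev_weight_sum J : \sum_(j < J) lev_weight j <= 4.
Proof.
apply: (@le_trans _ _ (\sum_(j < J) 4 * \sum_n lev j n ^+ 2)).
  apply: ler_sum => j _; rewrite /lev_weight mulr_natl -sumr_const big_mkcond /= mulr_sumr.
  apply: ler_sum => n _; rewrite levE; case: ifP; rewrite ?expr0n ?mulr0//= inE => /andP[h1 h2].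
  rewrite hS -(real_normK (num_real (a n))); have := h0 j.+1; nra.
rewrite -mulr_sumr exchange_big /= ger_pMr//.
apply: le_trans a2; apply: ler_sum => n _.
under eq_bigr do rewrite lev_sqr.
rewrite -(big_mkord xpredT (fun j => above j.+1 n ^+ 2 - above j n ^+ 2)) telescope_sumr// above0 expr0n subr0 /above.
by case: ifP => // _; rewrite expr0n sqr_ge0.
Qed.

Lemma lin_lev j x : lin_comb psi (lev j) x = lin_comb psi (above j.+1) x - lin_comb psi (above j) x.
Proof. by rewrite /lin_comb -sumrB; apply: eq_bigr => n _; rewrite mulrBl. Qed.

Lemma above_sub j r x :
  lin_comb psi (above j.+1) x - lin_comb psi (above (j.+1 - r)) x =
  \sum_(k < r | (k <= j)%N) lin_comb psi (lev (j - k)) x.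
Proof.
elim: r => [|r IH]; first by rewrite subn0 subrr big_ord0.
rewrite big_mkcond big_ord_recr -big_mkcond /= -IH.
case: leqP => rj; last first.
  by rewrite addr0 (_ : j.+1 - r.+1 = j.+1 - r)%N//; lia.
rewrite lin_lev (_ : (j - r).+1 = j.+1 - r)%N; last lia.
rewrite (_ : j - r = j.+1 - r.+1)%N; last lia.
ring.
Qed.

(** [tau] is the threshold of the chain and [r] the number of levels treated as close to a given
    one. [mm p] bounds the hits of net functions with 4^p terms; [kap] and [D] are the threshold
    parameter and the relative error of the estimate for flat combinations. *)
Variables (tau : R) (u M J r : nat) (mm : nat -> nat) (kap1 kap D E : R).
Hypothesis tauA : A <= tau.
Hypothesis tauN : tau <= N%:R.
Hypothesis aI : forall n : 'I_N, ~~ (u <= n < u + M)%N -> a n = 0.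
Hypothesis M0 : (0 < M)%N.
Hypothesis JN : (N <= 2 ^ J)%N.
Hypothesis J4 : (4 ^ J <= N ^ 3)%N.
Hypothesis EE : E = expR 1 * Num.sqrt (M%:R / N%:R).
Hypothesis mm_cond : forall p, (p <= J)%N -> 2 * C2 * (4 ^ p)%N%:R * ln N%:R <= (mm p)%:R * ln (N%:R / M%:R).
Hypothesis mm_ge : forall p, (4 ^ p <= mm p)%N.
Hypothesis mm_le : forall p, (mm p)%:R <= kap1 * 4 ^ p.
Hypothesis kap0 : 0 <= kap.
Hypothesis D0 : 0 <= D.
Hypothesis flat : forall (U : {set 'I_N}) (b : 'I_N -> R) (t : R),
  (0 < #|U|)%N -> (forall n, n \notin U -> b n = 0) -> (forall n, `|b n| <= t) -> 0 < t ->
  (forall n : 'I_N, n \in U -> (u <= n < u + M)%N) ->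
  let W := #|U|%:R * t ^+ 2 in
  Ex P (fun x => lin_comb psi b x * thr (Num.sqrt (kap * W) / 2) (lin_comb psi b x)) <= W * D.

Let Ff j := lin_comb psi (above j).
Let f j := lin_comb psi (lev j).
Let bF j : bmeas (Ff j). Proof. exact: bmeas_lin. Qed.
Let bf j : bmeas (f j). Proof. exact: bmeas_lin. Qed.
Let tau0 : 0 < tau. Proof. by apply: lt_le_trans tauA; apply: lt_le_trans A1. Qed.
Let bth j : bmeas (fun x => thr tau (Ff j x)). Proof. exact: bmeas_thr. Qed.

Lemma above_sum j : \sum_n above j n ^+ 2 <= 1.
Proof.
apply: le_trans a2; apply: ler_sum => n _; rewrite /above.
by case: ifP => // _; rewrite expr0n sqr_ge0.
Qed.

Definition exc j x : R := (tau < `|Ff j x|)%R%:R.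

Lemma bmeas_exc j : bmeas (exc j).
Proof. by have b := bF j; rewrite /exc; bm. Qed.

Lemma exc01 j x : 0 <= exc j x <= 1.
Proof. by rewrite /exc; case: (_ < _); rewrite ?ler01 ?lexx. Qed.

Lemma Ex_exc j : Ex P (exc j) <= (tau ^+ 2)^-1.
Proof.
have b := bmeas_exc j; have b' := bF j.
have t2 : 0 < tau ^+ 2 by rewrite exprn_gt0.
rewrite -(ler_pM2l t2) mulfV ?gt_eqF// -ExZ//.
apply: le_trans (above_sum j); rewrite -(Ex_lin2 psi_bm psi_on); apply: Ex_le; [bm..|] => x.
rewrite /exc -/(Ff j x); case: ltP => h1; rewrite ?mulr1 ?mulr0 ?sqr_ge0//.
by rewrite -(real_normK (num_real (Ff j x))) lerXn2r ?nnegrE// ltW.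
Qed.

(** By [sqr_le_thr], f_i^2 is at most kap W plus twice f_i times its thresholding. The first part is
    paid on exceptional sets of total measure at most 2 / tau^2, the second by the flat estimate. *)
Lemma Ex_exc_lev j p i :
  Ex P (fun x => (exc j x + exc p x) * f i x ^+ 2) <= lev_weight i * (2 * kap / tau ^+ 2 + 4 * D).
Proof.
have b1 := bmeas_exc j; have b2 := bmeas_exc p; have b3 := bf i.
have [U0|U0] := posnP #|levset i|.
  have z x : f i x = 0.
    rewrite /f /lin_comb big1// => n _; rewrite levE.
    by rewrite (card0_eq U0) mul0r.
  under eq_Ex do rewrite z expr0n mulr0.
  by rewrite Ex_cst /lev_weight U0 !mul0r.
pose W := lev_weight i.
have W0 : 0 <= W by exact: lev_weight_ge0.
set t := Num.sqrt (kap * W) / 2.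
have t0 : 0 <= t by rewrite divr_ge0 ?sqrtr_ge0.
have tE : (2 * t) ^+ 2 = kap * W.
  by rewrite /t mulrC divfK ?pnatr_eq0// sqr_sqrtr// mulr_ge0.
have bt : bmeas (fun x => thr t (f i x)) by exact: bmeas_thr.
have fl : Ex P (fun x => f i x * thr t (f i x)) <= W * D.
  apply: flat => //.
  - by move=> n nU; rewrite levE (negbTE nU).
  - by move=> n; exact: lev_le.
  - move=> n; rewrite inE => /andP[hn _]; apply: contraT => /aI an.
    by move: hn; rewrite an normr0 ltNge ltW.
apply: (@le_trans _ _ (Ex P (fun x => kap * W * (exc j x + exc p x) + 4 * (f i x * thr t (f i x))))).
  apply: Ex_le; [bm..|] => x.
  have := sqr_le_thr (f i x) t0; rewrite tE.
  have /andP[] := exc01 j x; have /andP[] := exc01 p x.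
  have := thr_sqr_le (f i x) t0; have := sqr_ge0 (thr t (f i x)).
  set g := f i x * _; set kW := kap * W.
  move: (exc j x) (exc p x) (f i x ^+ 2) => e1 e2 F; nra.
rewrite ExD ?ExZ ?ExD; [|bm..].
have := Ex_exc j; have := Ex_exc p; rewrite -/W.
have kW : 0 <= kap * W by rewrite mulr_ge0.
set v := (tau ^+ 2)^-1; nra.
Qed.

(* Both thresholds vanish off {tau < |F_(j+1)|} and {tau < |F_(j+1-r)|}, sets of
   measure at most tau^-2; on them the flat estimate controls each level. *)
Lemma near_bound : \sum_(j < J) Ex P (fun x => f j x *
    (thr tau (Ff j.+1 x) - thr tau (Ff (j.+1 - r) x))) <=
  4 * r%:R * (2 * kap / tau ^+ 2 + 4 * D).
Proof.
set K := 2 * kap / tau ^+ 2 + 4 * D.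
have K0 : 0 <= K by rewrite addr_ge0 ?mulr_ge0 ?invr_ge0 ?sqr_ge0 ?(ltW tau0).
have term (j : nat) : Ex P (fun x => f j x *
    (thr tau (Ff j.+1 x) - thr tau (Ff (j.+1 - r) x))) <=
    \sum_(k < r | (k <= j)%N) (lev_weight j + lev_weight (j - k)) / 2 * K.
  have b1 := bmeas_exc j.+1; have b2 := bmeas_exc (j.+1 - r).
  have bj := bf j.
  have b3 := bth j.+1; have b4 := bth (j.+1 - r).
  pose om x := exc j.+1 x + exc (j.+1 - r) x.
  have bo : bmeas om by rewrite /om; bm.
  apply: (@le_trans _ _ (Ex P (fun x => \sum_(k < r | (k <= j)%N)
     2^-1 * (om x * f j x ^+ 2 + om x * f (j - k)%N x ^+ 2)))).
    apply: Ex_le; [by bm|by apply: bmeas_sum => k; have := bf (j - k); bm|] => x.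
    have om0 : 0 <= om x by rewrite addr_ge0//; case/andP: (exc01 j.+1 x); case/andP: (exc01 (j.+1 - r) x).
    have dl : `|thr tau (Ff j.+1 x) - thr tau (Ff (j.+1 - r) x)| <=
        om x * \sum_(k < r | (k <= j)%N) `|f (j - k)%N x|.
      have lip := thr_lip (Ff j.+1 x) (Ff (j.+1 - r) x) (ltW tau0).
      rewrite /Ff above_sub in lip.
      have lip2 := le_trans lip (ler_norm_sum _ _ _).
      rewrite -/(Ff _) -/(Ff _) in lip2.
      set S := \sum_(k < r | _) _ in lip2 *.
      have S0 : 0 <= S by apply: sumr_ge0.
      have [h1|h1] := ltP tau `|Ff j.+1 x|.
        apply: (le_trans lip2); rewrite ler_peMl// /om /exc h1 lerDl.
        by case/andP: (exc01 (j.+1 - r) x).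
      have [h2|h2] := ltP tau `|Ff (j.+1 - r) x|.
        apply: (le_trans lip2); rewrite ler_peMl// /om /exc h2 lerDr.
        by case/andP: (exc01 j.+1 x).
      by rewrite !thr_eq0// subrr normr0 mulr_ge0.
    apply: (le_trans (ler_norm _)); rewrite normrM.
    apply: (le_trans (ler_wpM2l (normr_ge0 _) dl)).
    rewrite mulrCA mulrA mulr_sumr; apply: ler_sum => k _.
    rewrite -!mulrDr mulrCA -mulrA ler_wpM2l//.
    rewrite -(real_normK (num_real (f j x))) -(real_normK (num_real (f (j - k)%N x))).
    have := sqr_ge0 (`|f j x| - `|f (j - k)%N x|); lra.
  rewrite Ex_sum; last by move=> k; have := bf (j - k); bm.
  apply: ler_sum => k _; have bk := bf (j - k).
  rewrite ExZ ?ExD; [|bm..].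
  have := Ex_exc_lev j.+1 (j.+1 - r) j; have := Ex_exc_lev j.+1 (j.+1 - r) (j - k).
  rewrite -/K; lra.
apply: (le_trans (ler_sum _ (fun (j : 'I_J) _ => term j))).
rewrite (exchange_big_dep xpredT)//=.
apply: (@le_trans _ _ (\sum_(k < r) 4 * K)); last first.
  by rewrite sumr_const card_ord -[leLHS]mulr_natl mulrA [r%:R * 4]mulrC.
apply: ler_sum => k _.
rewrite -mulr_suml ler_wpM2r// -mulr_suml big_split /=.
have s1 : \sum_(i < J | (k <= i)%N) lev_weight i <= 4.
  apply: le_trans (lev_weight_sum J); rewrite big_mkcond /=; apply: ler_sum => i _.
  by case: ifP => // _; exact: lev_weight_ge0.
have s2 : \sum_(i < J | (k <= i)%N) lev_weight (i - k) <= 4.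
  apply: le_trans (lev_weight_sum J); exact: sum_shift_le lev_weight_ge0.
lra.
Qed.

(** The two terms of [net_correlation] for level j against F_p, p = j + 1 - r. Since h j = 2 h p h
    r, the hits contribute h j sqrt (mm p) <= 2 sqrt kap1 2^-r; the other indices contribute at most
    2^(r+1) sqrt E, because the level has at most 4^(j+1) elements. *)
Let farB := 2 * (Num.sqrt kap1 * (2 * h r) + 2 ^+ r.+1 * Num.sqrt E) + tau / N%:R.

(* F_(j+1-r) has only 4^(j+1-r) coefficients: goodness gains a factor 2^-r. *)
Lemma far_bound j : (j < J)%N ->
  Ex P (fun x => f j x * thr tau (Ff (j.+1 - r) x)) <= farB.
Proof.
move=> jJ; set p := (j.+1 - r)%N.
have sk0 : 0 <= Num.sqrt kap1 by exact: sqrtr_ge0.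
have sE0 : 0 <= Num.sqrt E by exact: sqrtr_ge0.
have hr0 : 0 < h r by [].
have tN0 : 0 <= tau / N%:R by rewrite divr_ge0 ?ltW.
have far0 : 0 <= farB.
  by rewrite addr_ge0// mulr_ge0// addr_ge0// mulr_ge0 ?exprn_ge0// mulr_ge0// ltW.
have bj := bf j; have bp := bF p.
have [p0|p0] := posnP p.
  have z x : Ff p x = 0.
    by rewrite p0 /Ff /lin_comb big1// => n _; rewrite above0 mul0r.
  by under eq_Ex do rewrite z thr0 mulr0; rewrite Ex_cst.
have jpr : (j.+1 = p + r)%N by rewrite /p subnK// ltnW// -subn_gt0.
have pJ : (p <= J)%N by exact: leq_trans (leq_subr r j.+1) jJ.
have m4 : (0 < mm p)%N by apply: leq_trans (mm_ge p); rewrite expn_gt0.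
have hq : (0 < 4 ^ p <= N ^ 3)%N.
  by rewrite expn_gt0 /=; apply: leq_trans J4; rewrite leq_exp2l.
pose c n := tau^-1 * above p n.
have ti0 : 0 < tau^-1 by rewrite invr_gt0.
have cs : (#|[set n | c n != 0%R]%SET| <= 4 ^ p)%N.
  rewrite -(ler_nat R) natrX; apply: le_trans (above_card p); rewrite ler_nat.
  apply: subset_leq_card; apply/fintype.subsetP => n; rewrite !inE /c mulf_eq0 negb_or /above.
  by case: ifP; rewrite ?eqxx ?andbF.
have cN n : `|c n| <= N%:R ^+ 4.
  rewrite /c normrM gtr0_norm// mulrC ler_pdivrMr//.
  apply: (@le_trans _ _ 1).
    by rewrite /above; case: ifP => _; rewrite ?coef_le1 ?normr0.
  rewrite -[leLHS]mul1r; apply: ler_pM => //; last by apply: le_trans tauA.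
  by rewrite -natrX ler1n expn_gt0 (ltnW (ltnW N3)).
have bI (n : 'I_N) : ~~ (u <= n < u + M)%N -> lev j n = 0.
  by move=> /aI an; rewrite levE an; case: ifP.
have bl : \sum_n `|lev j n| <= #|levset j|%:R * h j.
  rewrite mulr_natl -sumr_const [leRHS]big_mkcond /=; apply: ler_sum => n _.
  rewrite levE inE; case: ifP; last by rewrite normr0.
  by case/andP.
have nc := net_correlation psi_bm psi_on psi_A N3 AN A1 psi_good M0 hq (mm_cond pJ) cs cN bI (lev_le j) bl m4.
rewrite -EE in nc.
pose G x := thr 1 (lin_comb psi c x).
have GE x : thr tau (Ff p x) = tau * G x.
  by rewrite /G lin_combZ -thrZ ?ltW// mulr1 mulrA mulfV ?gt_eqF// mul1r.
have bG : bmeas G by apply: bmeas_thr; exact: bmeas_lin.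
have nG : nrm P G <= tau^-1.
  rewrite -(ler_pM2l tau0) mulfV ?gt_eqF//.
  rewrite -{1}(gtr0_norm tau0) -nrmZ//.
  apply: (@le_trans _ _ (nrm P (Ff p))).
    apply: nrm_mono; [bm..|] => x; rewrite -GE; exact: thr_le (ltW tau0).
  by rewrite nrm_lin// -(@sqrtr1 R) ler_wsqrtr// above_sum.
rewrite (@eq_Ex _ _ _ _ _ (fun x => tau * (f j x * G x))); last by move=> x; rewrite GE; ring.
rewrite ExZ; last by bm.
have pj : 2 ^+ p * h p = 1 by rewrite /h -exprMn mulfV ?expr1n.
have hj : h j = 2 * h p * h r.
  by rewrite hS jpr /h exprD mulrA.
have p4 : 4 ^+ p = (2 ^+ p) ^+ 2 :> R.
  by rewrite -exprM mulnC exprM (_ : 2 ^+ 2 = 4)// expr2 -natrM.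
have s4 : Num.sqrt (4 ^+ p) = 2 ^+ p :> R.
  by rewrite p4 sqrtr_sqr ger0_norm ?exprn_ge0.
have c1 : h j * Num.sqrt (mm p)%:R <= Num.sqrt kap1 * (2 * h r).
  apply: (@le_trans _ _ (h j * (Num.sqrt kap1 * 2 ^+ p))).
    rewrite ler_pM2l// -s4 -sqrtrM; first by rewrite ler_wsqrtr.
    have := le_trans (ler0n R _) (mm_le p); rewrite pmulr_lge0 ?exprn_gt0//.
  rewrite hj (_ : 2 * h p * h r * (Num.sqrt kap1 * 2 ^+ p) = Num.sqrt kap1 * (2 * h r) * (2 ^+ p * h p)); last by ring.
  by rewrite pj mulr1.
have E0 : 0 <= E by rewrite EE mulr_ge0 ?expR_ge0 ?sqrtr_ge0.
have mmr : 4 ^+ p <= (mm p)%:R :> R by rewrite -natrX ler_nat.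
have mm0 : 0 < (mm p)%:R :> R by rewrite ltr0n.
have hp4 : h p ^+ 2 * 4 ^+ p = 1.
  by rewrite p4 -exprMn mulrC pj expr1n.
have c2 : #|levset j|%:R * h j * Num.sqrt (E / (mm p)%:R) <= 2 ^+ r.+1 * Num.sqrt E.
  apply: (@le_trans _ _ (4 ^+ j.+1 * h j * (Num.sqrt E * h p))).
    apply: ler_pM; [|exact: sqrtr_ge0| |].
    - by apply: mulr_ge0; [exact: ler0n|exact: ltW].
    - by rewrite ler_pM2r// levset_card.
    rewrite -[h p]ger0_norm ?(ltW (h0 p))// -sqrtr_sqr -sqrtrM// ler_wsqrtr//.
    rewrite ler_wpM2l// -(ler_pM2r mm0) mulVf ?gt_eqF//.
    by rewrite -[leLHS]hp4 ler_wpM2l ?sqr_ge0.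
  rewrite hj jpr exprD.
  rewrite (_ : 4 ^+ p * 4 ^+ r * (2 * h p * h r) * (Num.sqrt E * h p) = 2 * (4 ^+ r * h r) * Num.sqrt E * (h p ^+ 2 * 4 ^+ p)); last by ring.
  rewrite hp4 mulr1 exprS (_ : 4 ^+ r * h r = 2 ^+ r)// /h -exprMn; congr (_ ^+ r); by field.
have ls : Num.sqrt (\sum_n lev j n ^+ 2) <= 1.
  rewrite -(@sqrtr1 R) ler_wsqrtr//; apply: le_trans a2; apply: ler_sum => n _.
  by rewrite levE; case: ifP => // _; rewrite expr0n sqr_ge0.
set c3 := h j * Num.sqrt (mm p)%:R in c1 nc.
set c4 := #|levset j|%:R * h j * Num.sqrt (E / (mm p)%:R) in c2 nc.
have c30 : 0 <= c3 by rewrite mulr_ge0 ?sqrtr_ge0// ltW.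
have c40 : 0 <= c4 by rewrite !mulr_ge0 ?sqrtr_ge0// ltW.
have Ni : 0 < N%:R^-1 :> R by rewrite invr_gt0.
have t1 : tau * (c3 + c4) * (nrm P G + N%:R^-1) <= 2 * (c3 + c4).
  rewrite -mulrA mulrCA mulrC; apply: ler_wpM2r; first by rewrite addr_ge0.
  rewrite mulrDr (_ : 2 = 1 + 1)// lerD//.
    by rewrite mulrC -ler_pdivlMr// mul1r.
  by rewrite ler_pdivrMr// mul1r.
have t2 : tau * (Num.sqrt (\sum_n lev j n ^+ 2) / N%:R) <= tau / N%:R.
  by rewrite ler_pM2l// ler_piMl// ltW.
have : tau * Ex P (fun x => f j x * G x) <= tau * ((c3 + c4) * (nrm P G + N%:R^-1) + Num.sqrt (\sum_n lev j n ^+ 2) / N%:R).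
  by rewrite ler_pM2l.
rewrite mulrDr mulrA /farB; lra.
Qed.

(** At most N coefficients of size at most 2^-J <= 1 / N are dropped, with total contribution at
    most A <= tau; in [chain_bound] this uses the second tau of the threshold 2 tau. *)
Lemma residual_bound x : `|lin_comb psi a x| - A <= `|Ff J x|.
Proof.
have : `|lin_comb psi a x - Ff J x| <= A.
  rewrite /Ff /lin_comb -sumrB (le_trans (ler_norm_sum _ _ _))//.
  apply: (@le_trans _ _ (\sum_(n < N) h J * A)).
    apply: ler_sum => n _; rewrite -mulrBl normrM ler_pM// /above.
    by case: ltP => hn; rewrite ?subrr ?normr0 ?subr0// ltW.
  rewrite sumr_const card_ord -[leLHS]mulr_natl mulrA ger_pMl ?(lt_le_trans _ A1)//.
  have : N%:R <= 2 ^+ J :> R by rewrite -natrX ler_nat.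
  have e : 2 ^+ J * h J = 1 by rewrite /h -exprMn mulfV ?expr1n.
  by move=> /(ler_wpM2r (ltW (h0 J))); rewrite e.
have := lerB_normD (lin_comb psi a x - Ff J x) (Ff J x).
have := ler_normD (lin_comb psi a x - Ff J x) (Ff J x).
rewrite subrK; lra.
Qed.

(* With G_j = thr tau F_j, convexity telescopes Ex G_J^2 into the correlations of
   f_j with G_(j+1) = (G_(j+1) - G_(j+1-r)) + G_(j+1-r). *)
Lemma chain_bound :
  Ex P (fun x => Num.max (`|lin_comb psi a x| - 2 * tau) 0 ^+ 2) <=
  2 * (J%:R * farB + 4 * r%:R * (2 * kap / tau ^+ 2 + 4 * D)).
Proof.
have ba : bmeas (lin_comb psi a) by exact: bmeas_lin.
have bb := bth.
apply: (@le_trans _ _ (Ex P (fun x => thr tau (Ff J x) ^+ 2))).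
  apply: Ex_le; [bm..|by have := bth J; bm|] => x.
  rewrite -[leRHS](real_normK (num_real _)) (thr_norm _ (ltW tau0)).
  have m0 (y : R) : 0 <= Num.max y 0 by rewrite le_max lexx orbT.
  apply: lerXn2r; [exact: m0|exact: m0|].
  have rb := residual_bound x; rewrite /Num.max; have := tauA.
  by case: ltP => ?; case: ltP => ? ?; lra.
have z x : Ff 0 x = 0.
  by rewrite /Ff /lin_comb big1// => n _; rewrite above0 mul0r.
have tele : Ex P (fun x => thr tau (Ff J x) ^+ 2) =
    \sum_(j < J) (Ex P (fun x => thr tau (Ff j.+1 x) ^+ 2) - Ex P (fun x => thr tau (Ff j x) ^+ 2)).
  rewrite -(big_mkord xpredT (fun j => Ex P (fun x => thr tau (Ff j.+1 x) ^+ 2) - Ex P (fun x => thr tau (Ff j x) ^+ 2))).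
  rewrite telescope_sumr//.
  rewrite [X in _ - X](_ : _ = 0) ?subr0//.
  by under eq_Ex do rewrite z thr0 expr0n; rewrite Ex_cst.
rewrite tele.
apply: (@le_trans _ _ (\sum_(j < J) 2 * (Ex P (fun x => f j x * thr tau (Ff (j.+1 - r) x)) +
   Ex P (fun x => f j x * (thr tau (Ff j.+1 x) - thr tau (Ff (j.+1 - r) x)))))).
  apply: ler_sum => j _.
  have b1 := bth j; have b2 := bth j.+1; have b3 := bth (j.+1 - r); have b4 := bf j.
  rewrite -ExB -?ExD -?ExZ; [|bm..]; apply: Ex_le; [bm..|] => x.
  apply: (le_trans (thr_convex _ _ (ltW tau0))).
  rewrite -(lin_lev j x) -/(f j).
  by rewrite le_eqVlt; apply/orP; left; apply/eqP; ring.
rewrite -mulr_sumr ler_pM2l// big_split /=; apply: lerD; last exact: near_bound.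
apply: (@le_trans _ _ (\sum_(j < J) farB)); last by rewrite sumr_const card_ord mulr_natl.
by apply: ler_sum => j _; exact: far_bound.
Qed.

End Levels.
End Chain.

(** * Maximal partial sums *)

Section Maximal.
Context {R : realType} {d : measure_display} {T : measurableType d}.
Variable P : probability T R.
Variables (N : nat) (psi : 'I_N -> T -> R).
Hypothesis psi_bm : forall n, bmeas (psi n).
Hypothesis psi_on : forall i j, Ex P (fun x => psi i x * psi j x) = (i == j)%:R.
Variables (a mu : 'I_N -> R).
Hypothesis mu0 : forall n, 0 < mu n.
Hypothesis mu_a : forall n, a n ^+ 2 <= mu n.

Definition trunc (u v : nat) (n : 'I_N) : R := if (u <= n < v)%N then a n else 0.
Definition psum (u v : nat) (x : T) : R := lin_comb psi (trunc u v) x.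
Definition mass (u v : nat) : R := \sum_(n < N | (u <= n < v)%N) mu n.
(** Starting at p = 0 instead of p = u only adds empty sums. *)
Definition maxpsum (u v : nat) (x : T) : R := \big[Num.max/0]_(p < v.+1) `|psum u p x|.
Definition maxexc (t : R) (u v : nat) : R := nrm P (fun x => Num.max (maxpsum u v x - t) 0).

Lemma bmeas_psum u v : bmeas (psum u v). Proof. exact: bmeas_lin. Qed.
Hint Resolve bmeas_psum : core.
Lemma bmeas_maxpsum u v : bmeas (maxpsum u v). Proof. by rewrite /maxpsum; bm. Qed.
Hint Resolve bmeas_maxpsum : core.

Lemma maxpsum_ge0 u v x : 0 <= maxpsum u v x.
Proof. exact: bigmax_ge_id. Qed.

Lemma psum_le_maxpsum u v p x : (p <= v)%N -> `|psum u p x| <= maxpsum u v x.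
Proof.
move=> pv; have h : (p < v.+1)%N by [].
exact: (le_bigmax _ (fun p : 'I_v.+1 => `|psum u p x|) (Ordinal h)).
Qed.

Lemma mass_ge0 u v : 0 <= mass u v.
Proof. by apply: sumr_ge0 => n _; rewrite ltW. Qed.

Lemma mass_cat u p v : (u <= p)%N -> (p <= v)%N -> mass u v = mass u p + mass p v.
Proof.
move=> up pv; rewrite /mass (bigID (fun n : 'I_N => (n < p)%N)) /=; congr (_ + _);
  apply: eq_bigl => n; lia.
Qed.

Lemma mass_mono u v u' v' : (u' <= u)%N -> (v <= v')%N -> mass u v <= mass u' v'.
Proof.
move=> uu vv; rewrite /mass big_mkcond [leRHS]big_mkcond /=; apply: ler_sum => n _.
case: ifP => h; first by rewrite (_ : (_ && _) = true)//; lia.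
by case: ifP => // _; rewrite ltW.
Qed.

Lemma mass_gt0 u v (n : 'I_N) : (u <= n < v)%N -> 0 < mass u v.
Proof.
move=> h; rewrite /mass (bigD1 n)//= ltr_pwDl// sumr_ge0// => i _; exact: ltW.
Qed.

Lemma mass1 (n : 'I_N) : mass n n.+1 = mu n.
Proof.
rewrite /mass (big_pred1 n)// => i /=; rewrite -val_eqE /=; lia.
Qed.

Lemma mass_nil u : mass u u = 0.
Proof. by rewrite /mass big_pred0// => n; lia. Qed.

Lemma psum_cat u p v x : (u <= p)%N -> (p <= v)%N -> psum u v x = psum u p x + psum p v x.
Proof.
move=> up pv; rewrite /psum /lin_comb -big_split /=; apply: eq_bigr => n _.
rewrite -mulrDl /trunc; congr (_ * _).
case: (ltnP n p) => np; first by rewrite (leq_trans np pv) /= addr0.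
by rewrite andbF /= add0r (leq_trans up np).
Qed.

Lemma psum1 (n : 'I_N) x : psum n n.+1 x = a n * psi n x.
Proof.
rewrite /psum /lin_comb (bigD1 n)//= /trunc leqnn ltnSn big1 ?addr0// => i ni.
case: ifP => h; last by rewrite mul0r.
by exfalso; move/negP: ni; apply; rewrite -val_eqE /=; lia.
Qed.

Lemma psum_nil u v x : (v <= u)%N -> psum u v x = 0.
Proof.
move=> vu; rewrite /psum /lin_comb big1// => n _; rewrite /trunc.
by case: ifP => h; [exfalso; lia | rewrite mul0r].
Qed.

Lemma trunc_sqr u v : \sum_n trunc u v n ^+ 2 <= mass u v.
Proof.
rewrite /mass [leRHS]big_mkcond; apply: ler_sum => n _; rewrite /trunc.
by case: ifP => // _; rewrite expr0n.
Qed.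

Lemma nrm_psum u v : nrm P (psum u v) <= Num.sqrt (mass u v).
Proof. by rewrite nrm_lin// ler_wsqrtr// trunc_sqr. Qed.

Variable A : R.
Hypothesis psi_A : forall n x, `|psi n x| <= A.
Hypothesis A1 : 1 <= A.

(** p is the index at which the mass counted from u passes one half. Its own term may be heavy, so
    it belongs to neither half; it costs at most A sqrt (mass). Partial sums ending beyond p are the
    left half, this term, and a partial sum of the right half. *)
Lemma median_split u v : (u < v <= N)%N -> exists p, [/\ (u <= p < v)%N,
  mass u p <= mass u v / 2, mass p.+1 v <= mass u v / 2 &
  forall x, maxpsum u v x <= `|psum u p x| + A * Num.sqrt (mass u v) + Num.max (maxpsum u p x) (maxpsum p.+1 v x)].
Proof.
move=> /andP[uv vN].
have uN : (u < N)%N by exact: leq_trans uv vN.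
have m0 : 0 < mass u v by apply: (@mass_gt0 _ _ (Ordinal uN)); rewrite /= leqnn uv.
have exq : exists q, (u < q)%N && (mass u v / 2 < mass u q).
  by exists v; rewrite uv /=; lra.
have := ex_minnP exq; case=> q /andP[uq mq] minq.
have qv : (q <= v)%N by apply: minq; rewrite uv /=; lra.
case: q uq mq minq qv => // p; rewrite ltnS => up mp minp pv.
have mup : mass u p <= mass u v / 2.
  move: up; rewrite leq_eqVlt => /predU1P[<-|up]; first by rewrite mass_nil divr_ge0// ltW.
  rewrite leNgt; apply/negP => h; have := minp p; rewrite up h => /(_ isT).
  by rewrite ltnn.
exists p; split; first by rewrite up pv.
- exact: mup.
- by have := @mass_cat u p.+1 v (leqW up) pv; lra.
move=> x; apply/bigmax_leP; split.
  by rewrite !addr_ge0 ?mulr_ge0 ?sqrtr_ge0// ?le_max ?maxpsum_ge0// (le_trans _ A1).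
move=> j _; have jv : (j <= v)%N by rewrite -ltnS.
have A0 : 0 <= A by apply: le_trans A1.
have s0 := sqrtr_ge0 (mass u v).
have [jp|pj] := leqP j p.
  apply: (@le_trans _ _ (maxpsum u p x)); first exact: psum_le_maxpsum.
  apply: (@le_trans _ _ (Num.max (maxpsum u p x) (maxpsum p.+1 v x))); first by rewrite le_max lexx.
  by rewrite lerDr addr_ge0// mulr_ge0.
rewrite (@psum_cat u p j)//; last exact: ltnW.
rewrite (@psum_cat p p.+1 j)// addrA.
have pN : (p < N)%N by exact: leq_trans pv vN.
rewrite (psum1 (Ordinal pN)).
apply: (le_trans (ler_normD _ _)); apply: lerD; last first.
  by apply: (@le_trans _ _ (maxpsum p.+1 v x)); [exact: psum_le_maxpsum | rewrite le_max lexx orbT].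
apply: (le_trans (ler_normD _ _)); rewrite lerD2l normrM mulrC ler_pM//.
rewrite -sqrtr_sqr ler_wsqrtr//; apply: (le_trans (mu_a _)).
rewrite -(mass1 (Ordinal pN)); apply: mass_mono => //=.
Qed.

(** The threshold t pays s1 for the sum of the left half, s0 for the middle term and t' for the two
    halves. The excess of a maximum of two is bounded by the root of the sum of the squared
    excesses; as masses add up, iteration adds errors instead of multiplying them. *)
Lemma maxexc_split (u v : nat) (t t' s1 s0 c0 : R) : (u < v <= N)%N -> 0 <= c0 ->
  A * Num.sqrt (mass u v) <= s0 + c0 -> s0 + s1 + t' <= t ->
  exists p, [/\ (u <= p < v)%N, mass u p <= mass u v / 2, mass p.+1 v <= mass u v / 2 &
    maxexc t u v <= nrm P (fun x => Num.max (`|psum u p x| - s1) 0) + c0 +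
      Num.sqrt (maxexc t' u p ^+ 2 + maxexc t' p.+1 v ^+ 2)].
Proof.
move=> uv c00 hA ht; have [p [h1 h2 h3 h4]] := median_split uv.
exists p; split => //.
have b1 := bmeas_psum u p; have b2 := bmeas_maxpsum u p; have b3 := bmeas_maxpsum p.+1 v; have b4 := bmeas_maxpsum u v.
pose H1 x := Num.max (maxpsum u p x - t') 0; pose H2 x := Num.max (maxpsum p.+1 v x - t') 0.
pose G x := Num.max (`|psum u p x| - s1) 0.
have b5 : bmeas H1 by rewrite /H1; bm.
have b6 : bmeas H2 by rewrite /H2; bm.
have b7 : bmeas G by rewrite /G; bm.
have mx0 (z : R) : 0 <= Num.max z 0 by rewrite le_max lexx orbT.
apply: (@le_trans _ _ (nrm P (fun x => (G x + c0) + Num.max (H1 x) (H2 x)))).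
  apply: nrm_mono; [bm..|] => x.
  have GG : 0 <= G x + c0 + Num.max (H1 x) (H2 x).
    by rewrite addr_ge0 ?addr_ge0 ?mx0// le_max mx0.
  rewrite (ger0_norm (mx0 _)) (ger0_norm GG) ge_max GG andbT.
  have g1 : `|psum u p x| - s1 <= G x by rewrite le_max lexx.
  have g2 : Num.max (maxpsum u p x) (maxpsum p.+1 v x) <= Num.max (H1 x) (H2 x) + t'.
    by rewrite ge_max -!lerBlDr !le_max !lexx ?orbT.
  have := h4 x; lra.
have bG : bmeas (fun x => G x + c0) by bm.
have bH : bmeas (fun x => Num.max (H1 x) (H2 x)) by bm.
apply: (le_trans (nrm_triangle P bG bH)); apply: lerD.
  apply: (le_trans (nrm_triangle P b7 (bmeas_cst c0))); rewrite lerD2l.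
  by apply: nrm_le => //; rewrite Ex_cst.
apply: ler_wsqrtr; rewrite !nrm2 -ExD; [|bm..]; apply: Ex_le; [bm..|] => x.
have := sqr_ge0 (H1 x); have := sqr_ge0 (H2 x).
by case: (leP (H1 x) (H2 x)) => _; rewrite -/(H1 x) -/(H2 x); lra.
Qed.

Lemma maxexc_nil t u v : (v <= u)%N -> 0 <= t -> maxexc t u v = 0.
Proof.
move=> vu t0; rewrite /maxexc (_ : (fun _ => _) = fun=> 0); last first.
  apply/funext => x; apply/max_idPr; rewrite subr_le0; apply: le_trans t0.
  apply/bigmax_leP; split=> // p _.
  by rewrite psum_nil ?normr0// (leq_trans _ vu)// -ltnS.
by rewrite /nrm (@eq_Ex _ _ _ _ _ (fun=> 0)) ?Ex_cst ?sqrtr0// => x; rewrite expr0n.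
Qed.

Lemma maxexc_mono t t' u v : t' <= t -> maxexc t u v <= maxexc t' u v.
Proof.
move=> tt; have b := bmeas_maxpsum u v; apply: nrm_mono; [bm..|] => x.
rewrite /Num.max; do 2 case: ltP => ?; rewrite ?normr0// !ger0_norm//; lra.
Qed.

Section Window.
Variables (u0 v0 : nat).
Hypothesis v0N : (v0 <= N)%N.

Definition psum_excess_le (K dl : R) := forall u p w, (u0 <= u)%N -> (p <= v0)%N -> mass u p <= w ->
  nrm P (fun x => Num.max (`|psum u p x| - Num.sqrt (K * w) / 10) 0) <= dl * Num.sqrt w.

Definition maxexc_le (K e : R) := forall u v, (u0 <= u)%N -> (v <= v0)%N ->
  maxexc (Num.sqrt (K * mass u v)) u v <= e * Num.sqrt (mass u v).

(* The threshold is split as 1/10 + 1/10 + 8/10, and (8/10)^2 * 2 = 128/100: on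
   the half-mass children the threshold parameter K grows by that factor. *)
Lemma maxexc_step K e dl : 0 <= e -> 0 <= dl -> (10 * A) ^+ 2 <= K ->
  psum_excess_le K dl -> maxexc_le (128 / 100 * K) e -> maxexc_le K (dl + e).
Proof.
move=> e0 dl0 KA hd hH u v uu vv.
have [vu|uv] := leqP v u; first by rewrite maxexc_nil ?sqrtr_ge0// mulr_ge0 ?sqrtr_ge0 ?addr_ge0.
have A0 : 0 <= A by apply: le_trans A1.
have K0 : 0 <= K by apply: le_trans KA; exact: sqr_ge0.
have m0 := mass_ge0 u v.
pose s := Num.sqrt (K * mass u v).
have sE : s = Num.sqrt K * Num.sqrt (mass u v) by rewrite /s sqrtrM.
have s0 : 0 <= s by exact: sqrtr_ge0.
have As : A * Num.sqrt (mass u v) <= s / 10 + 0.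
  rewrite addr0 sE; have : 10 * A <= Num.sqrt K.
    by rewrite -[leLHS]ger0_norm ?mulr_ge0// -sqrtr_sqr ler_wsqrtr.
  move=> /(ler_wpM2r (sqrtr_ge0 (mass u v))); lra.
have uvN : (u < v <= N)%N by rewrite uv (leq_trans vv).
have ht : s / 10 + s / 10 + s * (8 / 10) <= s by lra.
have [p [/andP[up pv] m1 m2 hle]] := maxexc_split uvN (lexx 0) As ht.
rewrite addr0 in hle; apply: (le_trans hle); rewrite [(dl + e) * _]mulrDl; apply: lerD.
  apply: hd => //; first by rewrite (leq_trans (ltnW pv)).
  by rewrite (le_trans m1)// ler_pdivrMr// mulrDr mulr1 lerDl.
have child u' v' : (u0 <= u')%N -> (v' <= v0)%N -> mass u' v' <= mass u v / 2 ->
    maxexc (s * (8 / 10)) u' v' ^+ 2 <= e ^+ 2 * mass u' v'.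
  move=> uu' vv' mm'; rewrite -[mass u' v'](sqr_sqrtr (mass_ge0 _ _)) -exprMn.
  apply: lerXn2r; rewrite ?nnegrE ?nrm_ge0 ?mulr_ge0 ?sqrtr_ge0//.
  apply: le_trans (hH u' v' uu' vv'); apply: maxexc_mono.
  rewrite -[leRHS]ger0_norm; last by rewrite mulr_ge0// divr_ge0.
  rewrite -sqrtr_sqr ler_wsqrtr// exprMn /s sqr_sqrtr; last by rewrite mulr_ge0.
  nra.
have c1 := child u p uu (leq_trans (ltnW pv) vv) m1.
have c2 := child p.+1 v (leq_trans uu (leqW up)) vv m2.
rewrite -[e]ger0_norm// -sqrtr_sqr -sqrtrM ?sqr_ge0// ler_wsqrtr//.
have e20 := sqr_ge0 e; nra.
Qed.

(** Each halving of the mass costs one [dl] while K grows geometrically, so about ln N halvings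
    reach the range of [maxexc_base]. *)
Lemma maxexc_iter K e dl D : 0 <= e -> 0 <= dl -> (10 * A) ^+ 2 <= K ->
  (forall K', K <= K' -> psum_excess_le K' dl) -> maxexc_le ((128 / 100) ^+ D * K) e -> maxexc_le K (D%:R * dl + e).
Proof.
move=> e0 dl0; elim: D K => [|D IH] K KA hd hH.
  by rewrite mul0r add0r; move: hH; rewrite expr0 mul1r.
have K0 : 0 <= K by apply: le_trans KA; exact: sqr_ge0.
rewrite (_ : D.+1%:R * dl + e = dl + (D%:R * dl + e)); last by rewrite -natr1; ring.
apply: maxexc_step => //; [by rewrite addr_ge0// mulr_ge0|exact: hd|].
apply: IH.
- by apply: (le_trans KA); lra.
- by move=> K' hK; apply: hd; lra.
- by rewrite mulrA -exprSr.
Qed.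

(** By Cauchy-Schwarz a partial sum is pointwise at most A sqrt (N mass), so nothing exceeds the
    threshold. *)
Lemma maxexc_base K : A ^+ 2 * N%:R <= K -> maxexc_le K 0.
Proof.
move=> KA u v _ _; rewrite mul0r.
rewrite /maxexc (_ : (fun _ => _) = fun=> 0).
  by rewrite /nrm (@eq_Ex _ _ _ _ _ (fun=> 0)) ?Ex_cst ?sqrtr0// => x; rewrite expr0n.
apply/funext => x; apply/max_idPr; rewrite subr_le0; apply/bigmax_leP; split; first exact: sqrtr_ge0.
move=> p _.
have pv : (p <= v)%N by rewrite -ltnS.
apply: (@le_trans _ _ (A * \sum_n `|trunc u p n|)).
  rewrite /psum /lin_comb (le_trans (ler_norm_sum _ _ _))// mulr_sumr.
  by apply: ler_sum => n _; rewrite normrM mulrC ler_wpM2r.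
have A0 : 0 <= A by apply: le_trans A1.
have := cauchy_schwarz_sum xpredT (fun n => `|trunc u p n|) (fun=> 1).
under eq_bigr do rewrite mulr1.
move=> /(ler_wpM2l A0) /le_trans; apply.
rewrite -[X in X * _](ger0_norm A0) -sqrtr_sqr -sqrtrM; last by apply: sumr_ge0 => n _; exact: sqr_ge0.
rewrite -sqrtrM ?sqr_ge0// ler_wsqrtr//.
rewrite [\sum_n 1 ^+ 2](eq_bigr (fun=> 1)); last by move=> n _; rewrite expr1n.
rewrite sumr_const card_ord.
under eq_bigr do rewrite real_normK ?num_real//.
have tm : \sum_n trunc u p n ^+ 2 <= mass u v.
  by apply: (le_trans (trunc_sqr _ _)); exact: mass_mono.
have t0 : 0 <= \sum_n trunc u p n ^+ 2 by apply: sumr_ge0 => n _; exact: sqr_ge0.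
apply: (@le_trans _ _ (A ^+ 2 * N%:R * mass u v)).
  apply: (@le_trans _ _ (A ^+ 2 * N%:R * \sum_n trunc u p n ^+ 2)).
    by rewrite le_eqVlt; apply/orP; left; apply/eqP; set S := \sum_n _; ring.
  by rewrite ler_wpM2l// mulr_ge0 ?sqr_ge0.
by rewrite ler_wpM2r// mass_ge0.
Qed.

End Window.

(** The Rademacher-Menshov argument with a fixed threshold: each halving down to mass m0 costs sqrt
    (mass) for the sum of the left half and A sqrt (mass) for the middle term. *)
Lemma maxexc_large t B m0 : 0 <= t -> 0 <= B ->
  (forall u v, (v <= N)%N -> mass u v <= m0 -> maxexc t u v <= B * Num.sqrt (mass u v)) ->
  forall j u v, (v <= N)%N -> mass u v <= 2 ^+ j * m0 ->
  maxexc t u v <= (B + j%:R * (1 + A)) * Num.sqrt (mass u v).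
Proof.
move=> t0 B0 base; have A0 : 0 <= A by apply: le_trans A1.
elim=> [|j IH] u v vN mj.
  by rewrite mul0r addr0; apply: base => //; rewrite -[m0]mul1r -(expr0 2).
have [vu|uv] := leqP v u.
  by rewrite maxexc_nil// mulr_ge0 ?sqrtr_ge0 ?addr_ge0 ?mulr_ge0 ?addr_ge0.
have uvN : (u < v <= N)%N by rewrite uv.
have A0' : 0 <= A * Num.sqrt (mass u v) by rewrite mulr_ge0 ?sqrtr_ge0.
have hA : A * Num.sqrt (mass u v) <= 0 + A * Num.sqrt (mass u v) by rewrite add0r.
have ht : 0 + 0 + t <= t by lra.
have [p [/andP[up pv] m1 m2 hle]] := maxexc_split uvN A0' hA ht.
apply: (le_trans hle).
pose e := B + j%:R * (1 + A).
have e0 : 0 <= e by rewrite addr_ge0// mulr_ge0 ?addr_ge0.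
have child u' v' : (v' <= N)%N -> mass u' v' <= mass u v / 2 ->
    maxexc t u' v' ^+ 2 <= e ^+ 2 * mass u' v'.
  move=> vv' mm'; rewrite -[X in _ * X](sqr_sqrtr (mass_ge0 _ _)) -exprMn.
  apply: lerXn2r; rewrite ?nnegrE ?nrm_ge0 ?mulr_ge0 ?sqrtr_ge0//.
  apply: IH => //; apply: (le_trans mm'); move: mj; rewrite exprS; lra.
have c1 := child u p (leq_trans (ltnW pv) vN) m1.
have c2 := child p.+1 v vN m2.
have sq : Num.sqrt (maxexc t u p ^+ 2 + maxexc t p.+1 v ^+ 2) <= e * Num.sqrt (mass u v).
  rewrite -[e]ger0_norm// -sqrtr_sqr -sqrtrM ?sqr_ge0// ler_wsqrtr//.
  have e20 := sqr_ge0 e; nra.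
have b1 := bmeas_psum u p.
have n1 : nrm P (fun x => Num.max (`|psum u p x| - 0) 0) <= Num.sqrt (mass u v).
  apply: (@le_trans _ _ (Num.sqrt (mass u p))); last first.
    by rewrite ler_wsqrtr// mass_mono// ltnW.
  apply: le_trans (nrm_psum u p); apply: nrm_mono; [bm..|] => x.
  by rewrite subr0 (max_idPl _)// normr_id.
rewrite -natr1; move: n1 sq; rewrite /e; lra.
Qed.

End Maximal.

(** * A single window *)

Lemma truncn_succ (R : archiRealFieldType) (x : R) : 0 <= x ->
  x <= (Num.truncn x).+1%:R /\ (Num.truncn x).+1%:R <= x + 1.
Proof.
by move=> /truncn_itv/andP[h1 h2]; split; [exact: ltW | rewrite -natr1 lerD2r].
Qed.

Lemma expR2_le16 (R : realType) : expR 2 <= 16 :> R.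
Proof.
have h : 1 - 2^-1 <= expR (- 2^-1) :> R by rewrite (le_trans _ (expR_ge1Dx _)).
have e : expR 2^-1 <= 2 :> R.
  have e0 : 0 < expR 2^-1 :> R by exact: expR_gt0.
  have := ler_wpM2l (ltW e0) h; rewrite -expRD subrr expR0; lra.
have -> : expR 2 = expR 2^-1 ^+ 4 :> R by rewrite -expRM_natl; congr expR; lra.
apply: (@le_trans _ _ (2 ^+ 4)); last by lra.
by apply: lerXn2r; rewrite ?nnegrE ?expR_ge0.
Qed.

(** Once H >= s^4, both errors of [maurey] are O(s^-4); the exponential only has to compensate the
    factor kap. *)
Lemma maurey_error (R : realType) (c1 c2 b kap H s : R) : 0 <= c1 -> 0 <= c2 -> 0 < b ->
  1 <= s -> s ^+ 4 <= H -> 0 <= kap -> kap * expR (- (s ^+ 4 / b)) <= 1 ->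
  c1 / H + c2 * kap / H ^+ 2 * expR (- (H / b)) <= (c1 + c2) * s ^- 4.
Proof.
move=> c10 c20 b0 s1 sH k0 hk.
have s40 : 0 < s ^+ 4 by rewrite exprn_gt0// (lt_le_trans ltr01).
have s41 : 1 <= s ^+ 4 by exact: exprn_ege1.
have H0 : 0 < H by exact: lt_le_trans sH.
have Hi : H^-1 <= s ^- 4 by rewrite lef_pV2.
have Hi0 : 0 < H^-1 by rewrite invr_gt0.
have Hi1 : H^-1 <= 1 by rewrite invf_le1// (le_trans s41).
have ex : expR (- (H / b)) <= expR (- (s ^+ 4 / b)).
  by rewrite ler_expR lerN2 ler_pM2r// invr_gt0.
have c3 : kap * expR (- (H / b)) <= 1.
  by apply: le_trans hk; apply: ler_wpM2l.
have c4 : kap / H ^+ 2 * expR (- (H / b)) <= s ^- 4.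
  rewrite (_ : _ * expR _ = kap * expR (- (H / b)) * (H^-1 * H^-1)); last first.
    by field; rewrite gt_eqF.
  rewrite -[leRHS]mul1r; apply: ler_pM; [|by rewrite mulr_ge0 ?ltW|exact: c3|].
    by rewrite mulr_ge0 ?expR_ge0.
  by apply: le_trans Hi; rewrite ler_piMr// ltW.
rewrite mulrDl; apply: lerD; first by rewrite ler_wpM2l.
rewrite (_ : _ * expR _ = c2 * (kap / H ^+ 2 * expR (- (H / b)))); last by ring.
by rewrite ler_wpM2l.
Qed.

Lemma maurey_const (R : realType) (A s : R) : 1 <= A -> 0 < s ->
  (256 * expR 2 * A ^+ 2 + 2 ^+ 18 * A ^+ 4) * s ^- 4 <= (2 ^+ 10 * A ^+ 2 / s ^+ 2) ^+ 2.
Proof.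
move=> A1 s0.
have A2 : 1 <= A ^+ 2 by exact: exprn_ege1.
have A4E : A ^+ 4 = A ^+ 2 * A ^+ 2 by rewrite -exprD.
have -> : (2 ^+ 10 * A ^+ 2 / s ^+ 2) ^+ 2 = (2 ^+ 20 * A ^+ 4) * s ^- 4.
  rewrite (_ : 2 ^+ 20 = (2 ^+ 10) ^+ 2 :> R); last by rewrite -exprM.
  by set c := 2 ^+ 10; field; rewrite gt_eqF.
apply: ler_wpM2r; first by rewrite invr_ge0 exprn_ge0// ltW.
have e2 := expR2_le16 R; have e0 := expR_ge0 (2 : R).
rewrite A4E; move: A2; set v := A ^+ 2 => v1.
set e := expR 2 in e2 e0 *.
have -> : 2 ^+ 20 = 4 * 2 ^+ 18 :> R by rewrite (_ : 20 = 18 + 2)%N// exprD mulrC; congr (_ * _); rewrite expr2 -natrM.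
have -> : 256 = 2 ^+ 8 :> R by rewrite -natrX.
have e16 : 16 = 2 ^+ 4 :> R by rewrite -natrX.
have h : e <= 2 ^+ 10 by apply: (le_trans e2); rewrite e16 ler_weXn2l// ler1n.
have h2 : 2 ^+ 8 * e * v <= 2 ^+ 18 * (v * v).
  have -> : 2 ^+ 8 * e * v = 2 ^+ 8 * (e * v) by rewrite -mulrA.
  have -> : 2 ^+ 18 * (v * v) = 2 ^+ 8 * (2 ^+ 10 * (v * v)) by rewrite [RHS]mulrA -exprD.
  apply: ler_wpM2l; first exact: exprn_ge0.
  have v0 : 0 <= v by exact: le_trans ler01 v1.
  by apply: ler_pM; rewrite ?ler_peMr.
move: h2; set w := v * v; set k := 2 ^+ 18; set z := _ * v.
have : 0 <= k * w by apply: mulr_ge0; [exact: exprn_ge0 | apply: mulr_ge0; exact: le_trans ler01 v1].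
lra.
Qed.

Section Window.
Context {R : realType} {d : measure_display} {T : measurableType d}.
Variable P : probability T R.
Variables (N : nat) (psi : 'I_N -> T -> R) (A C2 : R).
Hypothesis psi_bm : forall n, bmeas (psi n).
Hypothesis psi_on : forall i j, Ex P (fun x => psi i x * psi j x) = (i == j)%:R.
Hypothesis psi_A : forall n x, `|psi n x| <= A.
Hypothesis N3 : (3 <= N)%N.
Hypothesis AN : A <= N%:R.
Hypothesis A1 : 1 <= A.
Hypothesis C21 : 1 <= C2.
Hypothesis psi_good : good P psi C2 1%g.

Let Nr : 0 < N%:R :> R. Proof. by rewrite ltr0n (ltnW (ltnW N3)). Qed.

(** The window has length at most N^(1 - theta), [Kc] is the square of the chaining threshold, and
    errors are O(s^-2). Among the relations below, [ha] is the one that dictates the choice of s. *)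
Variables (u M : nat) (theta Kc s : R).
Hypothesis M0 : (0 < M)%N.
Hypothesis theta0 : 0 < theta.
Hypothesis theta1 : theta <= 1.
Hypothesis thetaE : theta * ln N%:R <= ln (N%:R / M%:R).
Hypothesis s1 : 1 <= s.
Hypothesis sA : 4 * A ^+ 2 <= s ^+ 4.
Hypothesis sC : Num.sqrt (8 * C2) + 1 <= s.
Hypothesis ha : s ^+ 8 <= theta * Kc.
Hypothesis hb : Kc * expR (- (s ^+ 4 / (2048 * A ^+ 2))) <= 1.
Hypothesis hc : Kc * (expR 1 * Num.sqrt (M%:R / N%:R)) <= s ^- 2.
Hypothesis hd : 2 * Num.sqrt Kc / N%:R <= s ^- 2.

Let s0 : 0 < s. Proof. exact: lt_le_trans s1. Qed.
Let A0 : 0 < A. Proof. exact: lt_le_trans A1. Qed.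
Let C20 : 0 < C2. Proof. exact: lt_le_trans C21. Qed.
Let kap := Kc / s ^+ 2.
Let L0 : 0 < ln N%:R :> R.
Proof. by rewrite ln_gt0// ltr1n (ltnW N3). Qed.

Definition flat_const : R := 2 ^+ 12 * A ^+ 2 + 16 * C2 + 3.

(** Since theta ln N <= ln (N / M), this value of m satisfies the condition of [good] for q
    terms. *)
Definition hit_budget (q : nat) : nat := (Num.truncn (2 * C2 * q%:R / theta)).+1.

Lemma hits_count (q : nat) : (0 < q)%N -> let m := hit_budget q in
  [/\ (0 < m)%N, (q <= m)%N, 2 * C2 * q%:R * ln N%:R <= m%:R * ln (N%:R / M%:R),
      m%:R <= 4 * C2 * q%:R / theta & q%:R / theta <= m%:R].
Proof.
move=> q0; rewrite /hit_budget /=; have q1 : 1 <= q%:R :> R by rewrite ler1n.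
set z := 2 * C2 * q%:R / theta.
have qth : q%:R / theta <= z.
  rewrite /z ler_pM2r ?invr_gt0//.
  by have : q%:R <= C2 * q%:R by [rewrite ler_peMl]; move: q1; lra.
have zq : q%:R <= z.
  by apply: le_trans qth; rewrite ler_pdivlMr// ler_piMr.
have z0 : 0 <= z by apply: le_trans zq.
have [m1 m2] := truncn_succ z0.
split => //.
- by rewrite -(ler_nat R) (le_trans zq).
- apply: (@le_trans _ _ (z * (theta * ln N%:R))).
    rewrite le_eqVlt; apply/orP; left; apply/eqP; rewrite /z; field.
    by rewrite gt_eqF.
  by apply: ler_pM => //; rewrite mulr_ge0 ?ltW.
- apply: (le_trans m2); rewrite (_ : 4 * C2 * q%:R / theta = z + z); last by rewrite /z; ring.
  by rewrite lerD2l; apply: le_trans zq.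
- exact: le_trans m1.
Qed.

Lemma flat_uniform (U : {set 'I_N}) (b : 'I_N -> R) (t : R) :
  (0 < #|U|)%N -> (forall n, n \notin U -> b n = 0) -> (forall n, `|b n| <= t) -> 0 < t ->
  (forall n : 'I_N, n \in U -> (u <= n < u + M)%N) ->
  let W := #|U|%:R * t ^+ 2 in
  Ex P (fun x => lin_comb psi b x * thr (Num.sqrt (kap * W) / 2) (lin_comb psi b x)) <=
   W * (flat_const / s ^+ 2).
Proof.
move=> U0 bU bt t0 UI; pose nu : R := #|U|%:R; pose W := nu * t ^+ 2.
cbv zeta; rewrite -/nu -/W.
have nu0 : 0 < nu by rewrite ltr0n.
have nuN : nu <= N%:R by rewrite ler_nat (leq_trans (max_card _))// card_ord.
have s2 : 0 < s ^+ 2 by rewrite exprn_gt0.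
have s21 : 1 <= s ^+ 2 by rewrite -(expr1n _ 2) lerXn2r ?nnegrE ?ler01// ltW.
have cD0 : 0 <= flat_const by rewrite /flat_const; have := sqr_ge0 A; have := C20; lra.
have W0 : 0 < W by rewrite mulr_gt0// exprn_gt0.
have KcE : Kc = kap * s ^+ 2 by rewrite /kap divfK ?gt_eqF.
have Kc0 : s ^+ 8 <= Kc.
  have s80 : 0 <= s ^+ 8 by rewrite exprn_ge0 ?ltW.
  have Kcp : 0 <= Kc by have := le_trans s80 ha; rewrite pmulr_rge0.
  by apply: (le_trans ha); rewrite ler_piMl.
have kaps : s ^+ 6 <= kap by rewrite -(ler_pM2r s2) -exprD -KcE.
have s41 : 1 <= s ^+ 4 by rewrite -(expr1n _ 4) lerXn2r ?nnegrE ?ler01// ltW.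
have s46 : s ^+ 4 <= kap.
  apply: le_trans kaps; rewrite (_ : s ^+ 6 = s ^+ 4 * s ^+ 2); last by rewrite -exprD.
  by rewrite ler_peMr// (le_trans _ s41).
have kap1 : 1 <= kap by apply: le_trans s46.
have kap0 : 0 < kap by apply: lt_le_trans kap1.
(* With few coefficients, f is pointwise at most nu t A <= sqrt (kap W) / 2 and its thresholding
   vanishes. *)
have [nusmall|nubig] := leP nu (kap / (4 * A ^+ 2)).
  have z x : thr (Num.sqrt (kap * W) / 2) (lin_comb psi b x) = 0.
    apply: thr_eq0; apply: (le_trans (f_le psi_A bU bt x)).
    rewrite -/nu ler_pdivlMr// -[leLHS]ger0_norm; last by rewrite !mulr_ge0 ?ltW.
    rewrite -sqrtr_sqr ler_wsqrtr// /W.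
    move: nusmall; rewrite ler_pdivlMr ?mulr_gt0 ?exprn_gt0// => h.
    rewrite (_ : (nu * (t * A) * 2) ^+ 2 = nu * (4 * A ^+ 2) * (nu * t ^+ 2)); last by ring.
    by rewrite ler_pM2r.
  under eq_Ex do rewrite z mulr0.
  by rewrite Ex_cst mulr_ge0 ?divr_ge0 ?(ltW W0) ?(ltW s2).
(* The sample size q lies just above z, which gives H >= s^4 and a Maurey error e1 of order s^-2. *)
set z := nu * s ^+ 4 / kap.
have z1 : 1 <= z.
  rewrite /z ler_pdivlMr// mul1r; move: nubig; rewrite ltr_pdivrMr ?mulr_gt0 ?exprn_gt0// => h.
  by apply: (le_trans (ltW h)); rewrite ler_pM2l.
have z0 : 0 <= z by apply: le_trans z1.
have [qz qz1] := truncn_succ z0.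
set q := (Num.truncn z).+1 in qz qz1.
have q2z : q%:R <= 2 * z by lra.
have zN : z <= N%:R.
  apply: le_trans nuN; rewrite /z ler_pdivrMr// ler_pM2l//.
have hq : (0 < q <= N ^ 3)%N.
  rewrite /= -(ler_nat R) natrX (le_trans q2z)//.
  apply: (@le_trans _ _ (N%:R * N%:R)); last first.
    rewrite exprS expr2 ler_peMl ?mulr_ge0// ler1n (ltnW (ltnW N3))//.
  by apply: ler_pM => //; rewrite ler_nat ltnW.
have [m0 _ mc mle mge] := hits_count (ltn0Sn (Num.truncn z)).
rewrite -/q in mc mle mge m0; set m := hit_budget q in mc mle mge m0.
have mr0 : 0 < m%:R :> R by rewrite ltr0n.
pose H := kap * q%:R / nu.
have Hs : s ^+ 4 <= H.
  by rewrite /H ler_pdivlMr//; move: qz; rewrite /z ler_pdivrMr//; lra.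
have H0 : 0 < H by apply: lt_le_trans Hs; apply: lt_le_trans s41.
pose e1 := 2 ^+ 10 * A ^+ 2 / s ^+ 2.
have e10 : 0 <= e1 by rewrite !mulr_ge0 ?exprn_ge0 ?invr_ge0 ?ltW.
pose g := (Num.sqrt (8 * C2) + 1) / s.
have g1 : g <= 1 by rewrite /g ler_pdivrMr// mul1r.
have he : 256 * expR 2 * A ^+ 2 / H +
    2 ^+ 18 * A ^+ 4 * kap / H ^+ 2 * expR (- (H / (2048 * A ^+ 2))) <= e1 ^+ 2.
  apply: le_trans (maurey_const A1 s0).
  apply: maurey_error; [| | |exact: s1|exact: Hs|exact: ltW|].
  - by apply: mulr_ge0; [apply: mulr_ge0; [exact: ler0n|exact: expR_ge0]|exact: sqr_ge0].
  - by apply: mulr_ge0; [exact: exprn_ge0|apply: exprn_ge0; exact: ltW].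
  - by apply: mulr_gt0; [exact: ltr0n|exact: exprn_gt0].
  apply: le_trans hb; apply: ler_wpM2r; first exact: expR_ge0.
  by rewrite KcE ler_peMr// ltW.
have hg : Num.sqrt (m%:R / nu) + Num.sqrt (nu * (expR 1 * Num.sqrt (M%:R / N%:R)) / m%:R) <= g.
  (* Here s^8 <= theta Kc enters: m / nu is of order s^6 / (theta Kc). *)
  have c1 : m%:R / nu <= 8 * C2 / s ^+ 2.
    rewrite ler_pdivrMr//; apply: (le_trans mle).
    apply: (@le_trans _ _ (4 * C2 * (2 * z) / theta)).
      by rewrite ler_pM2r ?invr_gt0// ler_pM2l ?mulr_gt0.
    rewrite ler_pdivrMr// /z.
    rewrite (_ : 4 * C2 * (2 * (nu * s ^+ 4 / kap)) = 8 * C2 * nu * (s ^+ 4 / kap)); last by ring.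
    rewrite (_ : 8 * C2 / s ^+ 2 * nu * theta = 8 * C2 * nu * (theta / s ^+ 2)); last by ring.
    rewrite ler_pM2l ?mulr_gt0// ler_pdivrMr// mulrAC ler_pdivlMr// -exprD.
    apply: (@le_trans _ _ (theta * Kc / s ^+ 2)); last by rewrite /kap mulrA.
    by rewrite ler_pdivlMr// -exprD.
  have c2 : nu * (expR 1 * Num.sqrt (M%:R / N%:R)) / m%:R <= s ^- 2.
    have hc' := hc; set E0 := expR 1 * _ in hc' *.
    have E00 : 0 <= E0 by rewrite mulr_ge0 ?expR_ge0 ?sqrtr_ge0.
    have nm : nu <= m%:R * kap.
      have zm : z <= m%:R.
        apply: (le_trans qz); apply: le_trans mge; rewrite ler_pdivlMr// ler_piMr//.
      move: zm; rewrite /z ler_pdivrMr// => zm; apply: le_trans zm.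
      by rewrite ler_peMr// ltW.
    rewrite ler_pdivrMr//; apply: (le_trans (ler_wpM2r E00 nm)).
    rewrite mulrC [_ * m%:R]mulrC mulrCA ler_pM2l//.
    apply: le_trans hc'; rewrite mulrC ler_wpM2r// KcE ler_peMr// ltW//.
  have h1 : Num.sqrt (m%:R / nu) <= Num.sqrt (8 * C2) / s.
    apply: (le_trans (ler_wsqrtr c1)); rewrite sqrtrM; last by rewrite mulr_ge0 ?ltW.
    by rewrite sqrtrV ?sqr_ge0// sqrtr_sqr gtr0_norm.
  have h2 : Num.sqrt (nu * (expR 1 * Num.sqrt (M%:R / N%:R)) / m%:R) <= s^-1.
    by apply: (le_trans (ler_wsqrtr c2)); rewrite sqrtrV ?sqr_ge0// sqrtr_sqr gtr0_norm.
  by rewrite /g mulrDl mul1r lerD.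
have := flat_bound psi_bm psi_on psi_A N3 AN A1 psi_good U0 bU bt t0 UI M0 hq m0 mc kap1 e10 he hg g1.
rewrite -/nu -/W => /le_trans; apply; rewrite ler_pM2l//.
have g2 : g ^+ 2 <= (16 * C2 + 2) / s ^+ 2.
  rewrite /g expr_div_n ler_pM2r ?invr_gt0//.
  have := sqr_sqrtr (ltW (mulr_gt0 (ltr0n R 8) C20)); set y := Num.sqrt _ => yE.
  have := sqr_ge0 (y - 1); lra.
have k2 : 2 * Num.sqrt kap / N%:R <= s ^- 2.
  apply: le_trans hd; rewrite ler_pM2r ?invr_gt0// ler_pM2l// ler_wsqrtr//.
  by rewrite KcE ler_peMr// (ltW kap0).
have e4 : 4 * e1 = 2 ^+ 12 * A ^+ 2 / s ^+ 2 by rewrite /e1; ring.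
rewrite e4 /flat_const 2!mulrDl; move: g2 k2; rewrite mulrDl; lra.
Qed.

Variables (J r : nat).
Hypothesis JN : (N <= 2 ^ J)%N.
Hypothesis J4 : (4 ^ J <= N ^ 3)%N.
Hypothesis he : J%:R * (2 * (Num.sqrt (4 * C2 / theta) * (2 * 2^-1 ^+ r) +
    2 ^+ r.+1 * Num.sqrt (expR 1 * Num.sqrt (M%:R / N%:R))) + Num.sqrt Kc / N%:R) <= r%:R / s ^+ 2.

Definition window_const : R := 18 + 32 * flat_const.

Lemma window_chain (b : 'I_N -> R) : \sum_n b n ^+ 2 <= 1 ->
  (forall n : 'I_N, ~~ (u <= n < u + M)%N -> b n = 0) ->
  Ex P (fun x => Num.max (`|lin_comb psi b x| - 2 * Num.sqrt Kc) 0 ^+ 2) <= window_const * (r%:R / s ^+ 2).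
Proof.
move=> b2 bI.
have s2 : 0 < s ^+ 2 by rewrite exprn_gt0.
have s80 : 0 < s ^+ 8 by rewrite exprn_gt0.
have Kcp : 0 < Kc by have := lt_le_trans s80 ha; rewrite pmulr_rgt0.
have sK : s ^+ 8 <= Kc by apply: (le_trans ha); rewrite ler_piMl// ltW.
have s41 : 1 <= s ^+ 4 by exact: exprn_ege1.
have A2 : 1 <= A ^+ 2 by exact: exprn_ege1.
have tauA : A <= Num.sqrt Kc.
  rewrite -[leLHS](ger0_norm (ltW A0)) -sqrtr_sqr ler_wsqrtr//; apply: le_trans sK.
  rewrite (_ : s ^+ 8 = s ^+ 4 * s ^+ 4); last by rewrite -exprD.
  apply: (@le_trans _ _ (s ^+ 4)); last by rewrite ler_peMr// (le_trans ler01).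
  by apply: le_trans sA; rewrite ler_peMl ?sqr_ge0// ler1n.
have tauN : Num.sqrt Kc <= N%:R.
  have si : s ^- 2 <= 1 by rewrite invf_le1// exprn_ege1.
  have := le_trans hd si; rewrite ler_pdivrMr// mul1r; have := sqrtr_ge0 Kc; lra.
have t2 : Num.sqrt Kc ^+ 2 = Kc by rewrite sqr_sqrtr// ltW.
have cD0 : 0 <= flat_const by rewrite /flat_const; have := sqr_ge0 A; have := C20; lra.
have cb (p : nat) : (0 < 4 ^ p)%N by rewrite expn_gt0.
have mc p : (p <= J)%N -> 2 * C2 * (4 ^ p)%N%:R * ln N%:R <= (hit_budget (4 ^ p))%:R * ln (N%:R / M%:R).
  by move=> _; have [] := hits_count (cb p).
have mg p : (4 ^ p <= hit_budget (4 ^ p))%N by have [] := hits_count (cb p).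
have ml p : (hit_budget (4 ^ p))%:R <= 4 * C2 / theta * 4 ^+ p.
  have [_ _ _ h _] := hits_count (cb p); apply: (le_trans h).
  by rewrite natrX mulrAC.
have kap0 : 0 <= kap by rewrite divr_ge0 ?ltW.
have D0 : 0 <= flat_const / s ^+ 2 by rewrite divr_ge0 ?(ltW s2).
have := chain_bound psi_bm psi_on psi_A N3 AN A1 psi_good b2 r tauA tauN bI M0 JN J4 (erefl _)
  mc mg ml kap0 D0 flat_uniform.
move=> /le_trans; apply; rewrite t2.
have kK : kap / Kc = s ^- 2 by rewrite /kap; field; rewrite !gt_eqF.
have -> : 4 * r%:R * (2 * kap / Kc + 4 * (flat_const / s ^+ 2)) = (8 + 16 * flat_const) * (r%:R / s ^+ 2).
  rewrite -[2 * kap / Kc]mulrA kK; ring.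
rewrite /window_const; move: he; set v := r%:R / s ^+ 2; set w := J%:R * _ => hw.
by rewrite mulrDr; lra.
Qed.

(** By homogeneity: [window_chain] applies to the truncated coefficients divided by sqrt w. *)
Lemma window_psum_excess (a mu : 'I_N -> R) : (forall n, 0 < mu n) -> (forall n, a n ^+ 2 <= mu n) ->
  psum_excess_le P psi a mu u (u + M) (400 * Kc) (Num.sqrt (window_const * (r%:R / s ^+ 2))).
Proof.
move=> mu0 mua u' p w uu pp mw.
have w0 : 0 <= w by apply: le_trans mw; exact: mass_ge0.
have tw : \sum_n trunc a u' p n ^+ 2 <= w by apply: le_trans mw; exact: trunc_sqr.
have bP : bmeas (psum psi a u' p) by exact: bmeas_lin.
have [wz|wn] := eqVneq w 0.
  rewrite wz sqrtr0 !mulr0 sqrtr0 mul0r.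
  have z x : psum psi a u' p x = 0.
    rewrite /psum /lin_comb big1// => n _.
    suff -> : trunc a u' p n = 0 by rewrite mul0r.
    apply/eqP; rewrite -sqrf_eq0 eq_le sqr_ge0 andbT -wz; apply: le_trans tw.
    by rewrite (bigD1 n)//= lerDl sumr_ge0// => i _; exact: sqr_ge0.
  rewrite /nrm (@eq_Ex _ _ _ _ _ (fun=> 0)) ?Ex_cst ?sqrtr0// => x.
  by rewrite z normr0 subr0 (max_idPl _)// expr0n.
have wp : 0 < w by rewrite lt_neqAle eq_sym wn.
have sw : 0 < Num.sqrt w by rewrite sqrtr_gt0.
pose b n := (Num.sqrt w)^-1 * trunc a u' p n.
have b2 : \sum_n b n ^+ 2 <= 1.
  under eq_bigr do rewrite /b exprMn.
  by rewrite -mulr_sumr exprVn (sqr_sqrtr w0) ler_pdivrMl// mulr1.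
have bI (n : 'I_N) : ~~ (u <= n < u + M)%N -> b n = 0.
  rewrite /b /trunc => nI; case: ifP => h; last by rewrite mulr0.
  exfalso; move/negP: nI; apply; case/andP: h => h1 h2.
  by rewrite (leq_trans uu h1) (leq_trans h2 pp).
have wc := window_chain b2 bI.
have K0 : 0 <= Kc.
  have s80 : 0 <= s ^+ 8 by rewrite exprn_ge0// ltW.
  by have := le_trans s80 ha; rewrite pmulr_rge0.
(* A tenth of sqrt (400 Kc w) is the threshold 2 tau = 2 sqrt Kc of the chain, rescaled by sqrt
   w. *)
have s400 : Num.sqrt (400 * Kc * w) / 10 = 2 * Num.sqrt Kc * Num.sqrt w.
  have -> : 400 * Kc * w = (20 * (Num.sqrt Kc * Num.sqrt w)) ^+ 2.
    rewrite [RHS]exprMn [(_ * _) ^+ 2 in RHS]exprMn (sqr_sqrtr K0) (sqr_sqrtr w0) mulrA.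
    by congr (_ * _ * _); rewrite expr2 -natrM.
  rewrite sqrtr_sqr ger0_norm; first by field.
  by apply: mulr_ge0; [exact: ler0n | apply: mulr_ge0; exact: sqrtr_ge0].
rewrite (_ : (fun x => _) = fun x => Num.sqrt w * Num.max (`|lin_comb psi b x| - 2 * Num.sqrt Kc) 0); last first.
  apply/funext => x; rewrite lin_combZ -/(psum _ _ _ _ _) normrM normfV (gtr0_norm sw) s400.
  rewrite maxr_pMr ?ltW// mulr0 mulrBr mulrA divff ?gt_eqF// mul1r.
  by congr (Num.max (_ - _) _); ring.
have bL : bmeas (lin_comb psi b) by exact: bmeas_lin.
rewrite nrmZ; last by bm.
rewrite (gtr0_norm sw) mulrC ler_pM2r//.
by rewrite ler_wsqrtr.
Qed.

End Window.

(** * Interval partitions *)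

Lemma interval_ordP (N : nat) (I : {set 'I_N}) : is_interval_ord I -> I != finset.set0 ->
  exists u v, (u < v <= N)%N /\ forall n : 'I_N, (n \in I) = (u <= n < v)%N.
Proof.
move=> /forall_inP hI /set0Pn[i0 i0I].
have [i iI imin] := arg_minnP (fun i : 'I_N => i : nat) i0I.
have [j jI jmax] := arg_maxnP (fun i : 'I_N => i : nat) i0I.
exists i, j.+1; split; first by rewrite ltnS imin //=.
move=> n; apply/idP/idP => [nI|/andP[h1 h2]].
  by rewrite imin //= ltnS; exact: jmax.
have /forall_inP/(_ j jI)/forallP/(_ n)/implyP := hI i iI; apply.
by rewrite h1 -ltnS.
Qed.

Lemma dyadic_level (R : realType) (m : R) (N Kx : nat) : (0 < N)%N -> N%:R^-1 <= m -> m <= 2 ->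
  (N < 2 ^ Kx)%N -> exists k : nat, [/\ (k < Kx.+1)%N, 2^-1 ^+ k < m & m <= 2 * 2^-1 ^+ k].
Proof.
move=> N0 mN m2 NK.
have Nr : 0 < N%:R :> R by rewrite ltr0n.
have ex : exists k, 2^-1 ^+ k < m.
  exists Kx; apply: lt_le_trans mN; rewrite exprVn ltf_pV2 ?posrE ?exprn_gt0//.
  by rewrite -natrX ltr_nat.
have := ex_minnP ex; case=> k km kmin.
exists k; split => //.
  rewrite ltnS; apply: kmin; apply: lt_le_trans mN.
  by rewrite exprVn ltf_pV2 ?posrE ?exprn_gt0// -natrX ltr_nat.
case: k km kmin => [|k] km kmin; first by rewrite expr0 mulr1.
rewrite leNgt; apply/negP => h.
suff : (k < k)%N by rewrite ltnn.
apply: kmin.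
by apply: le_lt_trans h; rewrite exprS mulrA mulfV// mul1r.
Qed.

(** * Charging the blocks of a partition to dyadic windows *)

Section Assembly.
Context {R : realType} {d : measure_display} {T : measurableType d}.
Variable P : probability T R.
Variables (N : nat) (psi : 'I_N -> T -> R).
Hypothesis psi_bm : forall n, bmeas (psi n).
Hypothesis N0 : (0 < N)%N.
Variables (a mu : 'I_N -> R).
Hypothesis muN : forall n, N%:R^-1 <= mu n.
Hypothesis mu2 : \sum_n mu n <= 2.
Variables (Kx : nat) (t : nat -> R) (K : R).
Hypothesis NKx : (N < 2 ^ Kx)%N.
Hypothesis K0 : 0 <= K.
Hypothesis t0 : forall k, 0 <= t k.
Hypothesis tK : forall k, t k ^+ 2 <= 3 * K * 2^-1 ^+ k.

Let h (k : nat) : R := 2^-1 ^+ k.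
Let h0 k : 0 < h k. Proof. by rewrite exprn_gt0// invr_gt0. Qed.
Let Nr : 0 < N%:R :> R. Proof. by rewrite ltr0n. Qed.
Let mu0 n : 0 < mu n. Proof. by apply: lt_le_trans (muN n); rewrite invr_gt0. Qed.

Lemma mass0_le2 u : mass mu 0 u <= 2.
Proof.
apply: le_trans mu2; rewrite /mass big_mkcond; apply: ler_sum => n _.
by case: ifP => // _; rewrite ltW.
Qed.

(** The window runs from the first index with mass at least s h k before it to the last with at most
    (s + 3) h k before it. A block of mass at most 2 h k that starts between s h k and (s + 1) h k
    lies inside. *)
Lemma window_exists (k s : nat) : exists UV : nat * nat,
  [/\ (UV.2 <= N)%N, mass mu UV.1 UV.2 <= 3 * h k &
   forall u v, (u <= v)%N -> (v <= N)%N -> s%:R * h k <= mass mu 0 u -> mass mu 0 v <= (s%:R + 3) * h k ->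
     (UV.1 <= u)%N /\ (v <= UV.2)%N].
Proof.
have [exu|nexu] := pselect (exists u, s%:R * h k <= mass mu 0 u); last first.
  (* If no index has mass s h k before it, no block uses this window, and it is taken empty. *)
  exists (0, 0)%N; split => //=; first by rewrite mass_nil mulr_ge0// ltW.
  by move=> u v _ _ hu; exfalso; apply: nexu; exists u.
have [U hU Umin] := ex_minnP exu.
pose Q v := (v <= N)%N && (mass mu 0 v <= (s%:R + 3) * h k).
have exv : exists v, Q v.
  by exists 0%N; rewrite /Q /= mass_nil mulr_ge0 ?addr_ge0 ?ler0n// ltW.
have bv v : Q v -> (v <= N)%N by case/andP.
have [V /andP[VN hV] Vmax] := ex_maxnP exv bv.
exists (U, V); split => //=.
  have [UV|VU] := leqP U V.
    have E := @mass_cat _ _ mu 0 U V (leq0n U) UV.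
    by move: hV hU; rewrite mulrDl; lra.
  apply: (@le_trans _ _ (mass mu V V)); last by rewrite mass_nil mulr_ge0// ltW.
  by apply: mass_mono => //; exact: ltnW.
by move=> u v _ vN hu hv; split; [exact: Umin | apply: Vmax; rewrite /Q vN].
Qed.

Definition block_window (k s : nat) : nat * nat := projT1 (cid (window_exists k s)).

Lemma block_windowP k s : [/\ ((block_window k s).2 <= N)%N, mass mu (block_window k s).1 (block_window k s).2 <= 3 * h k &
   forall u v, (u <= v)%N -> (v <= N)%N -> s%:R * h k <= mass mu 0 u -> mass mu 0 v <= (s%:R + 3) * h k ->
     ((block_window k s).1 <= u)%N /\ (v <= (block_window k s).2)%N].
Proof. by rewrite /block_window; case: cid. Qed.

Definition window_excess (k s : nat) (x : T) : R :=
  Num.max (maxpsum psi a (block_window k s).1 (block_window k s).2 x - t k) 0.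

(** A block of mass m contributes 24 K m to the bulk, and the total mass is at most 2. For the same
    reason 2^(k+1) + 1 starting positions s suffice at scale k. *)
Definition Zbound (x : T) : R :=
  48 * K + 8 * \sum_(k < Kx.+1) \sum_(s < (2 ^ k.+1).+1) window_excess k s x ^+ 2.

(* J has mass between 2^-k and 2 * 2^-k and starts at mass about s * 2^-k: blocks
   with the same key overlap, and J lies in the window [block_window k s]. *)
Definition block_key (J : {set 'I_N}) (k s : nat) : Prop :=
  [/\ (k < Kx.+1)%N, (s < (2 ^ k.+1).+1)%N &
   exists u v, [/\ (u < v <= N)%N, forall n : 'I_N, (n \in J) = (u <= n < v)%N,
     h k < mass mu u v, mass mu u v <= 2 * h k & s%:R * h k <= mass mu 0 u < (s%:R + 1) * h k]].

Lemma block_key_exists (J : {set 'I_N}) : is_interval_ord J -> J != finset.set0 ->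
  exists ks : nat * nat, block_key J ks.1 ks.2.
Proof.
move=> iJ nJ; have [u [v [uv JE]]] := interval_ordP iJ nJ.
have /andP[uv' vN] := uv.
have uN : (u < N)%N by exact: leq_trans uv' vN.
have m1 : N%:R^-1 <= mass mu u v.
  apply: (le_trans (muN (Ordinal uN))); rewrite -(mass1 mu (Ordinal uN)).
  by apply: mass_mono.
have m2 : mass mu u v <= 2.
  by apply: le_trans (mass0_le2 v); apply: mass_mono.
have [k [kK k1 k2]] := dyadic_level N0 m1 m2 NKx.
have z0 : 0 <= mass mu 0 u / h k by rewrite divr_ge0 ?(ltW (h0 k))//; exact: mass_ge0.
have /andP[s1 s2] := truncn_itv z0.
exists (k, Num.truncn (mass mu 0 u / h k)); split => //=.
  rewrite -(ltr_nat R) -[X in _ < X]natr1 natrX; apply: (le_lt_trans s1).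
  rewrite ltr_pdivrMr//; apply: (le_lt_trans (mass0_le2 u)).
  by rewrite mulrDl exprS -mulrA /h -exprMn mulfV// expr1n mulr1 mul1r ltrDl exprn_gt0// invr_gt0.
exists u, v; split => //.
by rewrite -ler_pdivlMr// s1 -ltr_pdivrMr// natr1.
Qed.

(** The block sum is a difference of two partial sums from the start of the window, hence at most
    twice their maximum, and that maximum is at most t k plus the excess. The bulk 8 t k^2 <= 24 K h
    k is paid by the mass of the block. *)
Lemma block_key_bound (J : {set 'I_N}) (k s : nat) x : block_key J k s ->
  `|\sum_(n in J) a n * psi n x| ^+ 2 <= 24 * K * \sum_(n in J) mu n + 8 * window_excess k s x ^+ 2.
Proof.
move=> [kK sk [u [v [/andP[uv vN] JE k1 k2 /andP[s1 s2]]]]].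
have [VN _ hw] := block_windowP k s.
have uv' : (u <= v)%N by exact: ltnW.
have cat := @mass_cat _ _ mu 0 u v (leq0n u) uv'.
have [Uu vV] : ((block_window k s).1 <= u)%N /\ (v <= (block_window k s).2)%N.
  by apply: hw => //; rewrite cat; move: s2; rewrite !mulrDl; lra.
have -> : \sum_(n in J) a n * psi n x = psum psi a u v x.
  rewrite /psum /lin_comb big_mkcond; apply: eq_bigr => n _; rewrite JE /trunc.
  by case: ifP => // _; rewrite mul0r.
have -> : \sum_(n in J) mu n = mass mu u v by apply: eq_bigl => n; rewrite JE.
have e := psum_cat psi a x Uu uv'.
set m := maxpsum psi a (block_window k s).1 (block_window k s).2 x.
have b1 : `|psum psi a (block_window k s).1 u x| <= m by apply: psum_le_maxpsum; exact: leq_trans uv' vV.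
have b2 : `|psum psi a (block_window k s).1 v x| <= m by exact: psum_le_maxpsum.
have b3 : `|psum psi a u v x| <= 2 * m.
  rewrite (_ : psum psi a u v x = psum psi a (block_window k s).1 v x - psum psi a (block_window k s).1 u x).
    by apply: (le_trans (ler_normB _ _)); lra.
  by rewrite e addrC addKr.
have w0 : 0 <= window_excess k s x by rewrite /window_excess le_max lexx orbT.
have mt : m <= t k + window_excess k s x.
  by rewrite addrC -lerBlDr /window_excess le_max lexx.
have p0 := normr_ge0 (psum psi a u v x); have tk := t0 k; have tk2 := tK k.
have m0 : 0 <= m by exact: maxpsum_ge0.
apply: (@le_trans _ _ ((2 * m) ^+ 2)); first by apply: lerXn2r; rewrite ?nnegrE// mulr_ge0.
apply: (@le_trans _ _ (8 * t k ^+ 2 + 8 * window_excess k s x ^+ 2)).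
  have : m ^+ 2 <= (t k + window_excess k s x) ^+ 2 by apply: lerXn2r; rewrite ?nnegrE ?addr_ge0.
  have := sqr_ge0 (t k - window_excess k s x); nra.
rewrite lerD2r.
have : K * h k <= K * mass mu u v by rewrite ler_wpM2l// ltW.
rewrite -/(h k) in tk2; lra.
Qed.

(** A block of mass above h k that starts at mass at least s h k ends beyond (s + 1) h k, hence
    beyond the start of every block with the same key. *)
Lemma block_key_inj (J J' : {set 'I_N}) (k s : nat) : block_key J k s -> block_key J' k s ->
  [disjoint J & J'] -> False.
Proof.
move=> [_ _ [u [v [/andP[uv vN] JE k1 _ /andP[s1 s2]]]]].
move=> [_ _ [u' [v' [/andP[uv' vN'] JE' k1' _ /andP[s1' s2']]]]] dj.
have uN : (u < N)%N by exact: leq_trans uv vN.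
have uN' : (u' < N)%N by exact: leq_trans uv' vN'.
have key (p q p' : nat) : (p < q)%N -> h k < mass mu p q -> s%:R * h k <= mass mu 0 p ->
    mass mu 0 p' < (s%:R + 1) * h k -> (q <= p')%N -> False.
  move=> pq m1 m2 m3 qp.
  have e1 := @mass_cat _ _ mu 0 p q (leq0n p) (ltnW pq).
  have e2 : mass mu 0 q <= mass mu 0 p' by exact: mass_mono.
  move: m3; rewrite mulrDl; lra.
have [vu|uv2] := leqP v u'; first exact: (key u v u').
have [vu'|uv2'] := leqP v' u; first exact: (key u' v' u).
have [uu|uu] := leqP u u'.
  have := disjointFr dj (x := Ordinal uN'); rewrite JE JE' /= uu uv2 leqnn uv' => /(_ isT).
  by [].
have := disjointFr dj (x := Ordinal uN); rewrite JE JE' /= leqnn uv (ltnW uu) uv2' => /(_ isT).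
by [].
Qed.

Lemma partition_bound (pi : {set {set 'I_N}}) x : interval_partition pi ->
  \sum_(J in pi) `|\sum_(n in J) a n * psi n x| ^+ 2 <= Zbound x.
Proof.
move=> /andP[pp /forall_inP ip].
have /and3P[cov triv n0] := pp.
have keyex (J : {set 'I_N}) : exists ks : nat * nat, J \in pi -> block_key J ks.1 ks.2.
  have [Jp|nJ] := boolP (J \in pi); last by exists (0, 0)%N.
  have nJ0 : J != finset.set0 by apply: contraNneq n0 => <-.
  by have [ks hks] := block_key_exists (ip J Jp) nJ0; exists ks.
have [key keyP] := choice keyex.
apply: (@le_trans _ _ (\sum_(J in pi) (24 * K * \sum_(n in J) mu n +
    8 * \sum_(k < Kx.+1) \sum_(s < (2 ^ k.+1).+1) (key J == (k : nat, s : nat))%:R * window_excess k s x ^+ 2))).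
  apply: ler_sum => J Jp; have bk := keyP J Jp.
  apply: (le_trans (block_key_bound x bk)); rewrite lerD2l ler_wpM2l//.
  have [kK sK _] := bk.
  rewrite (bigD1 (Ordinal kK))//= (bigD1 (Ordinal sK))//= -surjective_pairing eqxx mul1r -addrA lerDl.
  rewrite addr_ge0// sumr_ge0// => *; rewrite ?sumr_ge0// => *; rewrite mulr_ge0 ?ler0n ?sqr_ge0//.
rewrite big_split /= /Zbound; apply: lerD.
  rewrite -mulr_sumr.
  rewrite (_ : \sum_(J in pi) \sum_(n in J) mu n = \sum_n mu n).
    by have := ler_wpM2l K0 mu2; lra.
  by rewrite -(set_partition_big _ pp) /=; apply: eq_bigl => n; rewrite inE.
rewrite -mulr_sumr ler_wpM2l// exchange_big /=; apply: ler_sum => k _.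
rewrite exchange_big /=; apply: ler_sum => s _.
rewrite -mulr_suml ler_piMl ?sqr_ge0//.
rewrite -natr_sum -[leRHS]/(1%:R) ler_nat.
rewrite (eq_bigr (fun J => if key J == (k : nat, s : nat) then 1 else 0)%N); last first.
  by move=> J _; case: eqP.
rewrite -big_mkcondr /= sum1_card.
apply/card_le1_eqP => J J' /andP[Jp /eqP kJ] /andP[Jp' /eqP kJ'].
apply/eqP; apply: contraT => JJ; exfalso.
have b1 := keyP J Jp; have b2 := keyP J' Jp'; rewrite kJ in b1; rewrite kJ' in b2.
apply: (block_key_inj b1 b2).
by move/finset.trivIsetP: triv => /(_ J J' Jp Jp'); apply; rewrite eq_sym.
Qed.

Lemma bmeas_Zbound : bmeas Zbound.
Proof.
have be k s : bmeas (window_excess k s).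
  by rewrite /window_excess; have b := bmeas_maxpsum psi_bm a (block_window k s).1 (block_window k s).2; bm.
by rewrite /Zbound; bm.
Qed.

Lemma Ex_Zbound (B : nat -> R) : (forall k, 0 <= B k) ->
  (forall k u v, (k < Kx.+1)%N -> (v <= N)%N -> mass mu u v <= 3 * h k ->
     maxexc P psi a (t k) u v <= B k * Num.sqrt (3 * h k)) ->
  Ex P Zbound <= 48 * K + 72 * \sum_(k < Kx.+1) B k ^+ 2.
Proof.
move=> B0 hB.
have be k s : bmeas (window_excess k s).
  by rewrite /window_excess; have b := bmeas_maxpsum psi_bm a (block_window k s).1 (block_window k s).2; bm.
have bs k s : bmeas (fun x => window_excess k s x ^+ 2) by have := be k s; bm.
rewrite /Zbound ExD ?ExZ ?Ex_cst; [|by bm..].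
rewrite lerD2l Ex_sum; last by bm.
(* At scale k there are 2^(k+1) + 1 windows of mass at most 3 * 2^-k, in total at most 9. *)
rewrite (_ : 72 = 8 * 9); last by rewrite -natrM.
rewrite -mulrA ler_wpM2l// mulr_sumr; apply: ler_sum => k _.
rewrite Ex_sum//.
apply: (@le_trans _ _ (\sum_(s < (2 ^ k.+1).+1) B k ^+ 2 * (3 * h k))).
  apply: ler_sum => s _; have [VN mw _] := block_windowP k s.
  have := hB k _ _ (ltn_ord k) VN mw; rewrite -[X in X <= _](ger0_norm (nrm_ge0 _ _)) => hle.
  rewrite -(nrm2 P (window_excess k s)).
  have h3 : 0 <= 3 * h k by rewrite mulr_ge0// ltW.
  rewrite -(sqr_sqrtr h3) -exprMn; apply: lerXn2r; rewrite ?nnegrE ?nrm_ge0//.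
    by rewrite mulr_ge0 ?sqrtr_ge0.
  by apply: le_trans hle; rewrite ger0_norm ?nrm_ge0.
rewrite sumr_const card_ord -[leLHS]mulr_natl -natr1 natrX mulrCA [leRHS]mulrC.
rewrite ler_wpM2l ?sqr_ge0//.
have e : 2 ^+ k * h k = 1 by rewrite /h -exprMn mulfV// expr1n.
have : h k <= 1 by apply: exprn_ile1; rewrite ?invr_ge0 ?invf_le1 ?ler1n ?ler0n.
rewrite mulrDl mul1r mulrCA exprS -[2 * _ * h k]mulrA e; lra.
Qed.

End Assembly.

(** * Choice of the parameters *)

Section Level.
Context {R : realType} {d : measure_display} {T : measurableType d}.
Variable P : probability T R.
Variables (N : nat) (psi : 'I_N -> T -> R) (A C2 w : R).
Hypothesis psi_bm : forall n, bmeas (psi n).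
Hypothesis psi_on : forall i j, Ex P (fun x => psi i x * psi j x) = (i == j)%:R.
Hypothesis psi_A : forall n x, `|psi n x| <= A.
Hypothesis N3 : (3 <= N)%N.
Hypothesis A1 : 1 <= A.
Hypothesis C21 : 1 <= C2.
Hypothesis psi_good : good P psi C2 1%g.

(* Everything is expressed through w = ln ln N. The quantity Y = (ln N)^(1/88) is
   the gap between the exponents 71/88 of the error terms and 72/88 = 9/11 of the
   main term: it absorbs all constants and all powers of w. *)
Let L := expR w.
Let Y := expR (w / 88).
Hypothesis LE : ln N%:R = L.
Hypothesis w1 : 1 <= w.
Hypothesis wY : expR 11 * w <= Y.
Hypothesis AY : expR 24 * (A ^+ 2 + C2) <= Y.

Let Nr : 0 < N%:R :> R. Proof. by rewrite ltr0n (ltnW (ltnW N3)). Qed.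
Let NE : N%:R = expR L. Proof. by rewrite -LE lnK// posrE. Qed.
Let A0 : 0 < A. Proof. exact: lt_le_trans A1. Qed.
Let C20 : 0 < C2. Proof. exact: lt_le_trans C21. Qed.
Let Y0 : 0 < Y. Proof. exact: expR_gt0. Qed.
Let L0 : 0 < L. Proof. exact: expR_gt0. Qed.
Let A2 : 1 <= A ^+ 2. Proof. exact: exprn_ege1. Qed.
Let ACY : A ^+ 2 + C2 <= Y.
Proof.
apply: le_trans AY; rewrite ler_peMl ?addr_ge0 ?sqr_ge0 ?(ltW C20)//.
by rewrite -[leLHS](@expR0 R) ler_expR ler0n.
Qed.
Let Y24 : expR 24 <= Y.
Proof.
apply: le_trans AY; rewrite ler_peMr ?expR_ge0//.
by apply: (le_trans A2); rewrite lerDl ltW.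
Qed.
Let YL : Y <= L. Proof. by rewrite ler_expR; have := w1; lra. Qed.
Let Y1 : 1 <= Y. Proof. by rewrite -[leLHS](@expR0 R) ler_expR; have := w1; lra. Qed.

Lemma level_AN : A <= N%:R.
Proof.
have h : A <= A ^+ 2 by rewrite expr2 ler_peMl// ltW.
have h2 : A ^+ 2 <= Y by apply: le_trans ACY; rewrite lerDl ltW.
apply: (le_trans h); apply: (le_trans h2); apply: (le_trans YL).
by rewrite NE (le_trans _ (expR_ge1Dx L))// lerDr.
Qed.

(** With r about 12 w, 2^-r <= e^(-6 w) = L^-6 beats the powers of L in the far terms, while 2^(r+1)
    <= e^2 L^12 is still beaten by sqrt E, of order e^(- k / 16) with k >= Y. *)
Definition chain_depth : nat := (Num.truncn (12 * w)).+1.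

Lemma chain_depth_bounds : 12 * w <= chain_depth%:R /\ chain_depth%:R <= 12 * w + 1.
Proof. by apply: truncn_succ; apply: mulr_ge0; [exact: ler0n | exact: le_trans ler01 w1]. Qed.

Lemma two_pow_ge (n : nat) : expR (n%:R / 2) <= 2 ^+ n :> R.
Proof.
have h : 1 - 2^-1 <= expR (- 2^-1) :> R by rewrite (le_trans _ (expR_ge1Dx _)).
have e0 : 0 < expR 2^-1 :> R by exact: expR_gt0.
have e : expR 2^-1 <= 2 :> R.
  have := ler_wpM2l (ltW e0) h; rewrite -expRD subrr expR0; lra.
by rewrite expRM_natl; apply: lerXn2r; rewrite ?nnegrE ?(ltW e0).
Qed.

Lemma two_pow_le (n : nat) : 2 ^+ n <= expR n%:R :> R.
Proof.
rewrite -[n%:R]mulr1 expRM_natl; apply: lerXn2r; rewrite ?nnegrE ?expR_ge0//.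
by rewrite (le_trans _ (expR_ge1Dx 1)).
Qed.

Lemma pow_Y (n : nat) : (n <= 24)%N -> 2 ^+ n <= Y.
Proof.
move=> n24; apply: le_trans Y24; apply: (le_trans (two_pow_le n)).
by rewrite ler_expR ler_nat.
Qed.

Lemma w_le_Y : 512 * w <= Y.
Proof.
apply: le_trans wY; apply: ler_wpM2r; first exact: le_trans ler01 w1.
rewrite (_ : 512 = 2 ^+ 9); last by rewrite -natrX.
by apply: (le_trans (two_pow_le 9)); rewrite ler_expR ler_nat.
Qed.

(** Since s >= Y / 3, the Maurey tail has exponent at least Y >= 512 w, enough to beat Kc <=
    L^11. *)
Lemma Y_le_scale : Y * (2048 * A ^+ 2) <= (Y / 3) ^+ 4.
Proof.
have h : 81 * (2048 * A ^+ 2) <= Y.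
  apply: le_trans AY; apply: (@le_trans _ _ (expR 24 * A ^+ 2)); last first.
    by apply: ler_wpM2l; [exact: expR_ge0 | rewrite lerDl ltW].
  rewrite mulrA; apply: ler_wpM2r; first exact: sqr_ge0.
  have h81 : 81%:R <= 2 ^+ 7 :> R by rewrite -natrX ler_nat.
  have h2048 : 2048%:R <= 2 ^+ 11 :> R by rewrite -natrX ler_nat.
  apply: (le_trans (ler_pM (ler0n R 81) (ler0n R 2048) h81 h2048)).
  rewrite -exprD; apply: (le_trans (two_pow_le _)).
  by rewrite ler_expR ler_nat.
have v0 : 0 <= 2048 * A ^+ 2 by apply: mulr_ge0; [exact: ler0n|exact: sqr_ge0].
move: h v0; set v := 2048 * A ^+ 2 => h v0.
have y1 := Y1.
rewrite (_ : (Y / 3) ^+ 4 = Y * (Y ^+ 2 * (Y / 81))); last by field.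
rewrite ler_pM2l//; apply: (@le_trans _ _ (Y / 81)); first by lra.
by rewrite ler_peMl ?divr_ge0 ?(ltW Y0)// exprn_ege1.
Qed.

Section OneWindow.
Variables (u M J k : nat) (s Kc : R) (a mu : 'I_N -> R).
Hypothesis mu0 : forall n, 0 < mu n.
Hypothesis mu_a : forall n, a n ^+ 2 <= mu n.
Hypothesis M0 : (0 < M)%N.
Hypothesis JN : (N <= 2 ^ J)%N.
Hypothesis J4 : (4 ^ J <= N ^ 3)%N.
Hypothesis JL : J%:R <= 3 * L.
Hypothesis kY : Y <= k%:R :> R.
Hypothesis k1 : 1 <= k%:R :> R.
Hypothesis kL : k%:R <= 4 * L.
Hypothesis Mk : k%:R / 4 <= ln (N%:R / M%:R) :> R.
Hypothesis sY : Y / 3 <= s.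
Hypothesis sU : s <= expR (6 / 5 * w).
Hypothesis K0 : 0 <= Kc.
Hypothesis KU : Kc <= expR (11 * w).
Hypothesis ha : s ^+ 8 <= k%:R / (4 * L) * Kc.

Let theta := k%:R / (4 * L).
Let s0 : 0 < s. Proof. by apply: lt_le_trans sY; rewrite divr_gt0. Qed.

Let MN : M%:R / N%:R <= expR (- (k%:R / 4)) :> R.
Proof.
have M0' : 0 < M%:R :> R by rewrite ltr0n.
rewrite (_ : M%:R / N%:R = expR (- ln (N%:R / M%:R)) :> R) ?ler_expR ?lerN2//.
by rewrite -lnV ?posrE ?divr_gt0// invf_div lnK// posrE divr_gt0.
Qed.

Let sqMN : Num.sqrt (M%:R / N%:R) <= expR (- (k%:R / 8)) :> R.
Proof.
apply: (le_trans (ler_wsqrtr MN)).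
rewrite (_ : - (k%:R / 4) = - (k%:R / 8) + - (k%:R / 8) :> R); last by field.
by rewrite expRD -expr2 sqrtr_sqr ger0_norm ?expR_ge0.
Qed.

Let s2U : s ^+ 2 <= expR (12 / 5 * w).
Proof.
rewrite (_ : 12 / 5 * w = 6 / 5 * w + 6 / 5 * w); last by field.
by rewrite expRD -expr2; apply: lerXn2r sU; rewrite ?nnegrE ?expR_ge0// ltW.
Qed.

Let s1 : 1 <= s.
Proof.
have y2 := pow_Y (n := 2) isT.
have e4 : 2 ^+ 2 = 4 :> R by rewrite -natrX.
apply: le_trans sY; move: y2; rewrite e4; lra.
Qed.

Let cond_b : Kc * expR (- (s ^+ 4 / (2048 * A ^+ 2))) <= 1.
Proof.
have := Y_le_scale; have := w_le_Y; have b0 : 0 < 2048 * A ^+ 2 by apply: mulr_gt0; [exact: ltr0n|exact: exprn_gt0].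
move: b0; set b := 2048 * A ^+ 2 => b0 yw yb.
have s4 : (Y / 3) ^+ 4 <= s ^+ 4.
  by apply: lerXn2r sY; rewrite nnegrE ?divr_ge0 ?(ltW s0) ?(ltW Y0).
have z : 11 * w <= s ^+ 4 / b.
  rewrite ler_pdivlMr//; apply: le_trans s4; apply: le_trans yb; apply: ler_wpM2r; first exact: ltW.
  have := w1; lra.
apply: (@le_trans _ _ (expR (11 * w) * expR (- (s ^+ 4 / b)))).
  by apply: ler_wpM2r KU; exact: expR_ge0.
by rewrite -expRD -[leRHS](@expR0 R) ler_expR; lra.
Qed.
Let cond_c : Kc * (expR 1 * Num.sqrt (M%:R / N%:R)) <= s ^- 2.
Proof.
rewrite -[leRHS]mul1r ler_pdivlMr ?exprn_gt0//.
have e0 : 0 <= expR 1 * Num.sqrt (M%:R / N%:R) :> R by exact: (mulr_ge0 (expR_ge0 1) (sqrtr_ge0 _)).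
have e1 : expR 1 * Num.sqrt (M%:R / N%:R) <= expR 1 * expR (- (k%:R / 8)) :> R by rewrite ler_pM2l ?expR_gt0.
apply: (le_trans (ler_pM (mulr_ge0 K0 e0) (sqr_ge0 s) (ler_pM K0 e0 KU e1) s2U)).
rewrite -!expRD -[leRHS](@expR0 R) ler_expR.
have := w_le_Y; have := kY; have := w1; lra.
Qed.
Let sKc : Num.sqrt Kc <= expR (11 / 2 * w).
Proof.
apply: (le_trans (ler_wsqrtr KU)).
rewrite (_ : 11 * w = 11 / 2 * w + 11 / 2 * w); last by field.
by rewrite expRD -expr2 sqrtr_sqr ger0_norm ?expR_ge0.
Qed.
Let cond_d : 2 * Num.sqrt Kc / N%:R <= s ^- 2.
Proof.
rewrite -[leRHS]mul1r ler_pdivlMr ?exprn_gt0// mulrAC ler_pdivrMr// mul1r.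
apply: (@le_trans _ _ (expR w * expR (11 / 2 * w) * expR (12 / 5 * w))).
  apply: ler_pM; rewrite ?sqr_ge0 ?mulr_ge0 ?sqrtr_ge0//.
  apply: ler_pM; rewrite ?sqrtr_ge0//.
  by apply: le_trans (expR_ge1Dx w); have := w1; lra.
by rewrite NE -!expRD ler_expR; have := w_le_Y; have := YL; have := w1; lra.
Qed.
Let cond_e : J%:R * (2 * (Num.sqrt (4 * C2 / theta) * (2 * 2^-1 ^+ chain_depth) +
    2 ^+ chain_depth.+1 * Num.sqrt (expR 1 * Num.sqrt (M%:R / N%:R))) + Num.sqrt Kc / N%:R) <= chain_depth%:R / s ^+ 2.
Proof.
have [r1 r2] := chain_depth_bounds.
have s2 : 0 < s ^+ 2 by rewrite exprn_gt0.
have S0 : 0 <= s ^+ 2 by exact: ltW.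
have Yw := w_le_Y; have yl := YL; have ww := w1; have kk := kY.
have Yew : Y <= expR w by rewrite ler_expR; lra.
(* Of the right side only [chain_depth] >= 1 is kept: each of the three terms on the left,
   multiplied by J s^2, is O(1 / L). *)
rewrite ler_pdivlMr//; apply: (@le_trans _ _ 1); last by rewrite ler1n.
set T1 := Num.sqrt (4 * C2 / theta) * _; set T2 := 2 ^+ chain_depth.+1 * _; set T3 := Num.sqrt Kc / _.
have J0 : 0 <= J%:R :> R by [].
have a1 : T1 <= 8 * (expR w * expR (- (6 * w))).
  have c1 : Num.sqrt (4 * C2 / theta) <= 4 * L.
    rewrite -[leRHS]ger0_norm; last by rewrite mulr_ge0 ?(ltW L0).
    rewrite -sqrtr_sqr; apply: ler_wsqrtr.
    have k0 : 0 < k%:R :> R by exact: lt_le_trans ltr01 k1.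
    rewrite (_ : 4 * C2 / theta = 16 * L * (C2 / k%:R)); last first.
      by rewrite /theta; field; rewrite !gt_eqF.
    rewrite (_ : (4 * L) ^+ 2 = 16 * L * L); last by ring.
    apply: ler_wpM2l; first by rewrite mulr_ge0 ?(ltW L0).
    apply: (@le_trans _ _ C2); first by rewrite ler_piMr ?(ltW C20)// invf_le1.
    by apply: le_trans yl; apply: le_trans ACY; rewrite lerDr sqr_ge0.
  have c2 : 2^-1 ^+ chain_depth <= expR (- (6 * w)).
    rewrite exprVn expRN lef_pV2 ?posrE ?expR_gt0 ?exprn_gt0//.
    by apply: le_trans (two_pow_ge chain_depth); rewrite ler_expR; lra.
  rewrite /T1 (_ : 8 * _ = 4 * L * (2 * expR (- (6 * w)))); last by rewrite /L; ring.
  apply: ler_pM; rewrite ?sqrtr_ge0 ?mulr_ge0 ?exprn_ge0 ?invr_ge0//.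
  by rewrite ler_pM2l.
have a2 : T2 <= expR (12 * w + 2) * expR (1 / 2 - k%:R / 16).
  apply: ler_pM; rewrite ?sqrtr_ge0 ?exprn_ge0//.
    by apply: (le_trans (two_pow_le _)); rewrite ler_expR -natr1; lra.
  apply: (@le_trans _ _ (Num.sqrt (expR (1 / 2 - k%:R / 16) ^+ 2))); last first.
    by rewrite sqrtr_sqr ger0_norm ?expR_ge0.
  apply: ler_wsqrtr; rewrite expr2 -expRD.
  rewrite (_ : 1 / 2 - k%:R / 16 + (1 / 2 - k%:R / 16) = 1 + - (k%:R / 8)); last by field.
  by rewrite expRD ler_pM2l ?expR_gt0.
have a3 : T3 <= expR (11 / 2 * w) * expR (- L).
  by rewrite /T3 NE -expRN; apply: ler_wpM2r; rewrite ?expR_ge0.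
have JS : J%:R * s ^+ 2 <= 3 * (expR w * expR (12 / 5 * w)).
  by rewrite mulrA; apply: ler_pM.
have T10 : 0 <= T1 by rewrite /T1 mulr_ge0 ?sqrtr_ge0// mulr_ge0 ?exprn_ge0 ?invr_ge0.
have T20 : 0 <= T2 by rewrite /T2 mulr_ge0 ?sqrtr_ge0// exprn_ge0.
have T30 : 0 <= T3 by rewrite /T3 divr_ge0 ?sqrtr_ge0.
have JS0 : 0 <= J%:R * s ^+ 2 by rewrite mulr_ge0.
rewrite (_ : J%:R * (2 * (T1 + T2) + T3) * s ^+ 2 =
  2 * (J%:R * s ^+ 2 * T1) + 2 * (J%:R * s ^+ 2 * T2) + J%:R * s ^+ 2 * T3); last by ring.
have p1 := ler_pM JS0 T10 JS a1; have p2 := ler_pM JS0 T20 JS a2; have p3 := ler_pM JS0 T30 JS a3.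
have q1 : 3 * (expR w * expR (12 / 5 * w)) * (8 * (expR w * expR (- (6 * w)))) <= 24 * (expR w)^-1.
  rewrite (_ : _ * _ = 24 * (expR w * expR (12 / 5 * w) * (expR w * expR (- (6 * w))))); last by ring.
  by rewrite ler_pM2l// -!expRD -expRN ler_expR; lra.
have q2 : 3 * (expR w * expR (12 / 5 * w)) * (expR (12 * w + 2) * expR (1 / 2 - k%:R / 16)) <= 3 * (expR w)^-1.
  rewrite -mulrA ler_pM2l// -!expRD -expRN ler_expR; lra.
have q3 : 3 * (expR w * expR (12 / 5 * w)) * (expR (11 / 2 * w) * expR (- L)) <= 3 * (expR w)^-1.
  rewrite -mulrA ler_pM2l// -!expRD -expRN ler_expR; lra.
have ei : (expR w)^-1 <= 2 ^- 6.
  rewrite lef_pV2 ?posrE ?expR_gt0 ?exprn_gt0//; apply: le_trans Yew; exact: pow_Y.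
have -> : 1 = 2 ^+ 6 * 2 ^- 6 :> R by rewrite mulfV// expf_neq0.
have i0 : 0 <= 2 ^- 6 :> R by rewrite invr_ge0 exprn_ge0.
have e64 : 2 ^+ 6 = 64 :> R by rewrite -natrX.
rewrite e64 in ei i0 *; move: ei i0 p1 p2 p3 q1 q2 q3.
set iw := (expR w)^-1; lra.
Qed.
Let sA : 4 * A ^+ 2 <= s ^+ 4.
Proof.
apply: (@le_trans _ _ ((Y / 3) ^+ 4)); last first.
  by apply: lerXn2r sY; rewrite nnegrE ?divr_ge0 ?(ltW s0) ?(ltW Y0).
apply: le_trans Y_le_scale; rewrite mulrA; apply: ler_wpM2r; first exact: sqr_ge0.
apply: (@le_trans _ _ 2048); first by rewrite ler_nat.
by rewrite ler_peMl ?ler0n ?Y1.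
Qed.
Let sC : Num.sqrt (8 * C2) + 1 <= s.
Proof.
apply: le_trans sY; have e := expR_ge1Dx (24 : R).
have h : 25 * (A ^+ 2 + C2) <= Y.
  apply: le_trans AY; apply: ler_wpM2r; first by rewrite addr_ge0 ?sqr_ge0 ?(ltW C20).
  by apply: le_trans e; rewrite -natr1 addrC.
have c8 : 0 <= 8 * C2 by rewrite mulr_ge0 ?ler0n ?(ltW C20).
have := sqr_sqrtr c8; set z := Num.sqrt _ => zE.
have := sqr_ge0 (z - 1); have := A2; lra.
Qed.

Lemma level_psum_excess : psum_excess_le P psi a mu u (u + M) (400 * Kc) (Num.sqrt (window_const A C2 * (chain_depth%:R / s ^+ 2))).
Proof.
have th0 : 0 < theta by rewrite divr_gt0 ?mulr_gt0// (lt_le_trans ltr01).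
have th1 : theta <= 1 by rewrite ler_pdivrMr ?mulr_gt0// mul1r.
have thE : theta * ln N%:R <= ln (N%:R / M%:R).
  by apply: le_trans Mk; rewrite LE /theta le_eqVlt; apply/orP; left; apply/eqP; field; rewrite gt_eqF.
exact: (window_psum_excess psi_bm psi_on psi_A N3 level_AN A1 C21 psi_good M0 th0 th1 thE s1 sA sC ha cond_b cond_c cond_d JN J4 cond_e mu0 mu_a).
Qed.

End OneWindow.
End Level.

Lemma psum_excess_mono (R : realType) (d : measure_display) (T : measurableType d) (P : probability T R)
    (N : nat) (psi : 'I_N -> T -> R) (a mu : 'I_N -> R) (u v : nat) (K K' dl : R) :
  (forall n, bmeas (psi n)) -> (forall n, 0 < mu n) -> K <= K' ->
  psum_excess_le P psi a mu u v K dl -> psum_excess_le P psi a mu u v K' dl.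
Proof.
move=> psi_bm mu0 KK h u' p x uu pv maxpsum; apply: le_trans (h u' p x uu pv maxpsum).
have x0 : 0 <= x by apply: le_trans maxpsum; exact: mass_ge0.
have b := bmeas_psum psi_bm a u' p; apply: nrm_mono; [bm..|] => y.
have s : Num.sqrt (K * x) <= Num.sqrt (K' * x) by apply: ler_wsqrtr; exact: ler_wpM2r.
have m0 (z : R) : 0 <= Num.max z 0 by rewrite le_max lexx orbT.
rewrite (ger0_norm (m0 _)) (ger0_norm (m0 _)) ge_max m0 andbT le_max; apply/orP; left; lra.
Qed.

Lemma pow128_ge (R : realType) (n : nat) : expR (n%:R / 5) <= (128 / 100) ^+ n :> R.
Proof.
have h : 1 - 5^-1 <= expR (- 5^-1) :> R by rewrite (le_trans _ (expR_ge1Dx _)).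
have e0 : 0 < expR 5^-1 :> R by exact: expR_gt0.
have e : expR 5^-1 <= 128 / 100 :> R.
  have := ler_wpM2l (ltW e0) h; rewrite -expRD subrr expR0; lra.
by rewrite expRM_natl; apply: lerXn2r; rewrite ?nnegrE ?(ltW e0) ?divr_ge0.
Qed.

Lemma count_le (R : realType) (x : R) (n : nat) : 0 <= x ->
  \sum_(k < n) (k%:R <= x :> R)%:R <= x + 1 :> R.
Proof.
move=> x0; elim: n => [|n IH]; first by rewrite big_ord0 addr_ge0.
rewrite big_ord_recr /=; case: (leP n%:R x) => h; last by rewrite addr0.
apply: (@le_trans _ _ (n%:R + 1)); last by rewrite lerD2r.
rewrite lerD2r; apply: (@le_trans _ _ (\sum_(k < n) 1)); last by rewrite sumr_const card_ord.
by apply: ler_sum => k _; rewrite lern1 leq_b1.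
Qed.

(** The lower bound 1 / N on the weights makes the mass of a window control its length, on which
    goodness depends. *)
Lemma mass_ge_count (R : realType) (N : nat) (mu : 'I_N -> R) (u v : nat) :
  (forall n, N%:R^-1 <= mu n) -> (u <= v)%N -> (v <= N)%N -> (v - u)%:R / N%:R <= mass mu u v.
Proof.
move=> muN; elim: v => [|v IH] uv vN.
  by rewrite sub0n mul0r (_ : u = 0%N) ?mass_nil//; apply/eqP; rewrite -leqn0.
move: uv; rewrite leq_eqVlt => /predU1P[->|uv]; first by rewrite subnn mul0r mass_nil.
rewrite ltnS in uv; rewrite (mass_cat mu uv (leqnSn v)) subSn// -natr1 mulrDl.
apply: lerD; first by apply: IH => //; exact: ltnW.
by rewrite (mass1 mu (Ordinal vN)) mul1r.
Qed.

(** * Maximal excess at one dyadic scale *)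

Section Level.
Context {R : realType} {d : measure_display} {T : measurableType d}.
Variable P : probability T R.
Variables (N : nat) (psi : 'I_N -> T -> R) (A C2 w : R).
Hypothesis psi_bm : forall n, bmeas (psi n).
Hypothesis psi_on : forall i j, Ex P (fun x => psi i x * psi j x) = (i == j)%:R.
Hypothesis psi_A : forall n x, `|psi n x| <= A.
Hypothesis N3 : (3 <= N)%N.
Hypothesis A1 : 1 <= A.
Hypothesis C21 : 1 <= C2.
Hypothesis psi_good : good P psi C2 1%g.

Let L := expR w.
Let Y := expR (w / 88).
Hypothesis LE : ln N%:R = L.
Hypothesis w1 : 1 <= w.
Hypothesis wY : expR 11 * w <= Y.
Hypothesis AY : expR 24 * (A ^+ 2 + C2) <= Y.

Let Nr : 0 < N%:R :> R. Proof. by rewrite ltr0n (ltnW (ltnW N3)). Qed.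
Let NE : N%:R = expR L. Proof. by rewrite -LE lnK// posrE. Qed.
Let A0 : 0 < A. Proof. exact: lt_le_trans A1. Qed.
Let C20 : 0 < C2. Proof. exact: lt_le_trans C21. Qed.
Let Y0 : 0 < Y. Proof. exact: expR_gt0. Qed.
Let L0 : 0 < L. Proof. exact: expR_gt0. Qed.
Let w0 : 0 <= w. Proof. exact: le_trans w1. Qed.
Let A2 : 1 <= A ^+ 2. Proof. exact: exprn_ege1. Qed.

Let w2112 : 2112 <= w.
Proof.
have : expR 24 <= Y.
  apply: le_trans AY; rewrite ler_peMr ?expR_ge0//.
  by apply: (le_trans A2); rewrite lerDl ltW.
rewrite ler_expR; lra.
Qed.

Definition levelK : R := expR (9 / 11 * w).
(** About K^(1/3): the k0 coarser scales cost about k0^2 each, and k0^3 = K is the main term. From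
    this scale on, k K / L is at least L^(1/11). *)
Definition first_level : nat := (Num.truncn (expR (3 / 11 * w))).+1.
(* A step function below (k K / ln N)^(1/8), where K = (ln N)^(9/11), coarse enough
   to be summed by counting and fine enough that the sum of its inverse squares
   over k <= 4 ln N is O((ln N)^(71/88)). *)
Definition sample_scale (k : nat) : R := if k%:R <= expR (9 / 11 * w) then expR (w / 88)
  else if k%:R <= expR (21 / 22 * w) then expR (7 / 88 * w) else expR (17 / 176 * w).
(** Halvings of a first stage: 1.28^(60 w) >= e^(12 w) lifts the threshold parameter from K to
    beyond 400 L^11. *)
Definition levelD1 : nat := (Num.truncn (60 * w)).+1.
(** Halvings of a second stage: 1.28^(5 L) >= e^L = N reaches the range of [maxexc_base]. *)
Definition levelD2 : nat := (Num.truncn (5 * expR w)).+1.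
Definition step_err (s : R) : R := Num.sqrt (window_const A C2 * ((chain_depth w)%:R / s ^+ 2)).
(** The many halvings of the second stage are affordable because a threshold parameter above L^11
    permits the gain s = L^(6/5): the number 5 L of halvings, squared and divided by s^2, is of
    order L^(-2/5). *)
Definition level_err (k : nat) : R :=
  levelD1%:R * step_err (sample_scale k / 3) + levelD2%:R * step_err (expR (6 / 5 * w)).

Lemma first_level_bounds : expR (3 / 11 * w) <= first_level%:R /\
  first_level%:R <= expR (3 / 11 * w) + 1.
Proof. exact: truncn_succ (expR_ge0 _). Qed.

Lemma first_level_ge k : (first_level <= k)%N -> expR (3 / 11 * w) <= k%:R.
Proof. by move=> h; apply: (le_trans first_level_bounds.1); rewrite ler_nat. Qed.

Let J : nat := up_log 2 N.
Let N4 : (4 <= N)%N.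
Proof.
rewrite -(ler_nat R) NE; apply: le_trans (expR_ge1Dx L).
have := expR_ge1Dx w; have := w2112; rewrite -/L; lra.
Qed.
Let JN : (N <= 2 ^ J)%N. Proof. exact: up_logP. Qed.
Let J2 : (2 ^ J <= 2 * N)%N.
Proof.
have J0 : (0 < J)%N by rewrite up_log_gt0/= (ltn_trans _ N3).
by rewrite -(prednK J0) expnS leq_mul2l/= ltnW// up_log_gtn// (ltn_trans _ N3).
Qed.
Let J4 : (4 ^ J <= N ^ 3)%N.
Proof.
rewrite -[4%N]/(2 ^ 2)%N -expnM mulnC expnM (@leq_trans ((2 * N) ^ 2)) ?leq_exp2r//.
by rewrite expnMn (expnS _ 2) leq_mul2r N4 orbT.
Qed.
Let JL : J%:R <= 3 * L.
Proof.
have h : expR (J%:R / 2) <= expR (1 + L).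
  apply: (le_trans (two_pow_ge J)); rewrite expRD -NE.
  apply: (@le_trans _ _ (2 * N%:R)); first by rewrite -natrX -natrM ler_nat.
  by apply: ler_wpM2r; [exact: ler0n | rewrite (le_trans _ (expR_ge1Dx 1))].
move: h; rewrite ler_expR; have := expR_ge1Dx w; have := w2112; rewrite -/L; lra.
Qed.

Lemma sample_scale_ge k : expR (w / 88) <= sample_scale k.
Proof. by rewrite /sample_scale; case: ifP => _; [|case: ifP => _]; rewrite ler_expR; have := w0; lra. Qed.

Lemma sample_scale_le k : sample_scale k <= expR (6 / 5 * w).
Proof. by rewrite /sample_scale; case: ifP => _; [|case: ifP => _]; rewrite ler_expR; have := w0; lra. Qed.

(** On a step whose left end is L^y, with y = 3/11, 9/11 or 21/22, the exponent of the scale is (y +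
    9/11 - 1) / 8. *)
Lemma sample_scale_pow k : (first_level <= k)%N -> sample_scale k ^+ 8 <= k%:R * (levelK / L).
Proof.
move=> /first_level_ge k3.
rewrite /levelK /L -expRN -expRD.
suff h (y z : R) : expR y <= k%:R -> 8 * z <= y + (9 / 11 * w - w) -> expR z ^+ 8 <= k%:R * expR (9 / 11 * w - w).
  rewrite /sample_scale; have [k1|k1] := leP (k%:R : R) (expR (9 / 11 * w)); first by apply: (h _ _ k3); lra.
  by have [k2|k2] := leP (k%:R : R) (expR (21 / 22 * w)); [apply: (h _ _ (ltW k1)) | apply: (h _ _ (ltW k2))]; lra.
move=> yk yz; rewrite -expRM_natl; apply: (@le_trans _ _ (expR y * expR (9 / 11 * w - w))).
  by rewrite -expRD ler_expR.
by rewrite ler_pM2r ?expR_gt0.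
Qed.

Section OneLevel.
Variables (a mu : 'I_N -> R) (k : nat).
Hypothesis mu_a : forall n, a n ^+ 2 <= mu n.
Hypothesis muN : forall n, N%:R^-1 <= mu n.
Hypothesis k0 : (first_level <= k)%N.
Hypothesis kL : k%:R <= 4 * L.

Let mu0 n : 0 < mu n. Proof. by apply: lt_le_trans (muN n); rewrite invr_gt0. Qed.

(** The mass bound gives M <= 3 N 2^-k, so ln (N / M) is at least k / 2 minus a constant, hence at
    least k / 4 as k >= 8. *)
Lemma window_length (u v : nat) : (u < v <= N)%N -> mass mu u v <= 3 * 2^-1 ^+ k ->
  k%:R / 4 <= ln (N%:R / (v - u)%:R) :> R.
Proof.
move=> /andP[uv vN] hm.
have M0 : 0 < (v - u)%:R :> R by rewrite ltr0n subn_gt0.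
have hM := le_trans (mass_ge_count muN (ltnW uv) vN) hm.
have D0 : 0 < N%:R / (v - u)%:R :> R by rewrite divr_gt0.
have k8 : 8 <= k%:R :> R.
  by apply: le_trans (first_level_ge k0); apply: le_trans (expR_ge1Dx _); have := w2112; lra.
rewrite -ler_expR lnK ?posrE//; apply: (@le_trans _ _ (2 ^+ k / 3)).
  rewrite ler_pdivlMr//; apply: le_trans (two_pow_ge k).
  apply: (@le_trans _ _ (expR (k%:R / 4) * expR 2)).
    by rewrite ler_pM2l ?expR_gt0//; apply: le_trans (expR_ge1Dx 2); lra.
  by rewrite -expRD ler_expR; lra.
rewrite ler_pdivlMr// mulrAC ler_pdivrMr//.
move: hM; rewrite exprVn ler_pdivrMr// mulrAC ler_pdivlMr ?exprn_gt0//; lra.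
Qed.

Lemma level_maxexc_le (u v : nat) : (u < v <= N)%N -> mass mu u v <= 3 * 2^-1 ^+ k ->
  maxexc_le P psi a mu u v levelK (level_err k).
Proof.
move=> uvN hm; have /andP[uv vN] := uvN; have kM := window_length uvN hm.
have M0 : (0 < v - u)%N by rewrite subn_gt0.
have k3 := first_level_ge k0.
have ww := w2112; have y0 := Y0; have l0 := L0.
have kY : Y <= k%:R :> R by apply: le_trans k3; rewrite ler_expR; lra.
have k1 : 1 <= k%:R :> R.
  by apply: le_trans k3; apply: le_trans (expR_ge1Dx _); lra.
have hd s Kc : Y / 3 <= s -> s <= expR (6 / 5 * w) -> 0 <= Kc -> Kc <= expR (11 * w) ->
    s ^+ 8 <= k%:R / (4 * L) * Kc -> psum_excess_le P psi a mu u v (400 * Kc) (step_err s).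
  move=> h1 h2 h3 h4 h5; rewrite -[v](subnKC (ltnW uv)).
  exact: (level_psum_excess psi_bm psi_on psi_A N3 A1 C21 psi_good LE w1 wY AY mu0 mu_a M0 JN J4 JL kY k1 kL kM h1 h2 h3 h4 h5).
have K1 : (10 * A) ^+ 2 <= levelK.
  have p7 : 100%:R <= 2 ^+ 7 :> R by rewrite -natrX ler_nat.
  have h : 100%:R * A ^+ 2 <= Y.
    apply: le_trans AY; apply: ler_pM; rewrite ?sqr_ge0 ?ler0n//; last by rewrite lerDl ltW.
    by apply: (le_trans p7); apply: (le_trans (two_pow_le _)); rewrite ler_expR ler_nat.
  rewrite exprMn -natrX; apply: (le_trans h); rewrite ler_expR; lra.
have s0 x : 0 <= step_err x by exact: sqrtr_ge0.
have c400 : 400%:R <= expR w :> R.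
  have p9 : 400%:R <= 2 ^+ 9 :> R by rewrite -natrX ler_nat.
  apply: (le_trans p9); apply: (le_trans (two_pow_le _)); rewrite ler_expR; lra.
have e11 : 0 <= expR (11 * w) by exact: expR_ge0.
rewrite /level_err -[X in _ + X]addr0.
have d128 n : 1 <= (128 / 100) ^+ n :> R by rewrite exprn_ege1//; lra.
have lK0 : 0 <= levelK by exact: expR_ge0.
apply: (maxexc_iter psi_bm mu0 mu_a psi_A A1 vN) => //.
- by rewrite addr0 mulr_ge0.
- move=> K' KK'; apply: (psum_excess_mono psi_bm mu0 KK').
  rewrite -[levelK](@divfK _ 400%:R) ?pnatr_eq0// mulrC; apply: hd.
  + by rewrite ler_pM2r// sample_scale_ge.
  + by have := sample_scale_le k; have := sample_scale_ge k; have := Y0; rewrite /Y; lra.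
  + exact: divr_ge0 lK0 (ler0n R 400).
  + rewrite ler_pdivrMr ?ltr0n//; apply: (@le_trans _ _ (expR (11 * w))); first by rewrite ler_expR; lra.
    by rewrite ler_peMr// ler1n.
  (* The 400 of [window_psum_excess] and the 4 in theta = k / (4 L) amount to 1600 <= 3^8, which is
     why the scale is divided by 3. *)
  + rewrite exprMn exprVn ler_pdivrMr ?exprn_gt0//; apply: (le_trans (sample_scale_pow k0)).
    have kK0 : 0 <= k%:R * (levelK / L) by rewrite mulr_ge0// divr_ge0// ltW.
    rewrite (_ : _ / _ * _ * _ = k%:R * (levelK / L) * (3 ^+ 8 / (4 * 400))); last first.
      by field; rewrite gt_eqF.
    rewrite ler_peMr// ler_pdivlMr; last by rewrite mulr_gt0 ?ltr0n.
    by rewrite mul1r -natrX -natrM ler_nat.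
(* Second stage: the threshold parameter now exceeds 400 e^(11 w), and s = e^(6 w / 5) is
   admissible. *)
apply: (maxexc_iter psi_bm mu0 mu_a psi_A A1 vN) => //.
- by apply: (le_trans K1); rewrite ler_peMl.
- move=> K' KK'; apply: (psum_excess_mono psi_bm mu0 (K := 400%:R * expR (11 * w))).
    apply: le_trans KK'; apply: (@le_trans _ _ (expR w * expR (11 * w))); first by rewrite ler_pM2r ?expR_gt0.
    rewrite -expRD; apply: (@le_trans _ _ (expR (levelD1%:R / 5))).
      by have [h _] := truncn_succ (mulr_ge0 (ler0n R 60) w0); rewrite ler_expR /levelD1; lra.
    apply: (le_trans (pow128_ge _ _)); rewrite ler_peMr// ?exprn_ge0 ?divr_ge0//.
    by rewrite -[leLHS](@expR0 R) ler_expR; lra.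
  apply: hd => //.
  + apply: (@le_trans _ _ Y); first by rewrite ler_pdivrMr//; lra.
    by rewrite ler_expR; lra.
  + rewrite -expRM_natl [leRHS]mulrAC ler_pdivlMr ?mulr_gt0//.
    apply: (@le_trans _ _ (expR (11 * w))); last by rewrite ler_peMl.
    apply: (@le_trans _ _ (expR (8 * (6 / 5 * w)) * (expR 4 * L))).
      rewrite ler_pM2l ?expR_gt0// ler_pM2r//; apply: le_trans (expR_ge1Dx 4); lra.
    by rewrite -!expRD ler_expR; lra.
apply: (maxexc_base P mu0 mu_a psi_A A1).
have h : 5 * L <= levelD2%:R := (truncn_succ (mulr_ge0 (ler0n R 5) (expR_ge0 w))).1.
have h1 : N%:R <= (128 / 100) ^+ levelD2 :> R.
  by apply: le_trans (pow128_ge R levelD2); rewrite NE ler_expR; lra.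
rewrite mulrC; apply: ler_pM => //; first exact: sqr_ge0.
have : A ^+ 2 <= levelK.
  by apply: le_trans K1; rewrite exprMn ler_peMl ?sqr_ge0// exprn_ege1// ler1n.
by move=> h2; apply: (le_trans h2); rewrite ler_peMl.
Qed.

Lemma level_maxexc (t : R) (u v : nat) : (v <= N)%N -> mass mu u v <= 3 * 2^-1 ^+ k ->
  Num.sqrt (levelK * (3 * 2^-1 ^+ k)) <= t -> maxexc P psi a t u v <= level_err k * Num.sqrt (mass mu u v).
Proof.
move=> vN hm ht.
have t0 : 0 <= t by apply: le_trans ht; exact: sqrtr_ge0.
have e0 : 0 <= level_err k by rewrite addr_ge0// mulr_ge0// sqrtr_ge0.
have [vu|uv] := leqP v u; first by rewrite maxexc_nil// mulr_ge0 ?sqrtr_ge0.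
have uvN : (u < v <= N)%N by rewrite uv.
apply: le_trans (level_maxexc_le uvN hm (leqnn u) (leqnn v)); apply: maxexc_mono => //.
by apply: le_trans ht; apply: ler_wsqrtr; apply: ler_wpM2l => //; exact: expR_ge0.
Qed.
End OneLevel.
End Level.

Lemma window_const_ge1 (R : realType) (A C2 : R) : 1 <= C2 -> 1 <= window_const A C2.
Proof.
move=> C21; have C20 : 0 <= 16 * C2 by rewrite mulr_ge0// (le_trans ler01).
have A0 : 0 <= 2 ^+ 12 * A ^+ 2 by rewrite mulr_ge0 ?sqr_ge0// exprn_ge0.
by rewrite /window_const /flat_const; lra.
Qed.

(** * Summation of the errors over the scales *)

Section LevelSum.
Context {R : realType}.
Variables (A C2 w : R).
Hypothesis A1 : 1 <= A.
Hypothesis C21 : 1 <= C2.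
Hypothesis w2112 : 2112 <= w.
Hypothesis W3 : 2 ^+ 27 * w ^+ 3 <= expR (w / 88).

Let L := expR w.
Let W0 : 0 < window_const A C2. Proof. exact: lt_le_trans (window_const_ge1 A C21). Qed.
Let w0 : 0 < w. Proof. by have := w2112; lra. Qed.

(** The inverse square of the step function [sample_scale] is replaced by a sum of indicators and a
    constant, so that summing over k is counting. The factor w^3 stems from the square of [levelD1]
    times [chain_depth]. *)
Definition level_err_bound (k : nat) : R := window_const A C2 * (2 ^+ 22 * w ^+ 3) *
  ((k%:R <= expR (9 / 11 * w) :> R)%:R * expR (- (2 / 88 * w))
   + (k%:R <= expR (21 / 22 * w) :> R)%:R * expR (- (14 / 88 * w)) + expR (- (17 / 88 * w))).

Let G0 : 0 <= window_const A C2 * (2 ^+ 22 * w ^+ 3).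
Proof. by rewrite mulr_ge0 ?(ltW W0)// mulr_ge0 ?exprn_ge0// ltW. Qed.

Lemma level_err_bound_ge0 k : 0 <= level_err_bound k.
Proof. by rewrite mulr_ge0// !addr_ge0 ?mulr_ge0 ?expR_ge0. Qed.

Lemma sample_scale_inv k : (sample_scale w k ^+ 2)^-1 <= (k%:R <= expR (9 / 11 * w) :> R)%:R * expR (- (2 / 88 * w))
   + (k%:R <= expR (21 / 22 * w) :> R)%:R * expR (- (14 / 88 * w)) + expR (- (17 / 88 * w)).
Proof.
have e (x y : R) : 2 * x = y -> (expR x ^+ 2)^-1 = expR (- y).
  by move=> <-; rewrite expRN -expRM_natl.
have p x : 0 <= expR x :> R := expR_ge0 x.
have h1 := p (- (2 / 88 * w)); have h2 := p (- (14 / 88 * w)); have h3 := p (- (17 / 88 * w)).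
rewrite /sample_scale; case: ifP => k1.
  rewrite (e _ (2 / 88 * w)); last by field.
  by case: (k%:R <= expR (21 / 22 * w) :> R); rewrite ?mul1r ?mul0r; lra.
case: ifP => k2; rewrite ?mul1r ?mul0r ?add0r.
  rewrite (e _ (14 / 88 * w)); last by field.
  lra.
by rewrite (e _ (17 / 88 * w))//; field.
Qed.

Lemma level_err_ge0 k : 0 <= level_err A C2 w k.
Proof. by rewrite addr_ge0// mulr_ge0// sqrtr_ge0. Qed.

Lemma step_err_sqr s : step_err A C2 w s ^+ 2 = window_const A C2 * ((chain_depth w)%:R / s ^+ 2).
Proof. by rewrite sqr_sqrtr// mulr_ge0 ?(ltW W0)// divr_ge0 ?sqr_ge0. Qed.

Lemma level_err_sqr k : level_err A C2 w k ^+ 2 <= level_err_bound k.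
Proof.
have ww := w2112; have w1 : 1 <= w by lra.
have c0 := W0.
have D1 : (levelD1 w)%:R ^+ 2 <= 2 ^+ 12 * w ^+ 2 :> R.
  rewrite -[2 ^+ 12]/(2 ^+ (6 * 2)) exprM -exprMn; apply: lerXn2r; rewrite ?nnegrE ?mulr_ge0 ?exprn_ge0 ?(ltW w0)//.
  have h : (levelD1 w)%:R <= 60 * w + 1 := (truncn_succ (mulr_ge0 (ler0n R 60) (ltW w0))).2.
  apply: (le_trans h); rewrite (_ : 2 ^+ 6 = 64); last by rewrite -natrX.
  lra.
have D2 : (levelD2 w)%:R ^+ 2 <= 2 ^+ 6 * L ^+ 2 :> R.
  rewrite -[2 ^+ 6]/(2 ^+ (3 * 2)) exprM -exprMn; apply: lerXn2r; rewrite ?nnegrE ?mulr_ge0 ?exprn_ge0 ?expR_ge0//.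
  have h : (levelD2 w)%:R <= 5 * L + 1 := (truncn_succ (mulr_ge0 (ler0n R 5) (expR_ge0 w))).2.
  apply: (le_trans h); rewrite (_ : 2 ^+ 3 = 8); last by rewrite -natrX.
  by have := expR_ge1Dx w; rewrite -/L; lra.
have rw : (chain_depth w)%:R <= 2 ^+ 4 * w.
  have [_ h] := chain_depth_bounds w1; apply: (le_trans h); rewrite (_ : 2 ^+ 4 = 16); last by rewrite -natrX.
  lra.
set x := (levelD1 w)%:R * step_err A C2 w (sample_scale w k / 3).
set y := (levelD2 w)%:R * step_err A C2 w (expR (6 / 5 * w)).
have xy : level_err A C2 w k ^+ 2 <= 2 * x ^+ 2 + 2 * y ^+ 2.
  by rewrite /level_err -/x -/y; have := sqr_ge0 (x - y); lra.
apply: (le_trans xy); rewrite /x /y !exprMn !step_err_sqr.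
have Z0 : 0 < sample_scale w k by apply: lt_le_trans (sample_scale_ge w1 k); exact: expR_gt0.
have i1 := sample_scale_inv k.
have i0 : 0 <= (sample_scale w k ^+ 2)^-1 by rewrite invr_ge0 sqr_ge0.
rewrite /level_err_bound; move: i1 i0; rewrite (_ : (sample_scale w k / 3) ^- 2 = 9 * (sample_scale w k ^+ 2)^-1); last first.
  by field; rewrite gt_eqF.
set z := (sample_scale w k ^+ 2)^-1; set S := _ + _ + _ => zS z0.
have S17 : expR (- (17 / 88 * w)) <= S by rewrite lerDr addr_ge0 ?mulr_ge0 ?expR_ge0.
have S0 : 0 <= S by apply: le_trans z0 zS.
have r0 : 0 <= (chain_depth w)%:R :> R by [].
have q1 : 2 * ((levelD1 w)%:R ^+ 2 * (window_const A C2 * ((chain_depth w)%:R * (9 * z)))) <=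
    window_const A C2 * (2 ^+ 21 * w ^+ 3) * S.
  have u1 : (levelD1 w)%:R ^+ 2 * (chain_depth w)%:R <= 2 ^+ 12 * w ^+ 2 * (2 ^+ 4 * w) by apply: ler_pM => //; exact: sqr_ge0.
  have u2 := ler_pM (mulr_ge0 (sqr_ge0 _) r0) z0 u1 zS.
  rewrite (_ : 2 * _ = window_const A C2 * (18 * ((levelD1 w)%:R ^+ 2 * (chain_depth w)%:R * z))); last by ring.
  rewrite -[leRHS]mulrA ler_pM2l//; apply: (@le_trans _ _ (2 ^+ 5 * (2 ^+ 12 * w ^+ 2 * (2 ^+ 4 * w) * S))); last first.
    by rewrite le_eqVlt; apply/orP; left; apply/eqP; rewrite -[2 ^+ 21]/(2 ^+ (5 + (12 + 4))) !exprD; ring.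
  apply: ler_pM => //; first by rewrite !mulr_ge0 ?sqr_ge0.
  by rewrite -natrX ler_nat.
have q2 : 2 * ((levelD2 w)%:R ^+ 2 * (window_const A C2 * ((chain_depth w)%:R / expR (6 / 5 * w) ^+ 2))) <=
    window_const A C2 * (2 ^+ 11 * w ^+ 3) * S.
  have u1 : (levelD2 w)%:R ^+ 2 * (chain_depth w)%:R <= 2 ^+ 6 * L ^+ 2 * (2 ^+ 4 * w) by apply: ler_pM => //; exact: sqr_ge0.
  have ei : 0 <= (expR (6 / 5 * w) ^+ 2)^-1 by rewrite invr_ge0 sqr_ge0.
  have u2 := ler_wpM2r ei u1.
  rewrite (_ : 2 * _ = window_const A C2 * (2 * ((levelD2 w)%:R ^+ 2 * (chain_depth w)%:R * (expR (6 / 5 * w) ^+ 2)^-1))); last by ring.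
  rewrite -[leRHS]mulrA ler_pM2l//; apply: (@le_trans _ _ (2 * (2 ^+ 6 * L ^+ 2 * (2 ^+ 4 * w) * (expR (6 / 5 * w) ^+ 2)^-1))).
    by rewrite ler_pM2l.
  rewrite (_ : 2 * _ = 2 ^+ 11 * (w * (L ^+ 2 * (expR (6 / 5 * w) ^+ 2)^-1))); last first.
    by rewrite -[2 ^+ 11]/(2 ^+ (1 + (6 + 4))) !exprD expr1; ring.
  rewrite -[leRHS]mulrA ler_pM2l ?exprn_gt0//; apply: ler_pM => //.
  - exact: ltW.
  - by rewrite mulr_ge0// sqr_ge0.
  - by rewrite -[leLHS]expr1 ler_weXn2l.
  apply: le_trans S17; rewrite -!expRM_natl -expRN -expRD ler_expR; lra.
have q3 : window_const A C2 * (2 ^+ 11 * w ^+ 3) * S <= window_const A C2 * (2 ^+ 21 * w ^+ 3) * S.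
  apply: ler_wpM2r => //; rewrite ler_pM2l//; apply: ler_wpM2r; first by rewrite exprn_ge0// ltW.
  by rewrite ler_weXn2l// ler1n.
move: q1 q2 q3; rewrite (_ : 2 ^+ 22 = 2 * 2 ^+ 21 :> R); last by rewrite exprS.
set g := 2 ^+ 21; set h := 2 ^+ 11; lra.
Qed.

(** Up to the prefactor, the three pieces sum to O(L^(71/88)): their exponents are 9/11 - 2/88,
    21/22 - 14/88 and 1 - 17/88. The factor 2^27 w^3 is absorbed by L^(1/88), which completes
    L^(9/11). *)
Lemma level_err_bound_sum (n : nat) : n%:R <= 4 * L -> \sum_(k < n) level_err_bound k <= window_const A C2 * levelK w.
Proof.
move=> nL; rewrite /level_err_bound -mulr_sumr !big_split/= -!mulr_suml sumr_const card_ord.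
have ww := w2112.
have e1 (y : R) : 0 <= y -> 1 <= expR y by move=> y0; rewrite -[leLHS](@expR0 R) ler_expR.
have c1 := @count_le R (expR (9 / 11 * w)) n (expR_ge0 _).
have c2 := @count_le R (expR (21 / 22 * w)) n (expR_ge0 _).
have f1 : 1 <= expR (9 / 11 * w) by apply: e1; lra.
have f2 : 1 <= expR (21 / 22 * w) by apply: e1; lra.
set E := expR (71 / 88 * w).
have pe x : 0 <= expR x :> R := expR_ge0 x.
have b1 : (\sum_(i < n) (i%:R <= expR (9 / 11 * w) :> R)%:R) * expR (- (2 / 88 * w)) <= 2 * E.
  apply: (@le_trans _ _ (2 * expR (9 / 11 * w) * expR (- (2 / 88 * w)))).
    by apply: ler_wpM2r => //; lra.
  by rewrite -mulrA ler_pM2l// -expRD ler_expR; lra.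
have b2 : (\sum_(i < n) (i%:R <= expR (21 / 22 * w) :> R)%:R) * expR (- (14 / 88 * w)) <= 2 * E.
  apply: (@le_trans _ _ (2 * expR (21 / 22 * w) * expR (- (14 / 88 * w)))).
    by apply: ler_wpM2r => //; lra.
  by rewrite -mulrA ler_pM2l// -expRD ler_expR; lra.
have b3 : expR (- (17 / 88 * w)) *+ n <= 4 * E.
  rewrite -[leLHS]mulr_natl; apply: (@le_trans _ _ (4 * L * expR (- (17 / 88 * w)))).
    by apply: ler_wpM2r.
  by rewrite -mulrA ler_pM2l// -expRD ler_expR; lra.
rewrite -mulrA ler_pM2l//; apply: (@le_trans _ _ (2 ^+ 22 * w ^+ 3 * (8 * E))).
  apply: ler_wpM2l; last by move: b1 b2 b3; lra.
  by rewrite mulr_ge0 ?exprn_ge0 ?(ltW w0).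
have E0 : 0 <= E by exact: expR_ge0.
have wp : 0 <= w ^+ 3 by rewrite exprn_ge0 ?(ltW w0).
apply: (@le_trans _ _ (2 ^+ 27 * w ^+ 3 * E)).
  rewrite (_ : _ * (8 * E) = 2 ^+ 25 * (w ^+ 3 * E)); last first.
    by rewrite -[2 ^+ 25]/(2 ^+ (22 + 3)) exprD (_ : 2 ^+ 3 = 8) -?natrX//; ring.
  rewrite -[leRHS]mulrA; apply: ler_wpM2r; first exact: mulr_ge0.
  by rewrite ler_weXn2l// ler1n.
apply: (le_trans (ler_wpM2r E0 W3)); rewrite -expRD ler_expR; lra.
Qed.

Lemma first_level_le2 : (first_level w)%:R <= 2 * expR (3 / 11 * w).
Proof.
have [_ h] := first_level_bounds w; have := expR_ge1Dx (3 / 11 * w).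
have := w2112; move: h; lra.
Qed.

Lemma level_err_bound_le k : 4 * expR (3 / 11 * w) * (2 * level_err_bound k) <= window_const A C2 * levelK w.
Proof.
have S3 : (k%:R <= expR (9 / 11 * w) :> R)%:R * expR (- (2 / 88 * w))
   + (k%:R <= expR (21 / 22 * w) :> R)%:R * expR (- (14 / 88 * w)) + expR (- (17 / 88 * w)) <= 3.
  have n1 (b : bool) (x : R) : 0 <= x -> b%:R * expR (- x) <= 1.
    by move=> x0; rewrite mulr_ile1 ?expR_ge0 ?lern1 ?leq_b1// -[leRHS](@expR0 R) ler_expR; lra.
  have ww := w2112.
  have h1 := n1 (k%:R <= expR (9 / 11 * w) :> R) (2 / 88 * w); have h2 := n1 (k%:R <= expR (21 / 22 * w) :> R) (14 / 88 * w).
  have h3 := n1 true (17 / 88 * w); rewrite mul1r in h3.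
  have := h1 ltac:(lra); have := h2 ltac:(lra); have := h3 ltac:(lra).
  lra.
have := ler_wpM2l G0 S3; rewrite -/(level_err_bound k) => h.
have e0 : 0 <= 4 * expR (3 / 11 * w) * 2 by rewrite !mulr_ge0 ?expR_ge0.
rewrite mulrA; apply: (le_trans (ler_wpM2l e0 h)).
have E0 : 0 <= expR (3 / 11 * w) by exact: expR_ge0.
have wp : 0 <= w ^+ 3 by rewrite exprn_ge0 ?(ltW w0).
apply: (@le_trans _ _ (window_const A C2 * (2 ^+ 27 * w ^+ 3 * expR (3 / 11 * w)))).
  rewrite [leLHS](_ : _ = window_const A C2 * (24 * 2 ^+ 22 * (w ^+ 3 * expR (3 / 11 * w)))); last first.
    set g := 2 ^+ 22; set e := expR _. ring.
  rewrite ler_pM2l// -[leRHS]mulrA; apply: ler_wpM2r; first exact: mulr_ge0.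
  rewrite -[2 ^+ 27]/(2 ^+ (5 + 22)) exprD; apply: ler_wpM2r; first exact: exprn_ge0.
  by rewrite -natrX ler_nat.
rewrite ler_pM2l//; apply: (le_trans (ler_wpM2r E0 W3)); rewrite -expRD ler_expR; have := w2112; lra.
Qed.

(** Below k0 = [first_level] the threshold stays that of scale k0, and mass 3 * 2^-k is reached from
    3 * 2^-k0 by k0 - k <= k0 doublings, each costing 1 + A in [maxexc_large]. *)
Definition levelB (k : nat) : R := if (k < first_level w)%N
  then level_err A C2 w (first_level w) + (first_level w)%:R * (1 + A) else level_err A C2 w k.

Lemma levelB_sum (n : nat) : n%:R <= 4 * L ->
  \sum_(k < n) levelB k ^+ 2 <= (2 * window_const A C2 + 32 * (1 + A) ^+ 2) * levelK w.
Proof.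
move=> nL; set k0 := first_level w; set H := (2 * level_err_bound k0 + 2 * (k0%:R ^+ 2 * (1 + A) ^+ 2)).
have H0 : 0 <= H.
  by apply: addr_ge0; apply: mulr_ge0 => //; [exact: level_err_bound_ge0 | rewrite mulr_ge0 ?sqr_ge0].
have hB k : levelB k ^+ 2 <= (k%:R <= k0%:R :> R)%:R * H + level_err_bound k.
  rewrite /levelB -/k0; case: ltnP => kk; last first.
    by apply: (le_trans (level_err_sqr k)); rewrite lerDr mulr_ge0.
  rewrite ler_nat (ltnW kk) mul1r -[leLHS]addr0 lerD ?level_err_bound_ge0// /H -exprMn.
  set x := level_err _ _ _ _; set y := k0%:R * _.
  have h : x ^+ 2 <= level_err_bound k0 := level_err_sqr k0.
  have := sqr_ge0 (x - y); move: h; lra.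
apply: (@le_trans _ _ (\sum_(k < n) ((k%:R <= k0%:R :> R)%:R * H + level_err_bound k))).
  by apply: ler_sum => k _; exact: hB.
rewrite big_split/= -mulr_suml.
have s1 := level_err_bound_sum nL.
have c1 := @count_le R k0%:R n (ler0n _ _).
have k2 := first_level_le2; rewrite -/k0 in k2.
have e1 : 1 <= expR (3 / 11 * w).
  by have := expR_ge1Dx (3 / 11 * w); have := w2112; lra.
have c2 : \sum_(k < n) (k%:R <= k0%:R :> R)%:R <= 4 * expR (3 / 11 * w) by move: c1 k2 e1; lra.
have c3 := ler_wpM2r H0 c2.
have c4 : 4 * expR (3 / 11 * w) * H <= window_const A C2 * levelK w + 32 * (1 + A) ^+ 2 * levelK w.
  rewrite /H mulrDr; apply: lerD; first exact: level_err_bound_le.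
  apply: (@le_trans _ _ (4 * expR (3 / 11 * w) * (2 * ((2 * expR (3 / 11 * w)) ^+ 2 * (1 + A) ^+ 2)))).
    apply: ler_wpM2l; first by rewrite mulr_ge0 ?expR_ge0.
    apply: ler_wpM2l => //; apply: ler_wpM2r; first exact: sqr_ge0.
    by apply: lerXn2r; rewrite ?nnegrE ?mulr_ge0 ?expR_ge0.
  (* The coarse scales: k0 of them at cost k0^2 each, and 3 * 3/11 = 9/11. *)
  rewrite /levelK (_ : 9 / 11 * w = 3 * (3 / 11 * w)); last by field.
  by rewrite expRM_natl le_eqVlt; apply/orP; left; apply/eqP; ring.
move: c3 c4 s1; lra.
Qed.

End LevelSum.

(** * A majorant of the square variation for a good permutation *)

Section Level.
Context {R : realType} {d : measure_display} {T : measurableType d}.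
Variable P : probability T R.
Variables (N : nat) (psi : 'I_N -> T -> R) (A C2 w : R).
Hypothesis psi_bm : forall n, bmeas (psi n).
Hypothesis psi_on : forall i j, Ex P (fun x => psi i x * psi j x) = (i == j)%:R.
Hypothesis psi_A : forall n x, `|psi n x| <= A.
Hypothesis N3 : (3 <= N)%N.
Hypothesis A1 : 1 <= A.
Hypothesis C21 : 1 <= C2.
Hypothesis psi_good : good P psi C2 1%g.
Hypothesis LE : ln N%:R = expR w.
Hypothesis w2112 : 2112 <= w.
Hypothesis wY : expR 11 * w <= expR (w / 88).
Hypothesis AY : expR 24 * (A ^+ 2 + C2) <= expR (w / 88).
Hypothesis W3 : 2 ^+ 27 * w ^+ 3 <= expR (w / 88).

Definition variation_const : R := 48 + 72 * (2 * window_const A C2 + 32 * (1 + A) ^+ 2).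

Lemma variation_majorant (a : 'I_N -> R) : \sum_n a n ^+ 2 = 1 ->
  exists Z : T -> R, [/\ bmeas Z, forall x, 0 <= Z x, Ex P Z <= variation_const * expR (9 / 11 * w) &
    forall (pi : {set {set 'I_N}}) x, interval_partition pi ->
      \sum_(J in pi) `|\sum_(n in J) a n * psi n x| ^+ 2 <= Z x].
Proof.
move=> a1; have ww := w2112.
have w1 : 1 <= w by lra.
have N0 : (0 < N)%N by exact: ltnW (ltnW N3).
have Nr : 0 < N%:R :> R by rewrite ltr0n.
have NE : N%:R = expR (expR w) by rewrite -LE lnK// posrE.
pose mu n := a n ^+ 2 + N%:R^-1.
have muN n : N%:R^-1 <= mu n by rewrite lerDr sqr_ge0.
have mu_a n : a n ^+ 2 <= mu n by rewrite lerDl invr_ge0 ltW.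
have mu0 n : 0 < mu n by apply: lt_le_trans (muN n); rewrite invr_gt0.
have mu2 : \sum_n mu n <= 2.
  rewrite big_split/= a1 sumr_const card_ord -[X in _ + X]mulr_natl mulfV ?gt_eqF//.
pose Kx := (Num.truncn (2 * expR w + 1)).+1.
have LL := expR_ge1Dx w.
have [Kx1 Kx2] : 2 * expR w + 1 <= Kx%:R /\ Kx%:R <= 2 * expR w + 1 + 1.
  by apply: truncn_succ; rewrite addr_ge0// mulr_ge0 ?expR_ge0.
have NKx : (N < 2 ^ Kx)%N.
  rewrite -(ltr_nat R) natrX; apply: lt_le_trans (two_pow_ge Kx).
  by rewrite NE ltr_expR; lra.
set k0 := first_level w.
have k0L : k0%:R <= 4 * expR w.
  apply: (le_trans (first_level_le2 w2112)); apply: ler_pM => //; rewrite ?expR_ge0//.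
    by rewrite ler_nat.
  by rewrite ler_expR; lra.
have K0 : 0 <= levelK w by exact: expR_ge0.
(* Frozen at scale k0 for k < k0: [maxexc_large] works with one threshold for all masses, and a
   smaller threshold still satisfies the bound required of t. *)
pose t k := Num.sqrt (levelK w * (3 * 2^-1 ^+ (maxn k k0))).
have t0 k : 0 <= t k by exact: sqrtr_ge0.
have h0 k : 0 <= 2^-1 ^+ k :> R by rewrite exprn_ge0.
have tK k : t k ^+ 2 <= 3 * levelK w * 2^-1 ^+ k.
  rewrite sqr_sqrtr; last by rewrite !mulr_ge0.
  rewrite mulrA [levelK w * 3]mulrC; apply: ler_wpM2l; first exact: mulr_ge0.
  apply: ler_wiXn2l; rewrite ?leq_maxl// ?invr_ge0//.
  by rewrite invf_le1// ler1n.
exists (Zbound psi N0 a muN Kx t (levelK w)); split.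
- exact: bmeas_Zbound.
- move=> x; rewrite /Zbound addr_ge0 ?mulr_ge0//.
  by apply: sumr_ge0 => k _; apply: sumr_ge0 => i _; exact: sqr_ge0.
- have hB k : 0 <= levelB A C2 w k.
    rewrite /levelB; case: ifP => _; rewrite ?level_err_ge0// addr_ge0 ?level_err_ge0//.
    by rewrite mulr_ge0// addr_ge0// (le_trans ler01).
  have nL : Kx.+1%:R <= 4 * expR w by rewrite -natr1; lra.
  have := levelB_sum A C21 w2112 W3 nL.
  suff hE : Ex P (Zbound psi N0 a muN Kx t (levelK w)) <= 48 * levelK w + 72 * \sum_(k < Kx.+1) levelB A C2 w k ^+ 2.
    by rewrite /variation_const -/(levelK w); move: hE; set S := \sum_(k < _) _; lra.
  apply: Ex_Zbound => // k u v kK vN mk.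
  apply: (@le_trans _ _ (levelB A C2 w k * Num.sqrt (mass mu u v))); last first.
    by apply: ler_wpM2l => //; apply: ler_wsqrtr.
  rewrite /levelB -/k0; case: ltnP => kk0.
    have tE : t k = t k0 by rewrite /t maxnn (maxn_idPr (ltnW kk0)).
    rewrite tE.
    have base u' v' : (v' <= N)%N -> mass mu u' v' <= 3 * 2^-1 ^+ k0 ->
        maxexc P psi a (t k0) u' v' <= level_err A C2 w k0 * Num.sqrt (mass mu u' v').
      move=> vN' hm; apply: (level_maxexc psi_bm psi_on psi_A N3 A1 C21 psi_good LE w1 wY AY mu_a muN (leqnn k0) k0L vN' hm).
      by rewrite /t maxnn.
    have e0 := level_err_ge0 A C2 w k0.
    have mj : mass mu u v <= 2 ^+ (k0 - k) * (3 * 2^-1 ^+ k0).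
      rewrite mulrCA -[X in 2^-1 ^+ X](subnK (ltnW kk0)) exprD [X in 3 * X]mulrA -exprMn mulfV// expr1n mul1r.
      exact: mk.
    apply: (le_trans (maxexc_large psi_bm psi_on mu0 mu_a psi_A A1 (t0 k0) e0 base vN mj)).
    apply: ler_wpM2r; first exact: sqrtr_ge0.
    rewrite lerD2l ler_wpM2r ?ler_nat ?leq_subr//.
    by rewrite addr_ge0// (le_trans ler01).
  apply: (level_maxexc psi_bm psi_on psi_A N3 A1 C21 psi_good LE w1 wY AY mu_a muN kk0 _ vN mk).
    by apply: le_trans (_ : Kx%:R <= _); [rewrite ler_nat -ltnS | lra].
  by rewrite /t (maxn_idPl kk0).
- by move=> pi x hpi; apply: (partition_bound psi N0 a muN mu2 NKx K0 t0 tK).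
Qed.

End Level.

(** * From majorants to the square variation *)

Section Transfer.
Context {R : realType} {d : measure_display} {T : measurableType d}.
Variable P : probability T R.

Lemma norm2E (f : T -> R) : bmeas f -> norm2 P f = (nrm P f)%:E.
Proof.
move=> bf; rewrite /norm2 unlock.
have bf2 : bmeas (fun x => f x ^+ 2) by bm.
have -> : (\int[P]_x `|(EFin \o f) x| `^ 2)%E = (Ex P (fun x => f x ^+ 2))%:E.
  rewrite /Ex /Rintegral fineK; last first.
    exact: (integrable_fin_num measurableT (bmeas_integrable P bf2)).
  apply: eq_integral => x _; congr (_%:E).
  by rewrite -[2]/(2%:R) powR_mulrn// real_normK ?num_real.
by rewrite poweR_EFin powR12_sqrt// Ex_ge0// => x; exact: sqr_ge0.
Qed.

Lemma bmeas_sqrt (f : T -> R) : bmeas f -> bmeas (fun x => Num.sqrt (f x)).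
Proof.
move=> [mf [B hB]]; split.
  exact: (measurableT_comp (continuous_measurable_fun (@sqrt_continuous R)) mf).
exists (Num.sqrt B) => x; rewrite ger0_norm ?sqrtr_ge0// ler_wsqrtr//.
exact: le_trans (ler_norm _) (hB x).
Qed.

Lemma bmeas_square_variation (N : nat) (psi : 'I_N -> T -> R) (a : 'I_N -> R) :
  (forall n, bmeas (psi n)) -> bmeas (square_variation psi a).
Proof. by move=> psi_bm; rewrite /square_variation; apply: bmeas_sqrt; bm. Qed.

Lemma nrm_square_variation_le (N : nat) (psi : 'I_N -> T -> R) (a : 'I_N -> R) (Z : T -> R) :
  (forall n, bmeas (psi n)) -> bmeas Z -> (forall x, 0 <= Z x) ->
  (forall (pi : {set {set 'I_N}}) x, interval_partition pi ->
      \sum_(J in pi) `|\sum_(n in J) a n * psi n x| ^+ 2 <= Z x) ->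
  nrm P (square_variation psi a) <= Num.sqrt (Ex P Z).
Proof.
move=> psi_bm bZ Z0 hZ; have bv := bmeas_square_variation a psi_bm.
apply: ler_wsqrtr; apply: Ex_le; [bm..|] => x.
rewrite sqr_sqrtr; last exact: bigmax_ge_id.
by apply/bigmax_leP; split => // pi hpi; exact: hZ.
Qed.

End Transfer.

Section Permuted.
Context {R : realType} {d : measure_display} {T : measurableType d}.
Variable P : probability T R.
Variables (N : nat) (phi : 'I_N -> T -> R) (s : 'S_N).

Lemma netfun_perm (q : nat) (v : {ffun 'I_q -> 'I_N * 'I_(N ^ 10)}) :
  netfun (fun n => phi (s n)) v = netfun phi [ffun r => (s (v r).1, (v r).2)].
Proof. by apply/funext => x; rewrite /netfun; congr (thr _ _); apply: eq_bigr => r _; rewrite ffunE. Qed.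

(** Net functions of the reordered system are those of [phi] with relabelled indices; so the
    estimates above may all be stated for the identity permutation. *)
Lemma good_perm (C2 : R) : good P phi C2 s -> good P (fun n => phi (s n)) C2 1%g.
Proof.
move=> gs u M q m v M0 q0 hq; rewrite netfun_perm.
apply: leq_ltn_trans (gs u M q m [ffun r => (s (v r).1, (v r).2)] M0 q0 hq).
by rewrite leq_eqVlt; apply/orP; left; apply/eqP; apply: eq_card => n; rewrite !inE perm1.
Qed.

End Permuted.

Section Variation.
Context {R : realType} {d : measure_display} {T : measurableType d}.
Variable P : probability T R.
Variables (N : nat) (psi : 'I_N -> T -> R) (A : R).
Hypothesis psi_bm : forall n, bmeas (psi n).
Hypothesis psi_on : forall i j, Ex P (fun x => psi i x * psi j x) = (i == j)%:R.
Hypothesis psi_A : forall n x, `|psi n x| <= A.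
Hypothesis A1 : 1 <= A.

(** Cauchy-Schwarz on each block, valid for any order; this serves the bounded values of N. *)
Lemma variation_trivial (a : 'I_N -> R) :
  nrm P (square_variation psi a) <= A * Num.sqrt N%:R * nrm P (lin_comb psi a).
Proof.
pose z : R := (A ^+ 2 * N%:R) * \sum_n a n ^+ 2.
have A0 : 0 <= A by apply: le_trans A1.
have s0 : 0 <= \sum_n a n ^+ 2 by apply: sumr_ge0 => n _; exact: sqr_ge0.
have z0 : 0 <= z by rewrite !mulr_ge0.
have hz : Num.sqrt (Ex P (fun=> z)) = A * Num.sqrt N%:R * nrm P (lin_comb psi a).
  rewrite Ex_cst nrm_lin// /z sqrtrM; last by rewrite mulr_ge0 ?sqr_ge0.
  by rewrite sqrtrM ?sqr_ge0// sqrtr_sqr ger0_norm.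
rewrite -hz; apply: nrm_square_variation_le => //; first exact: bmeas_cst.
move=> pi x /andP[pp _].
apply: (@le_trans _ _ (\sum_(J in pi) (A ^+ 2 * N%:R) * \sum_(n in J) a n ^+ 2)).
  apply: ler_sum => J _.
  have c0 : 0 <= \sum_(n in J) a n ^+ 2 by apply: sumr_ge0 => n _; exact: sqr_ge0.
  have cs := cauchy_schwarz_sum (mem J) (fun n => `|a n|) (fun n => `|psi n x|).
  have n1 : `|\sum_(n in J) a n * psi n x| <= \sum_(n in J) `|a n| * `|psi n x|.
    by apply: (le_trans (ler_norm_sum _ _ _)); apply: ler_sum => n _; rewrite normrM.
  have q1 : \sum_(n in J) `|psi n x| ^+ 2 <= A ^+ 2 * N%:R.
    apply: (@le_trans _ _ (\sum_(n < N) A ^+ 2)); last by rewrite sumr_const card_ord mulr_natr.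
    rewrite big_mkcond; apply: ler_sum => n _; case: ifP => _; last exact: sqr_ge0.
    by apply: lerXn2r; rewrite ?nnegrE.
  have q2 : \sum_(n in J) `|a n| ^+ 2 = \sum_(n in J) a n ^+ 2.
    by apply: eq_bigr => n _; rewrite real_normK ?num_real.
  apply: (@le_trans _ _ ((Num.sqrt (\sum_(n in J) a n ^+ 2) * Num.sqrt (A ^+ 2 * N%:R)) ^+ 2)).
    apply: lerXn2r; rewrite ?nnegrE ?mulr_ge0 ?sqrtr_ge0//.
    apply: (le_trans n1); apply: (le_trans cs); rewrite q2.
    by apply: ler_wpM2l; [exact: sqrtr_ge0 | exact: ler_wsqrtr].
  by rewrite exprMn !sqr_sqrtr ?mulr_ge0 ?sqr_ge0// mulrC.
rewrite -mulr_sumr /z -(set_partition_big _ pp) /=.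
by rewrite (eq_bigl xpredT)// => n; rewrite inE.
Qed.

Variables (C2 w : R).
Hypothesis N3 : (3 <= N)%N.
Hypothesis C21 : 1 <= C2.
Hypothesis psi_good : good P psi C2 1%g.
Hypothesis LE : ln N%:R = expR w.
Hypothesis w2112 : 2112 <= w.
Hypothesis wY : expR 11 * w <= expR (w / 88).
Hypothesis AY : expR 24 * (A ^+ 2 + C2) <= expR (w / 88).
Hypothesis W3 : 2 ^+ 27 * w ^+ 3 <= expR (w / 88).

Lemma variation_good (a : 'I_N -> R) :
  nrm P (square_variation psi a) <= Num.sqrt (variation_const A C2) * expR (9 / 22 * w) * nrm P (lin_comb psi a).
Proof.
have s0 : 0 <= \sum_n a n ^+ 2 by apply: sumr_ge0 => n _; exact: sqr_ge0.
rewrite nrm_lin//; have [sz|sn] := eqVneq (\sum_n a n ^+ 2) 0.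
  have az n : a n = 0.
    apply/eqP; rewrite -sqrf_eq0; apply/eqP; apply/le_anti; rewrite sqr_ge0 andbT -sz.
    by rewrite (bigD1 n)//= lerDl sumr_ge0// => i _; exact: sqr_ge0.
  rewrite sz sqrtr0 mulr0 -[leRHS](sqrtr0 R) -[X in _ <= Num.sqrt X](Ex_cst P 0).
  apply: nrm_square_variation_le => //; first exact: bmeas_cst.
  move=> pi x _; rewrite big1// => J _; rewrite big1 ?normr0 ?expr0n// => n _.
  by rewrite az mul0r.
set r := \sum_n a n ^+ 2 in s0 sn *.
have r0 : 0 < r by rewrite lt_neqAle eq_sym sn.
have sr0 : 0 < Num.sqrt r by rewrite sqrtr_gt0.
pose b n := a n / Num.sqrt r.
have b1 : \sum_n b n ^+ 2 = 1.
  rewrite /b; under eq_bigr do rewrite exprMn exprVn sqr_sqrtr//.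
  by rewrite -mulr_suml mulfV.
have [Z [bZ Z0 EZ hZ]] := variation_majorant psi_bm psi_on psi_A N3 A1 C21 psi_good LE w2112 wY AY W3 b1.
have c0 : 0 <= variation_const A C2.
  rewrite /variation_const; have := window_const_ge1 A C21; have := sqr_ge0 (1 + A); lra.
apply: (@le_trans _ _ (Num.sqrt (Ex P (fun x => r * Z x)))).
  apply: nrm_square_variation_le => //; first by bm.
    by move=> x; rewrite mulr_ge0.
  move=> pi x hpi; apply: le_trans (ler_wpM2l s0 (hZ pi x hpi)).
  rewrite mulr_sumr le_eqVlt; apply/orP; left; apply/eqP; apply: eq_bigr => J _.
  rewrite -{1}(sqr_sqrtr s0) -[X in X ^+ 2 * _](ger0_norm (ltW sr0)) -exprMn -normrM mulr_sumr.
  congr (`|_| ^+ 2); apply: eq_bigr => n _.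
  by rewrite /b mulrA mulrCA mulfV ?gt_eqF// mulr1.
rewrite ExZ//; apply: (@le_trans _ _ (Num.sqrt (r * (variation_const A C2 * expR (9 / 11 * w))))).
  by apply: ler_wsqrtr; exact: ler_wpM2l.
rewrite !sqrtrM// mulrC (_ : 9 / 11 * w = 9 / 22 * w + 9 / 22 * w); last by field.
by rewrite expRD -expr2 sqrtr_sqr ger0_norm ?expR_ge0.
Qed.

End Variation.

(** * Probability of the good event, small N and the final constants *)

Lemma perm_prob_mono (R : realType) (N : nat) (E F : 'S_N -> Prop) :
  (forall s, E s -> F s) -> perm_prob R E <= perm_prob R F.
Proof.
move=> EF; rewrite /perm_prob ler_wpM2r ?invr_ge0// ler_nat; apply: subset_leq_card.
by apply/fintype.subsetP => s; rewrite !inE => /asboolP/asboolP Es; apply/asboolP/asboolP; exact: EF.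
Qed.

Lemma perm_prob_true (R : realType) (N : nat) (E : 'S_N -> Prop) :
  (forall s, E s) -> perm_prob R E = 1.
Proof.
move=> Es; rewrite /perm_prob (eq_card (B := {: 'S_N})); last first.
  by move=> s; rewrite !inE; apply/asboolP.
by rewrite divff// pnatr_eq0 -lt0n; apply/card_gt0P; exists 1%g.
Qed.

(** From e^(w / 88) >= (w / 352)^4, which exceeds S w^3 once w >= 352^4 S, for S above all the
    constants involved. The bound 2112 = 24 * 88 ensures e^(w / 88) >= e^24. *)
Lemma expR_dominates (R : realType) (A C2 : R) : exists X : R, [/\ 2112 <= X, 0 <= X &
  forall w, X <= w -> [/\ expR 11 * w <= expR (w / 88),
    expR 24 * (A ^+ 2 + C2) <= expR (w / 88) & 2 ^+ 27 * w ^+ 3 <= expR (w / 88)]].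
Proof.
pose Q : R := 352 ^+ 4.
have Q1 : 1 <= Q by rewrite exprn_ege1// ler1n.
pose S : R := expR 11 + `|expR 24 * (A ^+ 2 + C2)| + 2 ^+ 27 + 2112.
have e11 : 0 <= expR 11 :> R by exact: expR_ge0.
have e24 : 0 <= `|expR 24 * (A ^+ 2 + C2)| by [].
have e27 : 0 <= 2 ^+ 27 :> R by rewrite exprn_ge0.
have S0 : 2112 <= S by rewrite /S; set z := 2 ^+ 27 in e27 *; lra.
exists (Q * S).
have QS : S <= Q * S by rewrite ler_peMl//; lra.
have QS2 : 2112 <= Q * S by lra.
split; [by []|by lra|] => w hw.
have w1 : 1 <= w by lra.
have w0 : 0 <= w by lra.
have Q0 : 0 < Q by lra.
have h4 : S * w ^+ 3 <= expR (w / 88).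
  apply: (@le_trans _ _ ((w / 352) ^+ 4)).
    rewrite expr_div_n -/Q ler_pdivlMr// (_ : S * w ^+ 3 * Q = Q * S * w ^+ 3); last by ring.
    by rewrite [w ^+ 4]exprS; apply: ler_wpM2r hw; exact: exprn_ge0.
  rewrite (_ : w / 88 = 4%:R * (w / 352)); last by field.
  have e := expR_ge1Dx (w / 352).
  rewrite expRM_natl; apply: lerXn2r; last by apply: le_trans e; rewrite lerDr.
    by rewrite nnegrE; exact: divr_ge0 w0 (ler0n R 352).
  by rewrite nnegrE; exact: expR_ge0.
have w31 : 1 <= w ^+ 3 by rewrite exprn_ege1.
have w3w : w <= w ^+ 3 by rewrite -[leLHS]expr1 ler_weXn2l.
have hS (y : R) : 0 <= y -> y <= S -> y * w ^+ 3 <= expR (w / 88).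
  by move=> y0 yS; apply: le_trans h4; apply: ler_wpM2r => //; lra.
split.
- apply: le_trans (hS (expR 11) e11 _); first exact: ler_wpM2l.
  by rewrite /S; set z := 2 ^+ 27 in e27 *; lra.
- apply: le_trans (hS `|expR 24 * (A ^+ 2 + C2)| e24 _); last by rewrite /S; set z := 2 ^+ 27 in e27 *; lra.
  by apply: (le_trans (ler_norm _)); rewrite ler_peMr.
- apply: (hS _ e27); rewrite /S; set z := 2 ^+ 27 in e27 *; lra.
Qed.

Theorem theorem1 (R : realType) :
  exists c : R, 0 < c /\
  forall A eps gamma : R, 0 < A -> 0 < eps -> 1 < gamma ->
  exists C : R,
  forall (N : nat) (d : measure_display) (T : measurableType d)
    (P : probability T R) (phi : 'I_N -> {mfun T >-> R}),
  (0 < N)%N ->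
  orthonormal_system P phi ->
  (forall (n : 'I_N) (x : T), `|phi n x| <= A) ->
  1 - c * N%:R `^ (- gamma) <=
  perm_prob R (fun sigma : 'S_N =>
    forall a : 'I_N -> R,
      let psi := fun n : 'I_N => phi (sigma n) : T -> R in
      (norm2 P (square_variation psi a) <=
       (C * ln (N%:R : R) `^ (9 / 22 + eps))%:E * norm2 P (lin_comb psi a))%E).
Proof.
exists 1; split=> // A' eps gamma A'0 eps0 gamma1.
(* The uniform bound is raised to at least 1, as the estimates require; 17 + gamma is the value
   asked for by [good_prob]. *)
pose A := Num.max A' 1; pose C2 := 17 + gamma.
have A1 : 1 <= A by rewrite le_max lexx orbT.
have AA : A' <= A by rewrite le_max lexx.
have C21 : 1 <= C2 by rewrite /C2; lra.
have [X [X1 X0 hX]] := expR_dominates A C2.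
(* Above N0, ln ln N >= X and the estimate for good permutations applies; for 2 <= N <= N0 the
   trivial bound is absorbed into [Cs], using ln N >= ln 2. *)
pose N0 := (Num.truncn (expR (expR X))).+1.
have [N0X _] : expR (expR X) <= N0%:R /\ N0%:R <= expR (expR X) + 1 := truncn_succ (expR_ge0 _).
have p0 : 0 < 9 / 22 + eps by lra.
have l2 : 0 < ln 2 :> R by rewrite ln_gt0// ltr1n.
pose Cs := A * Num.sqrt N0%:R / ln 2 `^ (9 / 22 + eps).
have A0 : 0 <= A by lra.
have Cs0 : 0 <= Cs by rewrite divr_ge0 ?powR_ge0// mulr_ge0 ?sqrtr_ge0.
exists (Num.sqrt (variation_const A C2) + Cs) => N d T P phi Npos phi_on phi_A'.
have phi_bm n : bmeas (phi n : T -> R) by split; [exact: measurable_funP | exists A'].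
have phi_A n x : `|phi n x| <= A by apply: le_trans (phi_A' n x) AA.
have phi_onE i j : Ex P (fun x => phi i x * phi j x) = (i == j)%:R.
  by rewrite /Ex /Rintegral phi_on.
(* For N = 1 the logarithm vanishes, but the required probability is 0. *)
have [N1|N2] := leqP N 1.
  have -> : N%:R `^ (- gamma) = 1 :> R.
    by rewrite (_ : N = 1%N) ?powR1//; apply/eqP; rewrite eqn_leq N1.
  by rewrite mul1r subrr; apply: divr_ge0; exact: ler0n.
set E := fun sigma : 'S_N => _.
have red (s : 'S_N) (c : R) : c <= (Num.sqrt (variation_const A C2) + Cs) * ln N%:R `^ (9 / 22 + eps) ->
    (forall a, nrm P (square_variation (fun n => phi (s n) : T -> R) a) <=
      c * nrm P (lin_comb (fun n => phi (s n) : T -> R) a)) -> E s.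
  move=> hc h a /=; rewrite !norm2E//.
  - by rewrite -EFinM lee_fin; apply: (le_trans (h a)); rewrite ler_wpM2r ?nrm_ge0.
  - by apply: bmeas_lin.
  - by apply: bmeas_square_variation.
have on_s (s : 'S_N) i j : Ex P (fun x => phi (s i) x * phi (s j) x) = (i == j)%:R.
  by rewrite phi_onE (inj_eq perm_inj).
have lN : ln 2 <= ln N%:R :> R by rewrite ler_ln ?posrE ?ltr0n// ler_nat.
have lp0 : 0 < ln 2 `^ (9 / 22 + eps) by rewrite powR_gt0.
have sc0 : 0 <= Num.sqrt (variation_const A C2) by exact: sqrtr_ge0.
have lpN : ln 2 `^ (9 / 22 + eps) <= ln N%:R `^ (9 / 22 + eps).
  by apply: ge0_ler_powR => //; rewrite ?nnegrE ?ltW// (lt_le_trans l2).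
have [NN0|N0N] := leqP N N0.
  rewrite perm_prob_true; first by rewrite mul1r lerBlDr lerDl powR_ge0.
  move=> s; apply: (red s (A * Num.sqrt N%:R)); last first.
    by move=> a; apply: (variation_trivial (fun n => phi_bm (s n)) (on_s s) (fun n => phi_A (s n)) A1).
  apply: (@le_trans _ _ (Cs * ln 2 `^ (9 / 22 + eps))).
    rewrite /Cs divfK ?gt_eqF//; apply: ler_wpM2l => //; apply: ler_wsqrtr.
    by rewrite ler_nat.
  apply: ler_pM => //; [exact: ltW | by rewrite lerDr].
have NX : expR (expR X) <= N%:R by apply: (le_trans N0X); rewrite ler_nat ltnW.
have Nr : 0 < N%:R :> R by rewrite ltr0n.
have LX : expR X <= ln N%:R by rewrite -ler_expR lnK ?posrE.
have L0 : 0 < ln N%:R :> R by apply: lt_le_trans LX; exact: expR_gt0.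
pose w : R := ln (ln N%:R).
have wE : ln N%:R = expR w by rewrite lnK ?posrE.
have Xw : X <= w by rewrite -ler_expR -wE.
have [h1 h2 h3] := hX w Xw.
have w2112 : 2112 <= w by exact: le_trans X1 Xw.
have N3 : (3 <= N)%N.
  rewrite -(ler_nat R); apply: le_trans NX; have := expR_ge1Dx (expR X); have := expR_ge1Dx X; lra.
have gamma0 : 0 <= gamma by exact: ltW (lt_trans ltr01 gamma1).
rewrite mul1r; apply: (le_trans (good_prob phi_bm phi_onE N3 gamma0 (lexx C2))).
apply: perm_prob_mono => s gs.
apply: (red s (Num.sqrt (variation_const A C2) * expR (9 / 22 * w))); last first.
  by move=> a; apply: (variation_good (fun n => phi_bm (s n)) (on_s s) (fun n => phi_A (s n)) A1 N3 C21 (good_perm gs) wE w2112 h1 h2 h3).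
apply: ler_pM; [by [] | exact: expR_ge0 | by rewrite lerDl |].
rewrite /powR gt_eqF// -/w ler_expR; apply: ler_wpM2r; first exact: le_trans X0 Xw.
by rewrite lerDl ltW.
Qed.
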